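(* There exists an absolute constant $C>0$ such that the following holds. Let $n\ge 1$ and let $(\xi_i,\mathcal{F}_i)_{i=0,\dots,n}$ be a sequence of martingale differences on a probability space $(\Omega,\mathcal{F},\mathbf{P})$, with $\xi_0=0$ and $\{\emptyset,\Omega\}=\mathcal{F}_0\subseteq\dots\subseteq\mathcal{F}_n\subseteq\mathcal{F}$. Let $S_n=\sum_{i=1}^n\xi_i$ and $\langle S\rangle_n=\sum_{i=1}^n\mathbf{E}[\xi_i^2|\mathcal{F}_{i-1}]$. Assume: (A1) there is a number $\epsilon\in(0,1/2]$ such that $\big|\mathbf{E}[\xi_i^k|\mathcal{F}_{i-1}]\big|\le \frac12 k!\,\epsilon^{k-2}\,\mathbf{E}[\xi_i^2|\mathcal{F}_{i-1}]$ a.s. for all integers $k\ge 2$ and all $1\le i\le n$; (A2) there is a number $\delta\in[0,1]$ such that $|\langle S\rangle_n-1|\le\delta^2$ a.s. Then, for all $x\ge 0$, $$\mathbf{P}(S_n>x)\le\big(1-\Phi(\widehat{x})\big)\Big[1+C\,(1+\widehat{x})\big(\lambda^2\epsilon+\lambda\delta^2+\epsilon|\log\epsilon|+\delta\big)\Big],$$ where $$\widehat{x}=\frac{2x/\sqrt{1+\delta^2}}{1+\sqrt{1+2x\epsilon/(1+\delta^2)}},\qquad \lambda=\frac{2x/(1+\delta^2)}{1+2x\epsilon/(1+\delta^2)+\sqrt{1+2x\epsilon/(1+\delta^2)}}\in[0,\epsilon^{-1}).$$ In particular, for all $0\le x=o\big((\sqrt[3]{\epsilon}+\delta)^{-1}\big)$,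 $$\mathbf{P}(S_n>x)\le\big(1-\Phi(\widehat{x})\big)\,[1+o(1)],\qquad \max\{\epsilon,\delta\}\to 0;$$ that is, for any sequence of such martingales with parameters $(\epsilon_m,\delta_m)$ such that $\max\{\epsilon_m,\delta_m\}\to0$, and any $x_m\ge 0$ with $x_m(\sqrt[3]{\epsilon_m}+\delta_m)\to0$, the inequality holds (for the $m$-th martingale at $x=x_m$) with a factor $1+r_m$ in place of $1+o(1)$, where $r_m\to 0$.
   Context: $\Phi$ is the standard normal distribution function. Martingale differences: $\xi_i$ is $\mathcal{F}_i$-measurable, integrable and $\mathbf{E}[\xi_i|\mathcal{F}_{i-1}]=0$ a.s. for $1\le i\le n$ (here with moments of all orders). ''Absolute constant'' means $C$ depends on nothing (not on $n$, the martingale, $\epsilon$, $\delta$ or $x$). *)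

(* Defs.v *)
From HB Require Import structures.
From mathcomp Require Import all_boot all_order all_algebra.
From mathcomp Require Import all_classical all_reals all_analysis.
(* [all_analysis] does not re-export the [measurableType] instance of [\bar R]. *)
From mathcomp Require Import measurable_realfun.

Set Implicit Arguments.
Unset Strict Implicit.
Unset Printing Implicit Defensive.

Import Order.TTheory GRing.Theory Num.Theory.
Import numFieldNormedType.Exports.

Local Open Scope classical_set_scope.
Local Open Scope ring_scope.

Section conditional_expectation.
Context (d : measure_display) (T : measurableType d) (R : realType).
Variable P : probability T R.

(* For a sigma-algebra G, the measurable sets of [g_sigma_algebraType G] are
   exactly the elements of G ([measurable_g_measurableTypeE]). *)
Definition measurable_wrt (G : set (set T)) (X : T -> R) : Prop :=
  measurable_fun [set: g_sigma_algebraType G] (X : g_sigma_algebraType G -> R).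

Definition is_condexp (G : set (set T)) (X Y : T -> R) : Prop :=
  [/\ measurable_wrt G Y,
      P.-integrable setT (EFin \o Y) &
      forall A, G A ->
        (\int[P]_(w in A) (Y w)%:E = \int[P]_(w in A) (X w)%:E)%E].

(* A chosen version of E[X | G]. The value 0 is taken only when there is no
   version at all, which cannot happen for integrable X, by [condexpP]; the
   choice of the version is immaterial, by [is_condexp_ae_unique]. *)
Definition condexp (G : set (set T)) (X : T -> R) : T -> R :=
  xget (cst 0) [set Y | is_condexp G X Y].

End conditional_expectation.

Section conditional_expectation_map.
Context (d d' : measure_display) (T : measurableType d) (T' : measurableType d').
Context (R : realType).
Variables (P : probability T R) (phi : {mfun T >-> T'}).

Let mphi : measurable_fun setT phi. Proof. exact: measurable_funPT. Qed.

Let PG : probability T' R := distribution P phi.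

Let mpre (A : set T') : measurable A -> measurable (phi @^-1` A).
Proof. by move=> mA; rewrite -[X in measurable X]setTI; exact: mphi. Qed.

Lemma condexp_map_exists (X : T -> R) : P.-integrable setT (EFin \o X) ->
  exists g : T' -> R, [/\ measurable_fun setT g,
    P.-integrable setT (EFin \o (g \o phi)) &
    forall A, measurable A ->
      (\int[P]_(w in phi @^-1` A) ((g \o phi) w)%:E =
       \int[P]_(w in phi @^-1` A) (X w)%:E)%E].
Proof.
move=> iX; pose nu := pushforward (induced_charge iX) phi.
have nuP : nu `<< PG.
  apply/null_content_dominatesP => A mA PA0.
  apply: (@null_set_integral _ T R P) => //; first exact: mpre.
  exact: (measurable_funS measurableT (@subsetT _ _) (measurable_int _ iX)).
have [f [fin iRN nuE]] : exists f : T' -> \bar R,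
    [/\ forall w, f w \is a fin_num, PG.-integrable setT f &
     forall A, measurable A -> nu A = (\int[PG]_(w in A) f w)%E].
  pose f0 := Radon_Nikodym nu PG.
  exists (f0 mphi); split => [w||A mA].
  - exact: Radon_Nikodym_fin_num.
  - exact: Radon_Nikodym_integrable.
  - by rewrite -Radon_Nikodym_integral.
have mf := measurable_int _ iRN.
have fE : EFin \o (fine \o f) = f by apply/funext => w /=; rewrite fineK.
have if_ : P.-integrable [set: T] (f \o phi).
  apply/integrableP; split; first exact: measurableT_comp.
  case/integrableP : iRN => _; rewrite ge0_integral_pushforward//.
  exact: measurableT_comp.
exists (fine \o f); split.
- by apply/measurable_EFinP; rewrite fE.
- by rewrite (_ : _ \o _ = (EFin \o (fine \o f)) \o phi)// fE.
- move=> A mA; transitivity (nu A); last by [].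
  rewrite nuE// integral_pushforward//.
    by apply: eq_integral => w _ /=; rewrite fineK.
  exact: (integrableS measurableT (mpre mA) _ if_).
Qed.

Lemma condexp_map_unique (g h : T' -> R) :
  measurable_fun setT g -> measurable_fun setT h ->
  P.-integrable setT (EFin \o (g \o phi)) ->
  P.-integrable setT (EFin \o (h \o phi)) ->
  (forall A, measurable A ->
      (\int[P]_(w in phi @^-1` A) ((g \o phi) w)%:E =
       \int[P]_(w in phi @^-1` A) ((h \o phi) w)%:E)%E) ->
  {ae P, forall w, g (phi w) = h (phi w)}.
Proof.
move=> mg mh ig ih gh.
have mg' : measurable_fun setT (EFin \o g) by exact/measurable_EFinP.
have mh' : measurable_fun setT (EFin \o h) by exact/measurable_EFinP.
have igG : PG.-integrable setT (EFin \o g) by exact: integrable_pushforward.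
have [|N [mN N0 ghN]] := integral_ae_eq measurableT igG mh'.
  move=> E _ mE; rewrite !integral_pushforward//; last 2 first.
  - exact: (integrableS measurableT (mpre mE) _ ih).
  - exact: (integrableS measurableT (mpre mE) _ ig).
  exact: gh.
exists (phi @^-1` N); split; [exact: mpre|by []|].
by move=> w ghw; apply: ghN => /= /(_ I) [].
Qed.

End conditional_expectation_map.

Section conditional_expectation_theory.
Context (d : measure_display) (T : measurableType d) (R : realType).
Variable P : probability T R.
Variable G : set (set T).
Hypotheses (sG : sigma_algebra setT G) (GT : G `<=` measurable).

Let measurable_GE (A : set (g_sigma_algebraType G)) : measurable A = G A.
Proof. by rewrite -[RHS](congr1 (@^~ A) (measurable_g_measurableTypeE sG)). Qed.

Let id_G : T -> g_sigma_algebraType G := fun x => x.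

Let measurable_id_G : measurable_fun setT id_G.
Proof. by move=> _ A; rewrite measurable_GE setTI; exact: GT. Qed.

HB.instance Definition _ :=
  isMeasurableFun.Build _ _ _ _ id_G measurable_id_G.

Lemma condexpP (X : T -> R) :
  P.-integrable setT (EFin \o X) -> is_condexp P G X (condexp P G X).
Proof.
move=> /(condexp_map_exists (id_G : {mfun T >-> _}))[Y [mY iY YX]].
apply: (xgetPex (cst 0)); exists Y; split => // A GA.
by apply: YX; rewrite measurable_GE.
Qed.

Lemma is_condexp_ae_unique (X Y Z : T -> R) :
  is_condexp P G X Y -> is_condexp P G X Z -> {ae P, forall w, Y w = Z w}.
Proof.
move=> [mY iY YX] [mZ iZ ZX].
apply: (condexp_map_unique (phi := id_G : {mfun T >-> _}) mY mZ) => // A.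
by rewrite measurable_GE => GA; rewrite [LHS](YX _ GA) [RHS](ZX _ GA).
Qed.

End conditional_expectation_theory.

Section martingale_differences.
Context (d : measure_display) (T : measurableType d) (R : realType).
Variables (P : probability T R) (n : nat).
Variables (xi : nat -> T -> R) (F : nat -> set (set T)).

(* Only the indices 0, ..., n are constrained and used. *)
Record martingale_differences : Prop := {
  md_sigma_algebra : forall i, (i <= n)%N -> sigma_algebra setT (F i) ;
  md_sub : forall i, (i <= n)%N -> F i `<=` measurable ;
  md_filtration : forall i, (i < n)%N -> F i `<=` F i.+1 ;
  md_trivial : F 0 = [set set0; setT] ;
  md_xi0 : forall w, xi 0 w = 0 ;
  md_adapted : forall i, (i <= n)%N -> measurable_wrt (F i) (xi i) ;
  md_moments : forall i k, (i <= n)%N ->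
    P.-integrable setT (fun w => (xi i w ^+ k)%:E) ;
  md_condexp0 : forall i, (1 <= i <= n)%N ->
    {ae P, forall w, condexp P (F i.-1) (xi i) w = 0} }.

Definition mart_sum (w : T) : R := \sum_(1 <= i < n.+1) xi i w.

Definition cond_moment (i k : nat) : T -> R :=
  condexp P (F i.-1) (fun w => xi i w ^+ k).

Definition quad_char (w : T) : R := \sum_(1 <= i < n.+1) cond_moment i 2 w.

Definition bernstein_condition (eps : R) : Prop :=
  0 < eps <= 1 / 2 /\
  forall i k, (1 <= i <= n)%N -> (2 <= k)%N ->
    {ae P, forall w, `|cond_moment i k w| <=
      1 / 2 * (k`!)%:R * eps ^+ (k - 2) * cond_moment i 2 w}.

Definition quad_char_condition (delta : R) : Prop :=
  0 <= delta <= 1 /\ {ae P, forall w, `|quad_char w - 1| <= delta ^+ 2}.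

Definition mart_tail (x : R) : R := fine (P [set w | x < mart_sum w]).

End martingale_differences.

Section normal_comparison.
Context (R : realType).

Definition Phi (x : R) : R := fine (normal_prob 0 1 `]-oo, x]).

Definition xhat (eps delta x : R) : R :=
  (2 * x / Num.sqrt (1 + delta ^+ 2)) /
  (1 + Num.sqrt (1 + 2 * x * eps / (1 + delta ^+ 2))).

Definition lambda (eps delta x : R) : R :=
  (2 * x / (1 + delta ^+ 2)) /
  (1 + 2 * x * eps / (1 + delta ^+ 2)
     + Num.sqrt (1 + 2 * x * eps / (1 + delta ^+ 2))).

End normal_comparison.

(* Main.v *)
(* Put [q = 1 / (1 - lambda eps)].  Bernstein's condition bounds the conditional
   Laplace transform [m_i] of [xi_i] at [lambda] by
   [1 + (lambda^2 q / 2) E[xi_i^2 | F_(i-1)]], and [lambda] is the saddle point: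
   tilting by [Z = prod_i e^(lambda xi_i) / m_i] gives
     [P(S > x) <= e^(-xhat^2/2) E[Z e^(-lambda (S - x)); S > x]].
   The right-hand side is at most [e^(-xhat^2/2) <= C (1 + xhat) (1 - Phi xhat)],
   which is enough unless the error term is small.  When it is small, the
   variables [eta_i = xi_i - lambda s_i], with [s_i] the conditional variance of
   [xi_i], are nearly martingale differences of conditional variance [s_i] for
   the tilted measure.  Exchanging them one by one in [Phi ((y - U_k) / sqrt a_k)],
   where [U_k = eta_1 + ... + eta_k] and [a_k] is the remaining variance, yields
   by Bolthausen's method a Berry-Esseen bound of order
   [lambda^2 eps + eps |log eps| + delta].  For a Gaussian [Y] in place of [S - x]
   the expectation [E[e^(-lambda Y); Y > 0]] is the Mills ratio
   [e^(lambda^2/2) (1 - Phi lambda)], and [lambda] is close to [xhat]. *)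

From HB Require Import structures.
Require Import Defs.
From mathcomp Require Import all_boot all_order all_algebra.
From mathcomp Require Import all_classical all_reals all_analysis.
From mathcomp Require Import measurable_realfun.
From mathcomp Require Import ring lra.

Set Implicit Arguments.
Unset Strict Implicit.
Unset Printing Implicit Defensive.

Import Order.TTheory GRing.Theory Num.Theory.
Import numFieldNormedType.Exports.
Import HBSimple HBNNSimple.

Local Open Scope classical_set_scope.
Local Open Scope ring_scope.

(** * Gaussian estimates *)

(** Three obstacles shape the proof. Under the tilted weight a step has a conditional mean of order
    [lambda^2 eps] times its variance instead of zero, and a relative variance error of order
    [lambda eps], too large to be summed directly. The square of the second is of order [eps] times
    the first, so an arithmetic-geometric splitting hides it in the other two errors. The variances
    being random, the exchange uses the predictable remaining variance plus a floor [g^2]. Its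
    third-order errors depend on the current position; convexity moves them to the final position,
    where they telescope to the mean inverse distance of the final sum to [y]. That mean is again
    governed by the unknown Kolmogorov distance [D]: each dyadic shell costs a constant, whence the
    logarithm, and [D] returns with a factor made small by taking [g] a large multiple of [eps].
    Finally, neither a tilted measure nor conditional expectations under it are built: conditional
    facts are inequalities between integrals over events or against measurable test functions, and
    almost sure bounds are made to hold everywhere by clipping. *)

Section mean_value_bounds.
Context {R : realType}.
Implicit Types f df : R -> R.

Lemma is_derive_continuous f df :
  (forall t : R, is_derive t 1 f (df t)) -> continuous f.
Proof.
by move=> fd t; apply: differentiable_continuous; apply/derivable1_diffP; case: (fd t).
Qed.

Lemma mvt_le_exists f df (a b : R) : a <= b ->
  (forall t : R, a <= t <= b -> is_derive t 1 f (df t)) ->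
  exists2 c, a <= c <= b & f b - f a = df c * (b - a).
Proof.
move=> ab fd; have [||c cab E] := @MVT_segment _ f df a b ab.
- by move=> t /subset_itv_oo_cc; rewrite in_itv/=; exact: fd.
- by apply: derivable_within_continuous => t; rewrite in_itv/= => /fd[].
- by exists c => //; move: cab; rewrite in_itv.
Qed.

Lemma mvt_exists f df (a b : R) :
  (forall t : R, (a <= t <= b) || (b <= t <= a) -> is_derive t 1 f (df t)) ->
  exists2 c, (a <= c <= b) || (b <= c <= a) & f b - f a = df c * (b - a).
Proof.
move=> fd; have [ab|/ltW ba] := leP a b.
  have [t tab|c cab E] := mvt_le_exists (f := f) (df := df) ab.
    by apply: fd; rewrite tab.
  by exists c => //; rewrite cab.
have [t tab|c cab E] := mvt_le_exists (f := f) (df := df) ba.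
  by apply: fd; rewrite tab orbT.
exists c; first by rewrite cab orbT.
by rewrite -opprB E -mulrN opprB.
Qed.

Lemma mvt_norm_le f df (M a b : R) :
  (forall t : R, (a <= t <= b) || (b <= t <= a) -> is_derive t 1 f (df t)) ->
  (forall t, (a <= t <= b) || (b <= t <= a) -> `|df t| <= M) ->
  `|f b - f a| <= M * `|b - a|.
Proof.
move=> fd fM; have [c cab ->] := mvt_exists fd.
by rewrite normrM ler_wpM2r ?normr_ge0// fM.
Qed.

(** Two applications of the mean value theorem; they give the constant [M] in place of the sharp
    [M / 2]. *)
Lemma taylor2 f f1 f2 (a b M : R) : a <= b ->
  (forall t : R, a <= t <= b -> is_derive t 1 f (f1 t)) ->
  (forall t : R, a <= t <= b -> is_derive t 1 f1 (f2 t)) ->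
  (forall t, a <= t <= b -> `|f2 t| <= M) ->
  `|f b - f a - (b - a) * f1 a| <= M * (b - a) ^+ 2.
Proof.
move=> ab d1 d2 fM.
have M0 : 0 <= M by rewrite (le_trans (normr_ge0 (f2 a))) ?fM// lexx.
have [c cab E] := mvt_le_exists ab d1.
rewrite E mulrC -mulrBr normrM (ger0_norm (x := b - a)) ?subr_ge0//.
rewrite expr2 mulrA mulrC ler_wpM2r ?subr_ge0//.
case/andP : cab => ac cb.
have [t /andP[at_ tc]|e /andP[ae ec] ->] := @mvt_le_exists f1 f2 a c ac.
  by apply: d2; rewrite at_ (le_trans tc).
rewrite normrM ler_pM//; first by rewrite fM// ae (le_trans ec).
by rewrite ger0_norm; lra.
Qed.

(** Three nested mean value bounds, for [f2], [f1] and [f] minus their Taylor polynomials. The bound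
    on [f3] is asked only for [|t| <= |h|], so [M] may depend on [h]. *)
Lemma taylor3 f f1 f2 f3 (h M : R) :
  (forall t : R, is_derive t 1 f (f1 t)) ->
  (forall t : R, is_derive t 1 f1 (f2 t)) ->
  (forall t : R, is_derive t 1 f2 (f3 t)) ->
  (forall t, `|t| <= `|h| -> `|f3 t| <= M) ->
  `|f h - f 0 - h * f1 0 - h ^+ 2 / 2 * f2 0| <= M * `|h| ^+ 3.
Proof.
move=> d1 d2 d3 fM.
have bet (t s : R) : (0 <= s <= t) || (t <= s <= 0) -> `|s| <= `|t|.
  by case/orP => /andP[? ?]; [rewrite !ger0_norm//; lra|rewrite !ler0_norm//; lra].
have M0 : 0 <= M by rewrite (le_trans (normr_ge0 (f3 0))) ?fM// normr0.
have b2 t : `|t| <= `|h| -> `|f2 t - f2 0| <= M * `|t|.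
  move=> th; rewrite -{2}(subr0 t); apply: (mvt_norm_le (fun s _ => d3 s)) => s /bet st.
  by apply: fM; exact: le_trans st th.
have b1 t : `|t| <= `|h| -> `|f1 t - f1 0 - t * f2 0| <= M * `|t| ^+ 2.
  move=> th; pose g s := f1 s - s * f2 0.
  have gd (s : R) : is_derive s 1 g (f2 s - f2 0).
    rewrite /g; apply: is_derive_eq; rewrite scaler0 add0r.
    by rewrite /GRing.scale/= mulr1.
  have -> : f1 t - f1 0 - t * f2 0 = g t - g 0 by rewrite /g; ring.
  rewrite expr2 mulrA -{3}(subr0 t); apply: (mvt_norm_le (fun s _ => gd s)) => s /bet st.
  by rewrite (le_trans (b2 _ _)) ?(le_trans st)// ler_wpM2l.
pose g s := f s - s * f1 0 - s ^+ 2 / 2 * f2 0.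
have gd (s : R) : is_derive s 1 g (f1 s - f1 0 - s * f2 0).
  rewrite /g; under eq_fun do rewrite -mulrA.
  apply: is_derive_eq; rewrite !scaler0 !add0r.
  by rewrite /GRing.scale/= !mulr1; field.
have -> : f h - f 0 - h * f1 0 - h ^+ 2 / 2 * f2 0 = g h - g 0 by rewrite /g; ring.
rewrite exprS mulrCA mulrC -{3}(subr0 h); apply: (mvt_norm_le (fun s _ => gd s)) => s /bet st.
by rewrite (le_trans (b1 _ _))// ler_wpM2l// lerXn2r// nnegrE.
Qed.

End mean_value_bounds.

Lemma is_derive1_chain {R : realType} (f g : R -> R) (x a b : R) :
  is_derive (g x) 1 f a -> is_derive x 1 g b ->
  is_derive x 1 (fun y => f (g y)) (a * b).
Proof. by move=> ? ?; exact: is_derive1_comp. Qed.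

Section gaussian.
Context {R : realType}.
Implicit Types x y z t u v w : R.

Definition gauss x : R := normal_pdf 0 1 x.

Let peak : R := normal_peak 1.

Lemma gaussE x : gauss x = peak * expR (- (x ^+ 2 / 2)).
Proof.
by rewrite /gauss normal_pdfE ?oner_neq0// /normal_fun subr0 expr1n mulNr.
Qed.

Lemma peak_gt0 : 0 < peak. Proof. by rewrite normal_peak_gt0// oner_neq0. Qed.

Lemma peak_le1 : peak <= 1.
Proof.
rewrite /peak /normal_peak expr1n mul1r invf_le1 ?sqrtr_gt0; last by rewrite pmulrn_lgt0// pi_gt0.
rewrite -[leLHS]sqrtr1 ler_wsqrtr// -mulr_natr.
have := @pi_ge2 R; lra.
Qed.

Lemma gauss_gt0 x : 0 < gauss x.
Proof. by rewrite gaussE mulr_gt0 ?peak_gt0 ?expR_gt0. Qed.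

Lemma gauss_le1 x : gauss x <= 1.
Proof.
rewrite (le_trans (normal_pdf_ub _ _ (oner_neq0 _)))//; exact: peak_le1.
Qed.

Lemma is_derive_gauss x : is_derive x 1 gauss (- x * gauss x).
Proof.
have -> : gauss = (fun x => peak * expR (- (x ^+ 2 / 2))).
  by apply/funext => y; rewrite gaussE.
have d2 : is_derive x 1 (fun y : R => - (y ^+ 2 / 2)) (- x).
    under eq_fun do rewrite mulrC.
    apply: is_derive_eq; rewrite /GRing.scale/= !mulr1.
    by field.
have := is_derive1_chain (is_derive_expR _) d2 => d3.
apply: is_derive_eq; rewrite /GRing.scale/=; ring.
Qed.

Lemma continuous_gauss : continuous gauss.
Proof. exact: is_derive_continuous is_derive_gauss. Qed.

Lemma is_derive_Phi x : is_derive x 1 (@Phi R) (gauss x).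
Proof.
have ig : (@lebesgue_measure R).-integrable `]-oo, x + 1] (EFin \o gauss).
  apply: (integrableS measurableT _ (@subsetT _ _)) => //.
  exact: integrable_normal_pdf.
have xx1 : x < x + 1 by rewrite ltrDl.
have [] := continuous_FTC1 xx1 ig (ltNyr _) (@continuous_gauss x).
move=> dF FE; split; first exact: dF.
by rewrite -derive1E -FE.
Qed.

Lemma continuous_Phi : continuous (@Phi R).
Proof. exact: is_derive_continuous is_derive_Phi. Qed.

Lemma Phi_ge0 x : 0 <= Phi x. Proof. by rewrite /Phi fine_ge0. Qed.

Lemma PhiE x : (Phi x)%:E = normal_prob 0 1 `]-oo, x].
Proof. by rewrite /Phi fineK// fin_num_measure. Qed.

Lemma Phi_le1 x : Phi x <= 1.
Proof. by rewrite -lee_fin PhiE probability_le1. Qed.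

Lemma Phi_incr x y : x <= y -> Phi x <= Phi y.
Proof.
move=> xy; rewrite -lee_fin !PhiE le_measure ?inE//.
by apply: subset_itvl; rewrite bnd_simp.
Qed.

Lemma PhiB x y : x <= y -> 0 <= Phi y - Phi x <= y - x.
Proof.
move=> xy; rewrite subr_ge0 Phi_incr//=.
have [c _ ->] := mvt_le_exists xy (fun t _ => is_derive_Phi t).
by rewrite ler_piMl ?subr_ge0// gauss_le1.
Qed.

Let idN : measurableTypeR R -> R := idfun.

#[local] HB.instance Definition _ :=
  @isMeasurableFun.Build _ _ _ _ idN (@measurable_id _ _ setT).

Let PhicdfE : @Phi R = fine \o cdf (idN : {RV normal_prob (0 : R) 1 >-> R}).
Proof. by apply/funext => x; rewrite /Phi /cdf /distribution /pushforward /= preimage_id. Qed.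

Lemma cvg_Phi_y : Phi x @[x --> +oo] --> (1 : R).
Proof. by rewrite PhicdfE; apply: fine_cvg; exact: cvg_cdfy1. Qed.

Lemma cvg_Phi_Ny : Phi x @[x --> -oo] --> (0 : R).
Proof. by rewrite PhicdfE; apply: fine_cvg; exact: cvg_cdfNy0. Qed.

(* [e^v >= (1 + v/m)^m] at [v = u^2/2] *)
Lemma gauss_decay (m : nat) x : (0 < m)%N ->
  gauss x * (1 + x ^+ 2) ^+ m <= (2 * m%:R) ^+ m.
Proof.
move=> m0; have m0' : 0 < m%:R :> R by rewrite ltr0n.
have m1 : 1 <= m%:R :> R by rewrite ler1n.
have x2 := sqr_ge0 x.
have E : ((1 + x ^+ 2) / (2 * m%:R)) ^+ m <= expR (x ^+ 2 / 2).
  have -> : x ^+ 2 / 2 = m%:R * (x ^+ 2 / (2 * m%:R)) by field; rewrite gt_eqF.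
  rewrite expRM_natl lerXn2r ?nnegrE ?expR_ge0//.
    by apply: divr_ge0; lra.
  apply: le_trans (expR_ge1Dx _).
  have i1 : (2 * m%:R)^-1 <= 1 :> R by rewrite -[leRHS]invr1 lef_pV2 ?posrE; lra.
  by rewrite mulrDl mul1r lerD2r.
rewrite gaussE; move: E; rewrite expr_div_n ler_pdivrMr ?exprn_gt0//; last lra.
rewrite expRN mulrC => E1.
have e0 := expR_gt0 (x ^+ 2 / 2).
rewrite mulrAC ler_pdivrMr//; apply: le_trans E1.
by rewrite ler_piMl ?exprn_ge0 ?peak_le1//; lra.
Qed.


(** [gauss1], [gauss2] and [gauss3] are the first three derivatives of the density: Hermite
    polynomials times [gauss], up to sign. *)
Definition gauss1 x : R := - x * gauss x.
Definition gauss2 x : R := (x ^+ 2 - 1) * gauss x.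
Definition gauss3 x : R := (3 * x - x ^+ 3) * gauss x.

Lemma is_derive_gauss1 x : is_derive x 1 gauss1 (gauss2 x).
Proof.
have dg := is_derive_gauss x.
rewrite /gauss1 /gauss2; apply: is_derive_eq; rewrite /GRing.scale/=; ring.
Qed.

Lemma gauss_le (m : nat) x : (0 < m)%N ->
  gauss x <= (2 * m%:R) ^+ m / (1 + x ^+ 2) ^+ m.
Proof.
move=> m0; rewrite ler_pdivlMr ?gauss_decay// exprn_gt0//.
by have := sqr_ge0 x; lra.
Qed.

(** A factor of size [(1 + x^2)^k] uses up [k] of the [m + k] powers offered by [gauss_decay]. *)
Lemma gauss_poly_le (k m : nat) (C : R) p x : (0 < m + k)%N ->
  `|p| <= (1 + x ^+ 2) ^+ k -> (2 * (m + k)%:R) ^+ (m + k) <= C ->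
  `|p * gauss x| <= C / (1 + x ^+ 2) ^+ m.
Proof.
move=> mk pk CE; rewrite normrM (ger0_norm (ltW (gauss_gt0 x))).
have x2 : 0 < 1 + x ^+ 2 by have := sqr_ge0 x; lra.
rewrite ler_pdivlMr ?exprn_gt0// (le_trans _ CE)// (le_trans _ (gauss_decay x mk))//.
rewrite mulrAC mulrC ler_wpM2l ?(ltW (gauss_gt0 _))//.
by rewrite exprD mulrC ler_wpM2l// exprn_ge0// ltW.
Qed.

Lemma gauss1_le : exists2 C : R, 0 < C &
  forall x, `|gauss1 x| <= C / (1 + x ^+ 2).
Proof.
exists ((2 * (1 + 1)%:R) ^+ (1 + 1)) => [|x]; first by rewrite exprn_gt0.
have := @gauss_poly_le 1 1 _ (- x) x isT _ (lexx _); rewrite !expr1; apply.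
by rewrite normrN; case: (ger0P x) => x0; nra.
Qed.

Lemma gauss2_le : exists2 C : R, 0 < C &
  forall x, `|gauss2 x| <= C / (1 + x ^+ 2) ^+ 2.
Proof.
exists ((2 * (2 + 1)%:R) ^+ (2 + 1)) => [|x]; first by rewrite exprn_gt0.
apply: (@gauss_poly_le 1 2 _ _ x) => //; rewrite expr1.
by have := sqr_ge0 x => x2; case: (ger0P (x ^+ 2 - 1)); lra.
Qed.

Lemma gauss3_le : exists2 C : R, 0 < C &
  forall x, `|gauss3 x| <= C / (1 + x ^+ 2) ^+ 2.
Proof.
exists (4 * (2 * (2 + 2)%:R) ^+ (2 + 2)) => [|x]; first by rewrite mulr_gt0 ?exprn_gt0.
have -> : gauss3 x = 4 * ((3 * x - x ^+ 3) / 4 * gauss x) by rewrite /gauss3; field.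
rewrite normrM (ger0_norm (x := 4))// -[leRHS]mulrA ler_pM2l//.
apply: (@gauss_poly_le 2 2 _ _ x) => //.
have x2 := sqr_ge0 x; have : `|x| <= 1 + x ^+ 2 by case: (ger0P x) => x0; nra.
have -> : (3 * x - x ^+ 3) / 4 = x * ((3 - x ^+ 2) / 4) by field.
move=> x1; rewrite normrM expr2 ler_pM//.
by rewrite ler_norml; apply/andP; split; lra.
Qed.

(** [F t + K / (1 + t)^4] decreases for [t >= 0], because [gauss t] is below [4 K / (1 + t)^5]; the
    limit at infinity then gives the tail. Any primitive is allowed, so that both [Phi t] and
    [- Phi (- t)] are covered. *)
Lemma gauss_tail (F : R -> R) (l : R) v : (forall t : R, is_derive t 1 F (gauss t)) ->
  F w @[w --> +oo] --> l -> 0 <= v -> l - F v <= 864 / (1 + v ^+ 2) ^+ 2.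
Proof.
move=> dF Fl v0.
have [K KE] : exists K : R, K = 864 by exists 864.
have K0 : 0 < K by lra.
rewrite -KE.
have dC (t : R) : v <= t -> is_derive t 1 (fun t => K / (1 + t) ^+ 4) (- (K * 4) / (1 + t) ^+ 5).
  move=> vt; have t1 : (1 + t) ^+ 4 != 0 by rewrite expf_neq0//; lra.
  apply: is_derive_eq; rewrite /GRing.scale/=; field; lra.
have H w : v <= w -> F w <= F v + K / (1 + v ^+ 2) ^+ 2.
  move=> vw.
  have [t /andP[vt tw]|c /andP[vc cw]] := @mvt_le_exists _ (fun t => F t + K / (1 + t) ^+ 4)
     (fun t => gauss t + (- (K * 4) / (1 + t) ^+ 5)) v w vw.
    by have := is_deriveD (dF t) (dC t vt).
  have c1 : 0 < 1 + c by lra.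
  (* [gauss c <= 216 / (1 + c^2)^3] and [(1 + c)^5 <= (1 + c)^6 <= 8 (1 + c^2)^3]; as
     [216 * 8 = 4 * 432], the choice [K = 864] leaves a factor 2 to spare. *)
  have n0 : gauss c + - (K * 4) / (1 + c) ^+ 5 <= 0.
    rewrite mulNr subr_le0 (le_trans (@gauss_le 3 c isT))//.
    have c2 := sqr_ge0 c.
    rewrite ler_pdivrMr ?exprn_gt0//; last lra.
    rewrite mulrAC ler_pdivlMr ?exprn_gt0//.
    have -> : (2 * 3%:R : R) ^+ 3 = 216 by ring.
    have P : (1 + c) ^+ 2 <= 2 * (1 + c ^+ 2) by have := sqr_ge0 (1 - c); nra.
    have P3 : (1 + c) ^+ 2 ^+ 3 <= (2 * (1 + c ^+ 2)) ^+ 3.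
      by rewrite lerXn2r// nnegrE ?exprn_ge0; nra.
    have P5 : (1 + c) ^+ 5 <= (1 + c) ^+ 2 ^+ 3.
      by rewrite -exprM ler_weXn2l//; lra.
    rewrite [leRHS]exprMn in P3.
    have : 0 <= (1 + c ^+ 2) ^+ 3 by rewrite exprn_ge0//; lra.
    by have := le_trans P5 P3; rewrite KE; lra.
  have w0 : 0 <= K / (1 + w) ^+ 4 :> R.
    by rewrite divr_ge0 ?exprn_ge0//; lra.
  have v1 : K / (1 + v) ^+ 4 <= K / (1 + v ^+ 2) ^+ 2 :> R.
    have v2 := sqr_ge0 v; rewrite ler_pM2l// lef_pV2 ?posrE ?exprn_gt0//; try lra.
    have -> : (1 + v) ^+ 4 = (1 + v) ^+ 2 ^+ 2 by rewrite -exprM.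
    by rewrite lerXn2r ?nnegrE; nra.
  have n1 : (gauss c + - (K * 4) / (1 + c) ^+ 5) * (w - v) <= 0.
    by rewrite mulr_le0_ge0// subr_ge0.
  by move=> E; move: n1; rewrite -E; lra.
rewrite lerBlDl -(cvg_lim _ Fl)//; apply: limr_le; first by apply/cvg_ex; exists l.
by near=> w; apply: H; near: w; apply: nbhs_pinfty_ge; rewrite num_real.
Unshelve. all: by end_near. Qed.

Lemma Phi_tail v : 0 <= v -> 1 - Phi v <= 864 / (1 + v ^+ 2) ^+ 2.
Proof. exact: gauss_tail is_derive_Phi cvg_Phi_y. Qed.

Lemma PhiN_tail v : 0 <= v -> Phi (- v) <= 864 / (1 + v ^+ 2) ^+ 2.
Proof.
move=> v0; rewrite -[leLHS]opprK -[leLHS]sub0r.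
apply: (@gauss_tail (fun v => - Phi (- v))) => // [t|].
  have dN : is_derive t 1 (fun t : R => - t) (- 1 : R) by apply: is_derive_eq.
  have dP := is_derive1_chain (is_derive_Phi (- t)) dN.
  have := is_deriveN dP; rewrite mulrN1 opprK.
  by rewrite gaussE sqrrN -gaussE.
rewrite -[X in _ --> X]oppr0; apply: cvgN.
exact: (cvgNy_compNP (@Phi R) _).1 cvg_Phi_Ny.
Qed.


(** Only the mass of [[x, x + 1 / (1 + x)]] is kept: there the square exceeds [x^2] by at most 3, so
    the density stays comparable to [expR (- x^2 / 2)], and the length of the interval is
    [1 / (1 + x)]. This is where the factor [1 + xhat] of the theorem comes from. *)
Lemma Phi_tail_ge : exists2 c : R, 0 < c &
  forall x, 0 <= x -> c * expR (- (x ^+ 2 / 2)) <= (1 - Phi x) * (1 + x).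
Proof.
exists (peak * expR (- 2)); first by rewrite mulr_gt0 ?peak_gt0 ?expR_gt0.
move=> x x0; have x1 : 0 < 1 + x by lra.
pose y := x + (1 + x)^-1.
have yx : y - x = (1 + x)^-1 by rewrite /y addrC addKr.
have i0 : 0 < (1 + x)^-1 by rewrite invr_gt0.
have [c /andP[xc cy] E] := mvt_le_exists (f := @Phi R) (a := x) (b := y)
  ltac:(lra) (fun t _ => is_derive_Phi t).
rewrite -ler_pdivrMr// (le_trans (y := Phi y - Phi x))//; last first.
  by rewrite lerD2r Phi_le1.
rewrite E yx ler_pM2r// gaussE -mulrA ler_pM2l ?peak_gt0// -expRD ler_expR.
have i1 : (1 + x)^-1 <= 1 by rewrite invf_le1; lra.
have xi : x * (1 + x)^-1 <= 1 by rewrite ler_pdivrMr//; lra.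
have : c ^+ 2 <= y ^+ 2 by rewrite lerXn2r ?nnegrE; lra.
rewrite /y sqrrD => c2; have : (1 + x)^-1 ^+ 2 <= 1 by rewrite expr_le1//; lra.
by move: c2; rewrite -mulr_natr; lra.
Qed.

(** The Mills ratio [(1 - Phi x) / gauss x], up to the constant factor [gauss 0]. *)
Definition mills x : R := expR (x ^+ 2 / 2) * (1 - Phi x).

Lemma mills_ge0 x : 0 <= mills x.
Proof. by rewrite mulr_ge0 ?expR_ge0// subr_ge0 Phi_le1. Qed.

Lemma millsK x : expR (- (x ^+ 2 / 2)) * mills x = 1 - Phi x.
Proof. by rewrite /mills mulrA -expRD addNr expR0 mul1r. Qed.

Lemma is_derive_sqr2 x : is_derive x 1 (fun y : R => y ^+ 2 / 2) x.
Proof.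
under eq_fun do rewrite mulrC.
by apply: is_derive_eq; rewrite /GRing.scale/= !mulr1; field.
Qed.

(** The derivative [t * mills t - gauss 0] is at least [-1] for [t >= 0]. This allows [mills] at
    [lambda] to be replaced by [mills] at [xhat]. *)
Lemma millsB_le x y : 0 <= x -> x <= y -> mills x - mills y <= y - x.
Proof.
move=> x0 xy.
have dm (t : R) : is_derive t 1 mills (t * mills t - peak).
  have d1 := is_derive1_chain (is_derive_expR _) (is_derive_sqr2 t).
  have d2 := is_derive_Phi t.
  rewrite /mills; apply: is_derive_eq; rewrite /GRing.scale/= gaussE.
  have : expR (t ^+ 2 / 2) * expR (- (t ^+ 2 / 2)) = 1 by rewrite -expRD addrN expR0.
  move: (expR _) (expR _) => a b ab.
  by transitivity (t * (b * (1 - Phi t)) - peak * (b * a)); [ring|rewrite ab mulr1].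
have [c /andP[xc _] E] := mvt_le_exists xy (fun t _ => dm t).
rewrite -opprB E -mulNr ler_piMl ?subr_ge0// opprB.
have := mills_ge0 c; have := peak_le1 => p1 m0.
have : 0 <= c * mills c by rewrite mulr_ge0//; exact: le_trans xc.
lra.
Qed.

(** Completing the square shows that [expR (t^2 / 2) * Phi (y + t)] is a primitive of the
    integrand. *)
Lemma integral_exp_gauss t : (\int[lebesgue_measure]_(y in `[0%R, +oo[)
  (expR (- (t * y)) * gauss y)%:E = (mills t)%:E)%E.
Proof.
pose F y := expR (t ^+ 2 / 2) * Phi (y + t).
have dF (y : R) : is_derive y 1 F (expR (- (t * y)) * gauss y).
  have dt : is_derive y 1 (fun y : R => y + t) 1 by apply: is_derive_eq; rewrite addr0.
  have dP := is_derive1_chain (is_derive_Phi _) dt.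
  rewrite /F; apply: is_derive_eq.
  rewrite /GRing.scale/= mulr1 !gaussE ![peak * _]mulrC !mulrA -!expRD.
  by congr (expR _ * _); field.
have cF : continuous F := is_derive_continuous dF.
rewrite (@ge0_continuous_FTC2y _ _ F _ (expR (t ^+ 2 / 2))).
- by rewrite -EFinB /F add0r /mills mulrBr mulr1.
- by move=> y _; rewrite mulr_ge0 ?expR_ge0// ltW// gauss_gt0.
- apply: continuous_subspaceT => y; apply: cvgM; last exact: continuous_gauss.
  apply: (cvg_comp _ expR); last exact: continuous_expR.
  by apply: cvgN; apply: cvgM; [exact: cvg_cst|exact: cvg_id].
- rewrite -[X in _ --> X]mulr1; apply: cvgM; first exact: cvg_cst.
  apply: (cvg_comp (fun y => y + t) (@Phi R)); last exact: cvg_Phi_y.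
  exact: cvg_addrr.
- by move=> y _; case: (dF y).
- exact/cvg_at_right_filter/cF.
- by move=> y _; rewrite derive1E; case: (dF y).
Qed.

Lemma normal_prob_oc x y : x <= y ->
  (\int[lebesgue_measure]_(u in `]x, y]) (gauss u)%:E = (Phi y - Phi x)%:E)%E.
Proof.
move=> xy; rewrite EFinB !PhiE.
rewrite -[LHS]/(normal_prob 0 1 `]x, y]).
rewrite (_ : `]x, y]%classic = `]-oo, y] `\` `]-oo, x]); last first.
  apply/seteqP; split => u /=; rewrite !in_itv/=.
    by move=> /andP[xu uy]; split => //; apply/negP; rewrite -ltNge.
  by move=> [uy] /negP; rewrite -ltNge => ->.
rewrite measureD//; last by rewrite (le_lt_trans (probability_le1 _ _))// ltry.
rewrite setIidr//; exact: subitvPr.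
Qed.

End gaussian.

(** * One exchange step: heat equation and Taylor expansion *)

Section heat_step.
Context {R : realType}.
Implicit Types a z t u h e : R.

(** The heat equation: [gauss1 (z / sqrt t) / t] is the second derivative of [Phi (z / sqrt t)] in
    [z], and half of it is the derivative in the variance. *)
Let dPhi_sqrt z (t : R) : 0 < t -> is_derive t 1 (fun a => Phi (z / Num.sqrt a))
  (gauss1 (z / Num.sqrt t) / (2 * t)).
Proof.
move=> t0; have s0 : 0 < Num.sqrt t by rewrite sqrtr_gt0.
have ds := is_derive1_sqrt t0.
have d1 : is_derive t 1 (fun a : R => z / Num.sqrt a)
    (- z / (2 * Num.sqrt t ^+ 3)).
  have n0 : Num.sqrt t != 0 by rewrite gt_eqF.
  apply: is_derive_eq; rewrite /GRing.scale/=; field.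
  by rewrite n0.
have := is_derive1_chain (g := fun a : R => z / Num.sqrt a) (is_derive_Phi (z / Num.sqrt t)) d1.
congr (is_derive _ _ _ _); rewrite /gauss1.
move: (sqr_sqrtr (ltW t0)); move: (Num.sqrt t) s0 => q q0 <-.
by field; rewrite gt_eqF.
Qed.

(** The heat equation once more: the result is a quarter of the fourth derivative in [z]. *)
Let dgauss1_sqrt z (t : R) : 0 < t ->
  is_derive t 1 (fun a => gauss1 (z / Num.sqrt a) / (2 * a))
  (gauss3 (z / Num.sqrt t) / (4 * t ^+ 2)).
Proof.
move=> t0; have s0 : 0 < Num.sqrt t by rewrite sqrtr_gt0.
have ds := is_derive1_sqrt t0.
have n0 : Num.sqrt t != 0 by rewrite gt_eqF.
have nt : t != 0 by rewrite gt_eqF.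
have d1 : is_derive t 1 (fun a : R => z / Num.sqrt a)
    (- z / (2 * Num.sqrt t ^+ 3)).
  apply: is_derive_eq; rewrite /GRing.scale/=; field.
  by rewrite n0.
have d2 := is_derive1_chain (g := fun a : R => z / Num.sqrt a) (is_derive_gauss1 (z / Num.sqrt t)) d1.
have d3 : is_derive t 1 (fun a : R => (2 * a)^-1) (- (2 * t ^+ 2)^-1).
  have n2 : 2 * t != 0 by rewrite mulf_neq0.
  by apply: is_derive_eq; rewrite /GRing.scale/=; field.
have := is_deriveM d2 d3.
congr (is_derive _ _ _ _).
rewrite /GRing.scale/= /gauss1 /gauss2 /gauss3.
move: (sqr_sqrtr (ltW t0)); move: (Num.sqrt t) n0 => q q0 <-.
by field.
Qed.

(* The heat equation turns [d/da] into half of [d^2/dz^2], so the displayed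
   main terms are the Taylor expansion in [h] and in [a - a']. *)
Definition heat_bound (C : R) := forall e a a' z h,
  0 < e -> e ^+ 2 <= a' -> a' <= a -> a <= a' + 12 * e ^+ 2 ->
  let r := Num.sqrt (a + z ^+ 2) in
  let s := Num.sqrt a' in
  [/\ gauss (z / s) / s <= C / Num.sqrt a,
      `|gauss1 (z / s) / a'| <= C / r ^+ 2 &
      `|Phi ((z - h) / s) - Phi (z / Num.sqrt a) + h * (gauss (z / s) / s)
        - (h ^+ 2 - (a - a')) / 2 * (gauss1 (z / s) / a')|
      <= C * (`|h| ^+ 3 * (1 + h ^+ 2 / e ^+ 2) ^+ 2 + (a - a') * e) / r ^+ 3].

(** The changes of position and of variance are expanded separately. The decay of the Gaussian
    derivatives turns inverse powers of [s] into inverse powers of [r], which are small when [z] is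
    large; without this gain the errors could not be summed over the steps. *)
Lemma heat_step : exists2 C : R, 0 < C & heat_bound C.
Proof.
have [c1 c10 G1] := @gauss1_le R.
have [c2 c20 G2] := @gauss2_le R.
have [c3 c30 G3] := @gauss3_le R.
exists (4 + 13 * c1 + 4 * 169 * c2 + 12 * 169 * c3); first lra.
pose C := 4 + 13 * c1 + 4 * 169 * c2 + 12 * 169 * c3; rewrite -/C.
have C4 : 4 <= C by rewrite /C; lra.
have C13 : 13 * c1 <= C by rewrite /C; lra.
have C2 : 4 * 169 * c2 <= C by rewrite /C; lra.
have C3 : 12 * 169 * c3 <= C by rewrite /C; lra.
move: C C4 C13 C2 C3 => C C4 C13 C2 C3 e a a' z h e0 ea' a'a aa' r s.
have e2 : 0 < e ^+ 2 by rewrite exprn_gt0.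
have a'0 : 0 < a' by lra.
have a0 : 0 < a by lra.
have s0 : 0 < s by rewrite sqrtr_gt0.
have sE : s ^+ 2 = a' by rewrite sqr_sqrtr// ltW.
have z2 := sqr_ge0 z.
have r0 : 0 < r by rewrite sqrtr_gt0; lra.
have rE : r ^+ 2 = a + z ^+ 2 by rewrite sqr_sqrtr//; lra.
pose q := s ^+ 2 + z ^+ 2.
have q0 : 0 < q by rewrite /q; lra.
have rq : r ^+ 2 <= 13 * q by rewrite rE /q sE; lra.
have s_r : s <= r by rewrite ler_wsqrtr//; lra.
have e_s : e <= s.
  by rewrite -(@ler_pXn2r _ 2) ?nnegrE ?(ltW e0) ?(ltW s0)// sE.
(* [s <= r] and [r^2 <= 13 q] give [s r^3 <= r^4 <= 169 q^2]. The 13 is [1 + 12]: [a <= a' + 12 e^2]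
   and [e^2 <= a']. *)
have sq : s / q ^+ 2 <= 169 / r ^+ 3.
  rewrite ler_pdivrMr ?exprn_gt0// mulrAC ler_pdivlMr ?exprn_gt0//.
  apply: (@le_trans _ _ (r ^+ 2 ^+ 2)).
    have -> : r ^+ 2 ^+ 2 = r * r ^+ 3 by ring.
    by rewrite ler_pM2r ?exprn_gt0.
  have -> : 169 * q ^+ 2 = (13 * q) ^+ 2 by rewrite exprMn -natrX.
  by rewrite lerXn2r ?nnegrE ?exprn_ge0//; clear -q0 rq r0; lra.
have h2 := sqr_ge0 h.
have uE u : 1 + (u / s) ^+ 2 = (s ^+ 2 + u ^+ 2) / s ^+ 2.
  by rewrite expr_div_n; field; rewrite gt_eqF.
split.
- have sa : Num.sqrt a <= 4 * s.
    rewrite -(@ler_pXn2r _ 2) ?nnegrE ?sqrtr_ge0 ?mulr_ge0 ?(ltW s0)//.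
    by rewrite sqr_sqrtr ?(ltW a0)// exprMn sE; clear -ea' aa' a'0; lra.
  rewrite ler_pdivrMr// mulrAC ler_pdivlMr ?sqrtr_gt0//.
  have g1 := gauss_le1 (z / s).
  have g0 := gauss_gt0 (z / s).
  have := ler_pM (ltW g0) (sqrtr_ge0 a) g1 sa; nra.
- rewrite normrM (ger0_norm (x := a'^-1)) ?invr_ge0 ?(ltW a'0)// ler_pdivrMr//.
  apply: le_trans (G1 _) _; rewrite uE -/q invf_div mulrA.
  rewrite sE mulrAC ler_pM2r// ler_pdivrMr// mulrAC ler_pdivlMr ?exprn_gt0//.
  have := ler_wpM2l (ltW c10) rq; have := ler_wpM2r (ltW q0) C13; lra.
(* [D1] is the third-order Taylor remainder in [h] at the new variance [a'], [D2] the second-order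
   remainder in the variance at fixed [z]. *)
pose D1 := Phi ((z - h) / s) - Phi (z / s) + h * (gauss (z / s) / s)
  - h ^+ 2 / 2 * (gauss1 (z / s) / a').
pose D2 := Phi (z / Num.sqrt a) - Phi (z / s) - (a - a') * (gauss1 (z / s) / (2 * a')).
have -> : Phi ((z - h) / s) - Phi (z / Num.sqrt a) + h * (gauss (z / s) / s)
        - (h ^+ 2 - (a - a')) / 2 * (gauss1 (z / s) / a') = D1 - D2.
  rewrite /D1 /D2; move: (Phi _) (Phi (z / _)) (Phi (z / s)) (gauss1 _) (gauss _) => x1 x2 x3 x4 x5.
  by field; rewrite (gt_eqF a'0) (gt_eqF s0).
have B1 : `|D1| <= (4 * c2 * (1 + h ^+ 2 / e ^+ 2) ^+ 2 * (s / q ^+ 2)) * `|h| ^+ 3.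
  have dz (t : R) : is_derive t 1 (fun t : R => (z - t) / s) (- s^-1).
    by apply: is_derive_eq; rewrite /GRing.scale/=; field; rewrite gt_eqF.
  have d1 (t : R) := is_derive1_chain (g := fun t : R => (z - t) / s) (is_derive_Phi ((z - t) / s)) (dz t).
  have d2 (t : R) : is_derive t 1 (fun t => gauss ((z - t) / s) * - s^-1) (gauss1 ((z - t) / s) / a').
    have dd := is_derive1_chain (g := fun t : R => (z - t) / s) (is_derive_gauss ((z - t) / s)) (dz t).
    apply: is_derive_eq; rewrite /GRing.scale/= /gauss1 -sE; field.
    by rewrite gt_eqF.
  have d3 (t : R) : is_derive t 1 (fun t => gauss1 ((z - t) / s) / a') (gauss2 ((z - t) / s) * (- s^-1) / a').
    have dd := is_derive1_chain (g := fun t : R => (z - t) / s) (is_derive_gauss1 ((z - t) / s)) (dz t).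
    by apply: is_derive_eq; rewrite /GRing.scale/=; field; rewrite !gt_eqF.
  have := taylor3 (h := h) d1 d2 d3 _ => /(_ (4 * c2 * (1 + h ^+ 2 / e ^+ 2) ^+ 2 * (s / q ^+ 2))).
  have -> : Phi ((z - h) / s) - Phi ((z - 0) / s) -
     h * (gauss ((z - 0) / s) * - s^-1) - h ^+ 2 / 2 * (gauss1 ((z - 0) / s) / a') = D1.
    by rewrite subr0 /D1; ring.
  apply => t th.
  rewrite normrM (normrM (gauss2 _)) normrN (ger0_norm (x := s^-1)) ?invr_ge0 ?(ltW s0)// (ger0_norm (x := a'^-1)) ?invr_ge0 ?(ltW a'0)//.
  have G := G2 ((z - t) / s).
  have zt2 := sqr_ge0 (z - t).
  rewrite uE expr_div_n invf_div in G.
  have t2 : t ^+ 2 <= h ^+ 2 by rewrite -(real_normK (num_real t)) -(real_normK (num_real h)) lerXn2r ?nnegrE.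
  have th2 : t ^+ 2 / s ^+ 2 <= h ^+ 2 / e ^+ 2.
    by rewrite ler_pM ?sqr_ge0 ?invr_ge0 ?sqr_ge0// lef_pV2 ?posrE ?sE.
  (* A displacement by [t] with [|t| <= |h|] lowers [s^2 + z^2] at most by the factor
     [2 (1 + h^2 / e^2)], because [e <= s]; its square is the weight in [heat_bound]. *)
  have qle : q <= 2 * (s ^+ 2 + (z - t) ^+ 2) * (1 + h ^+ 2 / e ^+ 2).
    apply: (@le_trans _ _ (2 * (s ^+ 2 + (z - t) ^+ 2) * (1 + t ^+ 2 / s ^+ 2))).
      have -> : 2 * (s ^+ 2 + (z - t) ^+ 2) * (1 + t ^+ 2 / s ^+ 2)
        = 2 * (s ^+ 2 + (z - t) ^+ 2) + 2 * t ^+ 2 + 2 * (z - t) ^+ 2 * t ^+ 2 / s ^+ 2.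
        by field; rewrite gt_eqF.
      have : 0 <= 2 * (z - t) ^+ 2 * t ^+ 2 / s ^+ 2.
        by rewrite divr_ge0 ?sqr_ge0// mulr_ge0 ?sqr_ge0// mulr_ge0// sqr_ge0.
      by have := sqr_ge0 s; have := sqr_ge0 (z - 2 * t); rewrite /q; clear; lra.
    by rewrite ler_wpM2l ?lerD2l//; rewrite mulr_ge0// addr_ge0 ?sqr_ge0.
  set w := s ^+ 2 + (z - t) ^+ 2 in qle G.
  have w0 : 0 < w by rewrite /w ltr_wpDr ?sqr_ge0// exprn_gt0.
  set H := 1 + h ^+ 2 / e ^+ 2 in qle *.
  have H0 : 0 < H by rewrite /H ltr_wpDr// divr_ge0// ltW.
  have qw : 1 / w ^+ 2 <= 4 * H ^+ 2 / q ^+ 2.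
    rewrite ler_pdivrMr ?exprn_gt0// mulrAC ler_pdivlMr ?exprn_gt0// mul1r.
    have -> : 4 * H ^+ 2 * w ^+ 2 = (2 * w * H) ^+ 2 by rewrite !exprMn -natrX; ring.
    by rewrite lerXn2r ?nnegrE// ?(le_trans _ qle)// ltW.
  have -> : 4 * c2 * H ^+ 2 * (s / q ^+ 2) = c2 * s * (4 * H ^+ 2 / q ^+ 2) by ring.
  apply: (@le_trans _ _ (c2 * s * (1 / w ^+ 2))); last first.
    by rewrite ler_wpM2l// mulr_ge0// ltW.
  rewrite -mulrA -invfM ler_pdivrMr ?mulr_gt0// (le_trans G)//.
  rewrite -sE le_eqVlt; apply/orP; left; apply/eqP; field.
  by rewrite gt_eqF.
have B2 : `|D2| <= c3 / q ^+ 2 * (a - a') ^+ 2.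
  have pos t : a' <= t <= a -> 0 < t by case/andP => /(lt_le_trans a'0).
  have := @taylor2 _ (fun a => Phi (z / Num.sqrt a)) (fun a => gauss1 (z / Num.sqrt a) / (2 * a))
    (fun t => gauss3 (z / Num.sqrt t) / (4 * t ^+ 2)) a' a (c3 / q ^+ 2) a'a.
  apply.
  - by move=> t /pos; exact: dPhi_sqrt.
  - by move=> t /pos; exact: dgauss1_sqrt.
  move=> t tt; have t0 := pos _ tt; case/andP: tt => a't ta.
  have t4 : 0 < 4 * t ^+ 2 by rewrite mulr_gt0// exprn_gt0.
  rewrite normrM (ger0_norm (x := (4 * t ^+ 2)^-1)) ?invr_ge0 ?(ltW t4)//.
  have G := G3 (z / Num.sqrt t).
  rewrite expr_div_n (sqr_sqrtr (ltW t0)) in G.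
  have tz : 1 + z ^+ 2 / t = (t + z ^+ 2) / t by field; rewrite gt_eqF.
  rewrite tz expr_div_n invf_div in G.
  rewrite ler_pdivrMr//.
  apply: le_trans G _; rewrite mulrA [leRHS]mulrAC ler_pM//.
  - by rewrite mulr_ge0 ?sqr_ge0// ltW.
  - by rewrite invr_ge0 sqr_ge0.
  - by rewrite ler_wpM2l ?(ltW c30)//; have := sqr_ge0 t; clear; lra.
  - have qt : q <= t + z ^+ 2 by rewrite /q sE lerD2r.
    have t2 : 0 < t + z ^+ 2 by exact: lt_le_trans q0 qt.
    rewrite lef_pV2 ?posrE ?exprn_gt0//.
    by rewrite lerXn2r ?nnegrE// ltW.
have q20 : 0 < q ^+ 2 by rewrite exprn_gt0.
have r30 : 0 < r ^+ 3 by rewrite exprn_gt0.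
have B2' : `|D2| <= 12 * c3 * (a - a') * e * (s / q ^+ 2).
  apply: le_trans B2 _.
  have -> : 12 * c3 * (a - a') * e * (s / q ^+ 2) = c3 / q ^+ 2 * ((a - a') * (12 * (e * s))) by ring.
  rewrite ler_wpM2l ?divr_ge0 ?(ltW c30) ?(ltW q20)// expr2 ler_wpM2l ?subr_ge0//.
  have : e * e <= e * s by rewrite ler_wpM2l// ltW.
  by rewrite -expr2; clear -aa'; lra.
have sq1 : 0 <= s / q ^+ 2 by rewrite divr_ge0 ?ltW.
have H2 : 0 <= (1 + h ^+ 2 / e ^+ 2) ^+ 2 * `|h| ^+ 3.
  by rewrite mulr_ge0 ?sqr_ge0 ?exprn_ge0.
have ae : 0 <= (a - a') * e by rewrite mulr_ge0 ?subr_ge0// ltW.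
apply: le_trans (ler_normB _ _) _; apply: le_trans (lerD B1 B2') _.
move: H2 ae sq1 sq; set A := (1 + _ / _) ^+ 2; set B := `|h| ^+ 3.
set W := s / q ^+ 2 => AB0 ae W0 WK.
have K : 4 * c2 * W <= C / r ^+ 3.
  rewrite (le_trans (y := 4 * c2 * (169 / r ^+ 3)))//; first by rewrite ler_wpM2l// mulr_ge0// ltW.
  by rewrite mulrA ler_wpM2r ?invr_ge0 ?(ltW r30)//; clear -C2; lra.
have K' : 12 * c3 * W <= C / r ^+ 3.
  rewrite (le_trans (y := 12 * c3 * (169 / r ^+ 3)))//; first by rewrite ler_wpM2l// mulr_ge0// ltW.
  by rewrite mulrA ler_wpM2r ?invr_ge0 ?(ltW r30)//; clear -C3; lra.
have -> : 4 * c2 * A * W * B + 12 * c3 * (a - a') * e * W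
  = 4 * c2 * W * (A * B) + 12 * c3 * W * ((a - a') * e) by ring.
apply: le_trans (lerD (ler_wpM2r AB0 K) (ler_wpM2r ae K')) _.
by rewrite -mulrDr mulrAC (mulrC A).
Qed.

End heat_step.

(** * Expectations under a density *)

Section measurable_real_functions.
Context d (T : measurableType d) (R : realType).
Implicit Types f g : T -> R.

(** The inverse is written as [f] times the power [-1] of the nonnegative function [f^2]; at a zero
    of [f] both sides are 0. *)
Lemma measurable_fun_inv f : measurable_fun setT f ->
  measurable_fun setT (fun x => (f x)^-1).
Proof.
move=> mf.
have -> : (fun x => (f x)^-1) = (fun x => f x * ((f x) ^+ 2) `^ (-1)).
  apply/funext => x; rewrite powR_inv1 ?sqr_ge0// expr2.
  have [->|f0] := eqVneq (f x) 0; first by rewrite invr0 mul0r.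
  by rewrite invfM mulrA mulfV// mul1r.
apply: measurable_funM => //.
by apply: (measurableT_comp (measurable_powR (-1))); exact: measurable_funX.
Qed.

Lemma measurable_fun_sqrt f : measurable_fun setT f ->
  measurable_fun setT (fun x => Num.sqrt (f x)).
Proof.
move=> mf; apply: (measurableT_comp _ mf).
by apply: continuous_measurable_fun; exact: sqrt_continuous.
Qed.

Lemma measurable_fun_norm f : measurable_fun setT f ->
  measurable_fun setT (fun x => `|f x|).
Proof. by move=> mf; apply: (measurableT_comp _ mf). Qed.

Lemma measurable_fun_exp f : measurable_fun setT f ->
  measurable_fun setT (fun x => expR (f x)).
Proof. by move=> mf; apply: (measurableT_comp _ mf). Qed.

Lemma measurable_fun_Phi f : measurable_fun setT f ->
  measurable_fun setT (fun x => Phi (f x)).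
Proof.
move=> mf; apply: (measurableT_comp _ mf).
by apply: continuous_measurable_fun; exact: continuous_Phi.
Qed.

Lemma measurable_fun_gauss f : measurable_fun setT f ->
  measurable_fun setT (fun x => gauss (f x)).
Proof.
move=> mf; apply: (measurableT_comp _ mf).
by apply: continuous_measurable_fun; exact: continuous_gauss.
Qed.

Lemma measurable_fun_gauss1 f : measurable_fun setT f ->
  measurable_fun setT (fun x => gauss1 (f x)).
Proof.
move=> mf; apply: measurable_funM; last exact: measurable_fun_gauss.
exact: measurableT_comp mf.
Qed.

End measurable_real_functions.

Ltac msolve := repeat lazymatch goal with
  | |- measurable_fun _ (fun _ => ?c) => exact: measurable_cst
  | |- measurable_fun _ (fun w => @?f w + @?g w) => apply: measurable_funD
  | |- measurable_fun _ (fun w => @?f w * @?g w) => apply: measurable_funM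
  | |- measurable_fun _ (fun w => - @?f w) => apply: measurable_funN
  | |- measurable_fun _ (fun w => (@?f w)^-1) => apply: measurable_fun_inv
  | |- measurable_fun _ (fun w => @?f w ^+ _) => apply: measurable_funX
  | |- measurable_fun _ (fun w => `|@?f w|) => apply: measurable_fun_norm
  | |- measurable_fun _ (fun w => Num.sqrt (@?f w)) => apply: measurable_fun_sqrt
  | |- measurable_fun _ (fun w => expR (@?f w)) => apply: measurable_fun_exp
  | |- measurable_fun _ (fun w => Phi (@?f w)) => apply: measurable_fun_Phi
  | |- measurable_fun _ (fun w => gauss (@?f w)) => apply: measurable_fun_gauss
  | |- measurable_fun _ (fun w => gauss1 (@?f w)) => apply: measurable_fun_gauss1
  | _ => assumption
  end.

Section measurable_wrt_theory.
Context d (T : measurableType d) (R : realType).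
Implicit Types (G : set (set T)) (X Y : T -> R).

Lemma measurable_wrt_sub G G' X : G `<=` G' ->
  measurable_wrt G X -> measurable_wrt G' X.
Proof.
move=> GG' mX _ A mA; apply: sub_smallest2r (mX measurableT A mA) => //.
Qed.

Lemma measurable_wrt_fun G X : G `<=` measurable ->
  measurable_wrt G X -> measurable_fun setT X.
Proof.
move=> GT mX _ A mA; apply: (smallest_sub _ GT (mX measurableT A mA)).
exact: sigma_algebra_measurable.
Qed.

End measurable_wrt_theory.

Section weighted_expectation.
Context d (T : measurableType d) (R : realType) (P : probability T R).
Variable Z : T -> R.
Implicit Types f g : T -> R.

(** The measure with density [Z] is represented by weighted integrals against [P]: no new measure is
    built, and null sets remain those of [P]. *)
Definition density := [/\ measurable_fun setT Z, forall w, 0 <= Z w &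
  (\int[P]_w (Z w)%:E = 1)%E].

Hypothesis hZ : density.

Let mZ : measurable_fun setT Z. Proof. by case: hZ. Qed.
Let Z0 : forall w, 0 <= Z w. Proof. by case: hZ. Qed.
Let Z1 : (\int[P]_w (Z w)%:E = 1)%E. Proof. by case: hZ. Qed.

Definition Int (f : T -> R) := P.-integrable setT (fun w => (f w * Z w)%:E).
Definition Ex (f : T -> R) : R := \int[P]_w (f w * Z w).

Lemma eq_Ex f g : f =1 g -> Ex f = Ex g.
Proof. by move=> /funext ->. Qed.

Lemma eq_Int f g : f =1 g -> Int f -> Int g.
Proof. by move=> /funext ->. Qed.

Lemma IntD f g : Int f -> Int g -> Int (fun w => f w + g w).
Proof.
move=> f1 g1; rewrite /Int; under eq_fun do rewrite mulrDl EFinD.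
exact: integrableD.
Qed.

Lemma IntZ (c : R) f : Int f -> Int (fun w => c * f w).
Proof.
move=> f1; rewrite /Int; under eq_fun do rewrite -mulrA EFinM.
exact: integrableZl.
Qed.

Lemma IntB f g : Int f -> Int g -> Int (fun w => f w - g w).
Proof.
move=> f1 /(IntZ (-1)) /(IntD f1); apply: eq_Int => w; ring.
Qed.

Lemma Int_cst (c : R) : Int (cst c).
Proof.
rewrite /Int; under eq_fun do rewrite EFinM.
apply: integrableZl => //; apply/integrableP; split; first exact/measurable_EFinP.
by under eq_integral do rewrite /= ger0_norm//; rewrite Z1 ltry.
Qed.

Lemma Int_sum (I : Type) (r : seq I) (f : I -> T -> R) :
  (forall i, Int (f i)) -> Int (fun w => \sum_(i <- r) f i w).
Proof.
move=> If; elim: r => [|i r IH].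
  by apply: eq_Int (Int_cst 0) => w; rewrite big_nil.
by apply: eq_Int (IntD (If i) IH) => w; rewrite big_cons.
Qed.

Lemma Int_le f g : measurable_fun setT f -> Int g ->
  (forall w, `|f w| <= g w) -> Int f.
Proof.
move=> mf ig fg; apply: le_integrable ig => //.
  by apply/measurable_EFinP; exact: measurable_funM.
move=> w _; rewrite lee_fin !normrM ler_wpM2r//.
by rewrite (le_trans (fg w))// ler_norm.
Qed.

Lemma Int_norm f : measurable_fun setT f -> Int f -> Int (fun w => `|f w|).
Proof.
move=> mf /integrable_abse; rewrite /Int; congr (_.-integrable _ _).
by apply/funext => w /=; rewrite normrM (ger0_norm (Z0 w)).
Qed.

Lemma Int_bounded f (M : R) : measurable_fun setT f ->
  (forall w, `|f w| <= M) -> Int f.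
Proof. by move=> mf fM; exact: Int_le mf (Int_cst M) fM. Qed.

Lemma ExD f g : Int f -> Int g -> Ex (fun w => f w + g w) = Ex f + Ex g.
Proof.
move=> f1 g1; rewrite /Ex -RintegralD//.
by apply: eq_Rintegral => w _; rewrite mulrDl.
Qed.

Lemma ExZ (c : R) f : Int f -> Ex (fun w => c * f w) = c * Ex f.
Proof.
move=> f1; rewrite /Ex -RintegralZl//.
by apply: eq_Rintegral => w _; rewrite mulrA.
Qed.

Lemma ExB f g : Int f -> Int g -> Ex (fun w => f w - g w) = Ex f - Ex g.
Proof.
move=> f1 g1; rewrite /Ex -RintegralB//.
by apply: eq_Rintegral => w _; rewrite mulrBl.
Qed.

Lemma Ex_cst (c : R) : Ex (cst c) = c.
Proof.
rewrite -[cst c]/(fun w => c); transitivity (c * Ex (cst 1)).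
  by rewrite -ExZ ?Int_cst//; apply: eq_Ex => w; rewrite mulr1.
rewrite /Ex /Rintegral; under eq_integral do rewrite mul1r.
by rewrite Z1 /= mulr1.
Qed.

Lemma Ex_sum (I : Type) (r : seq I) (f : I -> T -> R) :
  (forall i, Int (f i)) -> Ex (fun w => \sum_(i <- r) f i w) = \sum_(i <- r) Ex (f i).
Proof.
move=> If; elim: r => [|i r IH].
  by rewrite big_nil -[RHS](Ex_cst 0); apply: eq_Ex => w; rewrite big_nil.
rewrite big_cons -IH -ExD//; last exact: Int_sum.
by apply: eq_Ex => w; rewrite big_cons.
Qed.

Lemma Ex_ge0_ae f : Int f -> {ae P, forall w, 0 <= f w} -> 0 <= Ex f.
Proof.
move=> If f0; have mf := measurable_int _ If.
rewrite /Ex /Rintegral (@ae_eq_integral _ _ _ P setT (fun w => `|f w * Z w|%:E))//.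
- by apply: Rintegral_ge0.
- by apply/measurable_EFinP; apply: measurableT_comp => //; exact/measurable_EFinP.
- by apply: filterS f0 => w f0 _; rewrite ger0_norm// mulr_ge0.
Qed.

Lemma Ex_le_ae f g : Int f -> Int g -> {ae P, forall w, f w <= g w} ->
  Ex f <= Ex g.
Proof.
move=> If Ig fg; rewrite -subr_ge0 -ExB//; apply: Ex_ge0_ae; first exact: IntB.
by apply: filterS fg => w; rewrite subr_ge0.
Qed.

Lemma Ex_le f g : Int f -> Int g -> (forall w, f w <= g w) -> Ex f <= Ex g.
Proof. by move=> If Ig fg; apply: Ex_le_ae => //; exact: aeW. Qed.

Lemma Ex_ge0 f : (forall w, 0 <= f w) -> 0 <= Ex f.
Proof. by move=> f0; apply: Rintegral_ge0 => w _; rewrite mulr_ge0. Qed.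

Lemma Ex_norm f g : Int f -> Int g -> (forall w, `|f w| <= g w) -> `|Ex f| <= Ex g.
Proof.
move=> If Ig fg; rewrite ler_norml; apply/andP; split.
  rewrite lerNl -mulN1r -ExZ//; apply: Ex_le => //; first exact: IntZ.
  by move=> w; rewrite mulN1r (le_trans _ (fg w))// -normrN ler_norm.
by apply: Ex_le => // w; rewrite (le_trans _ (fg w))// ler_norm.
Qed.

End weighted_expectation.

Arguments eq_Ex {d T R P Z f g}.

(** * Smoothing of nearly martingale sums *)

Section real_inequalities.
Context {R : realType}.
Implicit Types a b x y z t u : R.

Lemma ler_sqr_of a b : 0 <= a -> a <= b -> a ^+ 2 <= b ^+ 2.
Proof. by move=> a0 ab; rewrite lerXn2r ?nnegrE// (le_trans a0). Qed.

(* Tangent line of [t |-> t^(-3/2)] at [m^2], evaluated at [p^2]. *)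
Lemma tangent_pow32 (m p : R) : 0 < m -> 0 < p ->
  m^-1 ^+ 3 - 3 / 2 * (m^-1 ^+ 5 * p ^+ 2 - m^-1 ^+ 3) <= p^-1 ^+ 3.
Proof.
move=> m0 p0; have pE : p = (p^-1)^-1 by rewrite invrK.
pose x := m / p.
have x0 : 0 < x by rewrite divr_gt0.
have P : 0 <= (x - 1) ^+ 2 * (2 * x ^+ 3 + 4 * x ^+ 2 + 6 * x + 3).
  rewrite mulr_ge0 ?sqr_ge0//.
  by have := exprn_gt0 2 x0; have := exprn_gt0 3 x0; lra.
have m30 : 0 <= (2 * m ^+ 3 * x ^+ 2)^-1.
  by rewrite invr_ge0 mulr_ge0 ?sqr_ge0// mulr_ge0// exprn_ge0// ltW.
rewrite -subr_ge0.
suff -> : p^-1 ^+ 3 - (m^-1 ^+ 3 - 3 / 2 * (m^-1 ^+ 5 * p ^+ 2 - m^-1 ^+ 3))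
  = (2 * m ^+ 3 * x ^+ 2)^-1 * ((x - 1) ^+ 2 * (2 * x ^+ 3 + 4 * x ^+ 2 + 6 * x + 3)).
  exact: mulr_ge0.
by rewrite /x; field; rewrite (gt_eqF m0) (gt_eqF p0).
Qed.

(** The function [t^(-1/2)] decreases, so its value at the right end point times the length is below
    its integral over [[a', a]]. *)
Lemma sqrt_step a a' : 0 < a' -> a' <= a ->
  (a - a') / Num.sqrt a <= 2 * (Num.sqrt a - Num.sqrt a').
Proof.
move=> a'0 a'a; have a0 : 0 < a by lra.
have s0 : 0 < Num.sqrt a by rewrite sqrtr_gt0.
have s'0 : 0 < Num.sqrt a' by rewrite sqrtr_gt0.
have ss : Num.sqrt a' <= Num.sqrt a by rewrite ler_wsqrtr.
rewrite ler_pdivrMr// -{1}(sqr_sqrtr (ltW a0)) -{1}(sqr_sqrtr (ltW a'0)).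
move: (Num.sqrt a) (Num.sqrt a') s0 s'0 ss => x y *; nra.
Qed.

(** The same lower Riemann sum for [t^(-3/2)], whose primitive is [-2 / sqrt t]. *)
Lemma inv_sqrt_step a a' : 0 < a' -> a' <= a ->
  (a - a') / Num.sqrt a ^+ 3 <= 2 * ((Num.sqrt a')^-1 - (Num.sqrt a)^-1).
Proof.
move=> a'0 a'a; have a0 : 0 < a by lra.
have s0 : 0 < Num.sqrt a by rewrite sqrtr_gt0.
have s'0 : 0 < Num.sqrt a' by rewrite sqrtr_gt0.
have ss : Num.sqrt a' <= Num.sqrt a by rewrite ler_wsqrtr.
rewrite -{1}(sqr_sqrtr (ltW a0)) -{1}(sqr_sqrtr (ltW a'0)).
move: (Num.sqrt a) (Num.sqrt a') s0 s'0 ss => x y x0 y0 yx.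
rewrite ler_pdivrMr ?exprn_gt0//.
have -> : 2 * (y^-1 - x^-1) * x ^+ 3 = 2 * (x - y) * x ^+ 2 / y.
  by field; rewrite (gt_eqF x0) (gt_eqF y0).
rewrite ler_pdivlMr//.
have -> : 2 * (x - y) * x ^+ 2 = (x - y) * (2 * x ^+ 2) by ring.
have -> : (x ^+ 2 - y ^+ 2) * y = (x - y) * ((x + y) * y) by ring.
rewrite ler_wpM2l ?subr_ge0//; nra.
Qed.

End real_inequalities.

Lemma sqrD_le2 {R : realType} (a b : R) : (a + b) ^+ 2 <= 2 * a ^+ 2 + 2 * b ^+ 2.
Proof. by have := sqr_ge0 (a - b); lra. Qed.

Lemma double_le_sqr {R : realType} (a : R) : 2 * a <= 1 + a ^+ 2.
Proof. by have := sqr_ge0 (a - 1); lra. Qed.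

(** [q] dominates [|t|^3]; integrability of this single weight therefore gives that of the first two
    powers. *)
Lemma le_weighted_cube {R : realType} (e t : R) (q := `|t| ^+ 3 * (1 + t ^+ 2 / e ^+ 2) ^+ 2) :
  `|t| <= 1 + q /\ t ^+ 2 <= 1 + q.
Proof.
have t0 := normr_ge0 t.
have : `|t| ^+ 3 <= q.
  rewrite /q ler_peMr ?exprn_ge0// expr_ge1// ?lerDl ?divr_ge0 ?sqr_ge0//.
  by rewrite addr_ge0// divr_ge0 ?sqr_ge0.
rewrite -[t ^+ 2]real_normK ?num_real//; move: q (`|t|) t0 => q u u0 h3.
by split; have := sqr_ge0 (u - 1); nra.
Qed.

Lemma eq_le_of {R : realType} (x y : R) : x = y -> x <= y.
Proof. by move=> ->. Qed.

Section martingale_smoothing.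
Context d (T : measurableType d) (R : realType) (P : probability T R).
Variable Z : T -> R.
Hypothesis hZ : density P Z.
Local Notation E := (Ex P Z).
Local Notation I := (Int P Z).
Variables (n : nat) (F : nat -> set (set T)) (eta s : nat -> T -> R).
Variables (e del kap mu K : R).
Hypotheses (e0 : 0 < e) (del01 : 0 <= del <= 1) (kap01 : 0 <= kap <= 1)
  (mu01 : 0 <= mu <= 1) (mukap : mu ^+ 2 <= kap * e) (K0 : 0 <= K).
Hypothesis FT : forall k, (k <= n)%N -> F k `<=` measurable.
Hypothesis Fincr : forall k, (k < n)%N -> F k `<=` F k.+1.
Hypothesis meta : forall k, (k < n)%N -> measurable_wrt (F k.+1) (eta k).
Hypothesis ms : forall k, (k < n)%N -> measurable_wrt (F k) (s k).
Hypothesis s0 : forall k w, (k < n)%N -> 0 <= s k w <= 12 * e ^+ 2.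

Definition psum (f : nat -> T -> R) k w : R := \sum_(i < k) f i w.
Local Notation v := (psum s).
Local Notation U := (psum eta).

Hypothesis vle : forall w, v n w <= 1 + del ^+ 2.
Let q3 k w := `|eta k w| ^+ 3 * (1 + eta k w ^+ 2 / e ^+ 2) ^+ 2.
Hypothesis Heta : forall k (H : T -> R), (k < n)%N -> measurable_wrt (F k) H -> I H ->
  [/\ I (fun w => `|H w| * q3 k w),
      `|E (fun w => H w * eta k w)| <= kap * E (fun w => `|H w| * s k w),
      `|E (fun w => H w * (eta k w ^+ 2 - s k w))| <= mu * E (fun w => `|H w| * s k w) &
      E (fun w => `|H w| * q3 k w) <= K * e * E (fun w => `|H w| * s k w)].

Lemma psumS f k w : psum f k.+1 w = psum f k w + f k w.
Proof. by rewrite /psum big_ord_recr. Qed.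

Lemma psumSE f k : psum f k.+1 = fun w => psum f k w + f k w.
Proof. by apply/funext => w; rewrite psumS. Qed.

Lemma psum0E f : psum f 0 = cst 0.
Proof. by apply/funext => w; rewrite /psum big_ord0. Qed.

Lemma psum0 f w : psum f 0 w = 0.
Proof. by rewrite /psum big_ord0. Qed.

Lemma filtration_le i j : (i <= j <= n)%N -> F i `<=` F j.
Proof.
elim: j => [|j IH]; first by move=> /andP[]; rewrite leqn0 => /eqP-> _; exact: subset_refl.
rewrite leq_eqVlt => /andP[/orP[/eqP->|ij] jn]; first exact: subset_refl.
apply: (subset_trans (IH _)); first by rewrite -ltnS ij ltnW.
exact: Fincr.
Qed.

Lemma measurable_wrt_le i j (X : T -> R) : (i <= j <= n)%N ->
  measurable_wrt (F i) X -> measurable_wrt (F j) X.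
Proof. by move=> ij; apply: measurable_wrt_sub; exact: filtration_le. Qed.

Lemma measurable_wrtT i (X : T -> R) : (i <= n)%N -> measurable_wrt (F i) X -> measurable_fun setT X.
Proof. by move=> ni; apply: measurable_wrt_fun; exact: FT. Qed.

Lemma measurable_wrt_varS k : (k < n)%N -> measurable_wrt (F k) (v k.+1).
Proof.
elim: k => [|k IH] kn; rewrite /measurable_wrt.
  apply: eq_measurable_fun (ms kn) => w _.
  by rewrite psumS psum0 add0r.
rewrite psumSE.
apply: measurable_funD; last exact: ms.
by apply: measurable_wrt_le (IH (ltnW kn)); rewrite leqnSn ltnW.
Qed.

Lemma measurable_wrt_var k : (k <= n)%N -> measurable_wrt (F k) (v k).
Proof.
case: k => [_|k kn].
  rewrite /measurable_wrt; rewrite psum0E; exact: measurable_cst.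
by apply: measurable_wrt_le (measurable_wrt_varS kn); rewrite leqnSn.
Qed.

Lemma measurable_wrt_psum k : (k <= n)%N -> measurable_wrt (F k) (U k).
Proof.
elim: k => [|k IH] kn; rewrite /measurable_wrt.
  by rewrite psum0E; exact: measurable_cst.
rewrite psumSE.
apply: measurable_funD; last exact: meta.
by apply: measurable_wrt_le (IH (ltnW kn)); rewrite leqnSn.
Qed.

Lemma v_incr i j w : (i <= j <= n)%N -> v i w <= v j w.
Proof.
elim: j => [|j IH]; first by move=> /andP[]; rewrite leqn0 => /eqP->.
rewrite leq_eqVlt => /andP[/orP[/eqP->//|ij] jn].
rewrite psumS (le_trans (IH _))//; first by rewrite -ltnS ij ltnW.
by rewrite lerDl; case/andP : (s0 w jn).
Qed.

Lemma v_ge0 k w : (k <= n)%N -> 0 <= v k w.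
Proof. by move=> kn; rewrite -(psum0 s w) v_incr. Qed.

Let q3_ge0 k w : 0 <= q3 k w.
Proof. by rewrite /q3 mulr_ge0 ?sqr_ge0// exprn_ge0. Qed.

Let le_q3 k w : `|eta k w| <= 1 + q3 k w /\ eta k w ^+ 2 <= 1 + q3 k w.
Proof. exact: le_weighted_cube. Qed.

Lemma moment_Int k (H : T -> R) : (k < n)%N -> measurable_wrt (F k) H -> I H ->
  [/\ I (fun w => H w * eta k w), I (fun w => H w * eta k w ^+ 2)
    & I (fun w => `|H w| * s k w)].
Proof.
move=> kn mH IH; have [IHq _ _ _] := Heta kn mH IH.
have mHT := measurable_wrtT (ltnW kn) mH.
have metaT := measurable_wrtT kn (meta kn).
have msT := measurable_wrtT (ltnW kn) (ms kn).
have IH' : I (fun w => `|H w|).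
  apply/integrableP; split.
    apply/measurable_EFinP; apply: measurable_funM; first by msolve.
    by case: hZ.
  case/integrableP: IH => _; congr (_ < _)%E; apply: eq_integral => w _.
  by rewrite /= !normrM normr_id.
have ID := IntD IH' IHq.
split.
- apply: (Int_le hZ (g := fun w => `|H w| + `|H w| * q3 k w)) => //; first by msolve.
  by move=> w; rewrite normrM -[X in X + _]mulr1 -mulrDr ler_wpM2l//; case: (le_q3 k w).
- apply: (Int_le hZ (g := fun w => `|H w| + `|H w| * q3 k w)) => //; first by msolve.
  move=> w; rewrite normrM -[X in X + _]mulr1 -mulrDr ler_wpM2l//.
  by rewrite ger0_norm ?sqr_ge0//; case: (le_q3 k w).
- apply: (Int_le hZ (g := fun w => 12 * e ^+ 2 * `|H w|)); [by msolve|exact: IntZ|].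
  move=> w; have /andP[s1 s2] := s0 w kn.
  by rewrite normrM normr_id (ger0_norm s1) mulrC ler_wpM2r.
Qed.

(* [w |-> w e^{-v}] compensates the drift of [U], whose conditional mean is
   only bounded by [kap * s]. *)
Lemma lyapunov k j (H : T -> R) (M : R) : (k <= j <= n)%N ->
  measurable_wrt (F k) H -> (forall w, 0 <= H w <= M) ->
  I (fun w => H w * (U j w - U k w) ^+ 2) /\
  E (fun w => H w * (expR (- v j w) * (U j w - U k w) ^+ 2))
    <= 3 * E (fun w => H w * (v j w - v k w)).
Proof.
have aux1 (a b u z x y p q : R) : a <= 3 * b -> u <= x + y -> z <= x -> p + y <= a ->
  x <= q -> p + u + z + x <= 3 * (b + q) by lra.
have aux2 (d2 vk vj vn : R) : d2 <= 1 -> vn <= 1 + d2 -> 0 <= vk -> vj <= vn -> vj - vk <= 2.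
  by lra.
have diag i : I (fun w => H w * (U i w - U i w) ^+ 2) /\
  E (fun w => H w * (expR (- v i w) * (U i w - U i w) ^+ 2))
    <= 3 * E (fun w => H w * (v i w - v i w)).
  split.
    by apply: eq_Int (Int_cst hZ 0) => w; rewrite subrr expr0n mulr0.
  rewrite (eq_Ex (g := cst 0)); last by move=> w; rewrite subrr expr0n !mulr0.
  rewrite [in leRHS](eq_Ex (g := cst 0)); last by move=> w; rewrite subrr !mulr0.
  by rewrite Ex_cst// mulr0.
elim: j => [|j IH] kj mH H0M.
  by have -> : k = 0%N by case/andP: kj; rewrite leqn0 => /eqP.
have [->|kj'] := eqVneq k j.+1; first exact: diag.
have {}kj' : (k <= j)%N by case/andP: kj; rewrite leq_eqVlt (negbTE kj').
have jn : (j < n)%N by case/andP: kj.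
have kjn : (k <= j <= n)%N by rewrite kj' ltnW.
have [IH1 IH2] := IH kjn mH H0M.
have mHj : measurable_wrt (F j) H by exact: measurable_wrt_le mH.
have mUk : measurable_wrt (F j) (U k) by apply: measurable_wrt_le (measurable_wrt_psum _) => //; case/andP: kj => _ /ltnW /(leq_trans kj').
have mUj : measurable_wrt (F j) (U j) by apply: measurable_wrt_psum; exact: ltnW.
have mvj : measurable_wrt (F j) (v j) by apply: measurable_wrt_var; exact: ltnW.
have mvj1 : measurable_wrt (F j) (v j.+1) by apply: measurable_wrt_varS.
have msj := ms jn.
pose W w := U j w - U k w.
have mW : measurable_wrt (F j) W by rewrite /measurable_wrt /W; msolve.
have HM w : `|H w| <= M by have /andP[? ?] := H0M w; rewrite ger0_norm.
have MH0 w : 0 <= H w by have /andP[? ?] := H0M w.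
have mWT := measurable_wrtT (ltnW jn) mW.
have mHT := measurable_wrtT (ltnW jn) mHj.
have msT := measurable_wrtT (ltnW jn) msj.
have mvT := measurable_wrtT (ltnW jn) mvj1.
have mvjT := measurable_wrtT (ltnW jn) mvj.
have metaT := measurable_wrtT jn (meta jn).
have IH' : I H by exact: Int_bounded HM.
pose X w := expR (- v j.+1 w).
have X01 w : 0 < X w <= 1.
  by rewrite expR_gt0 -expR0 ler_expR oppr_le0 v_ge0.
have mX : measurable_wrt (F j) X by rewrite /measurable_wrt /X; msolve; exact: measurableT_comp mvj1.
have mXT := measurable_wrtT (ltnW jn) mX.
have IHX : I (fun w => H w * X w).
  apply: (Int_le hZ (g := H)) => //; first by msolve.
  move=> w; have /andP[x0 x1] := X01 w.
  by rewrite normrM !ger0_norm ?ler_piMr// ltW.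
have IHXW : I (fun w => 2 * (H w * X w * W w)).
  apply: IntZ => //; apply: (Int_le hZ (g := fun w => H w + H w * W w ^+ 2)).
  - by msolve.
  - exact: IntD.
  move=> w; have /andP[x0 x1] := X01 w.
  rewrite !normrM (ger0_norm (ltW x0)) (ger0_norm (MH0 w)).
  rewrite -[X in X + _]mulr1 -mulrDr -mulrA ler_wpM2l//.
  apply: (@le_trans _ _ `|W w|); first by rewrite ler_piMl.
  by rewrite -(real_normK (num_real (W w))); have := normr_ge0 (W w); nra.
have mHX : measurable_wrt (F j) (fun w => H w * X w) by rewrite /measurable_wrt; msolve.
have mHXW : measurable_wrt (F j) (fun w => 2 * (H w * X w * W w)) by rewrite /measurable_wrt; msolve.
have [_ J2 J3] := moment_Int jn mHX IHX.
have [J4 _ J6] := moment_Int jn mHXW IHXW.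
have [_ J7 J8] := moment_Int jn mHj IH'.
have [_ _ K2 _] := Heta jn mHX IHX.
have [_ K1 _ _] := Heta jn mHXW IHXW.
have IHXs : I (fun w => H w * X w * s j w).
  apply: eq_Int J3 => w; have /andP[x0 x1] := X01 w.
  by rewrite ger0_norm// mulr_ge0// ltW.
have EHXs : E (fun w => `|H w * X w| * s j w) = E (fun w => H w * X w * s j w).
  apply: eq_Ex => w; have /andP[x0 x1] := X01 w.
  by rewrite ger0_norm// mulr_ge0// ltW.
have IHs : I (fun w => H w * s j w).
  by apply: eq_Int J8 => w; rewrite ger0_norm.
have IHXW2 : I (fun w => H w * X w * W w ^+ 2).
  apply: (Int_le hZ (g := fun w => H w * W w ^+ 2)) => //; first by msolve.
  move=> w; have /andP[x0 x1] := X01 w.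
  rewrite normrM (ger0_norm (sqr_ge0 (W w))) ger0_norm; last by rewrite mulr_ge0// ltW.
  by rewrite ler_wpM2r ?sqr_ge0// ler_piMr.
have UE w : U j.+1 w - U k w = W w + eta j w by rewrite psumS /W; ring.
split.
  apply: (Int_le hZ (g := fun w => 2 * (H w * W w ^+ 2) + 2 * (H w * eta j w ^+ 2))).
  - have := measurable_wrtT _ (measurable_wrt_psum jn) => mU1; have := measurable_wrtT (ltnW jn) mUk => mU2.
    by have {}mU1 := mU1 jn; msolve.
  - by apply: IntD; apply: IntZ.
  move=> w; rewrite UE ger0_norm; last by apply: mulr_ge0 => //; exact: sqr_ge0.
  rewrite !(mulrCA 2) -mulrDr ler_wpM2l//.
  by apply: (le_trans (sqrD_le2 _ _)); apply: eq_le_of; ring.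
have -> : E (fun w => H w * (expR (- v j.+1 w) * (U j.+1 w - U k w) ^+ 2))
  = E (fun w => H w * X w * W w ^+ 2) + E (fun w => 2 * (H w * X w * W w) * eta j w)
    + E (fun w => H w * X w * (eta j w ^+ 2 - s j w)) + E (fun w => H w * X w * s j w).
  have J9 : I (fun w => H w * X w * (eta j w ^+ 2 - s j w)).
    by apply: eq_Int (IntB J2 IHXs) => w; rewrite mulrBr.
  rewrite -ExD// -ExD//; [|exact: IntD].
  rewrite -ExD//; [|by do 2 apply: IntD => //].
  by apply: eq_Ex => w; rewrite UE -/(X w); ring.
have EH0 : 0 <= E (fun w => H w * X w * s j w).
  apply: Ex_ge0 => // w; have /andP[x0 x1] := X01 w; have /andP[? ?] := s0 w jn.
  by rewrite !mulr_ge0// ltW.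
have E60 : 0 <= E (fun w => `|2 * (H w * X w * W w)| * s j w).
  by apply: Ex_ge0 => // w; have /andP[? ?] := s0 w jn; rewrite mulr_ge0.
have B1 := le_trans (ler_norm _) K1.
have B2 := le_trans (ler_norm _) K2.
rewrite EHXs in B2.
have {B2} B2 : E (fun w => H w * X w * (eta j w ^+ 2 - s j w)) <= E (fun w => H w * X w * s j w).
  by apply: le_trans B2 _; rewrite ler_piMl//; case/andP: mu01.
have IHXW2s : I (fun w => H w * X w * W w ^+ 2 * s j w).
  apply: (Int_le hZ (g := fun w => 12 * e ^+ 2 * (H w * X w * W w ^+ 2))).
  - by msolve.
  - exact: IntZ.
  move=> w; have /andP[x0 _] := X01 w; have /andP[s1 s2] := s0 w jn.
  have h0 : 0 <= H w * X w * W w ^+ 2 by rewrite mulr_ge0 ?sqr_ge0// mulr_ge0// ltW.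
  by rewrite normrM (ger0_norm s1) (ger0_norm h0) mulrC ler_wpM2r.
(* [2 |W| <= 1 + W^2] splits the cross term; the part with [W^2 s] is left to the exponential
   factor. *)
have {}B1 : E (fun w => 2 * (H w * X w * W w) * eta j w) <=
   E (fun w => H w * X w * s j w + H w * X w * W w ^+ 2 * s j w).
  apply: le_trans B1 _.
  apply: (@le_trans _ _ (E (fun w => `|2 * (H w * X w * W w)| * s j w))).
    by rewrite ler_piMl//; case/andP: kap01.
  apply: Ex_le => //; first exact: IntD.
  move=> w; have /andP[x0 _] := X01 w; have /andP[s1 s2] := s0 w jn.
  rewrite -mulrDl ler_wpM2r// !normrM (ger0_norm (ltW x0)) (ger0_norm (MH0 w)).
  rewrite (ger0_norm (x := 2))// mulrCA -[X in X + _]mulr1 -mulrDr.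
  rewrite ler_wpM2l ?mulr_ge0 ?(ltW x0)//.
  rewrite -(real_normK (num_real (W w))).
  exact: double_le_sqr.
have Ij1 : I (fun w => H w * (expR (- v j w) * W w ^+ 2)).
  apply: (Int_le hZ (g := fun w => H w * W w ^+ 2)) => //.
    by apply: measurable_funM => //; apply: measurable_funM; msolve; exact: measurableT_comp mvjT.
  move=> w; rewrite ger0_norm; last by rewrite mulr_ge0// mulr_ge0 ?expR_ge0 ?sqr_ge0.
  rewrite ler_wpM2l// ler_piMl ?sqr_ge0// -expR0 ler_expR oppr_le0 v_ge0//.
  exact: ltnW.
have vj_bound w : `|v j w - v k w| <= 2.
  have := v_incr w kjn; have : v j w <= v n w by rewrite v_incr// leqnn andbT ltnW.
  have := v_ge0 w (leq_trans kj' (ltnW jn)); have := vle w.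
  case/andP: del01 => d0 d1; have : del ^+ 2 <= 1 by rewrite expr_le1.
  by move=> b1 b2 b3 b4 b5; rewrite ger0_norm ?subr_ge0//; exact: aux2 b1 b2 b3 b4.
have mvk : measurable_fun setT (v k) by apply: measurable_wrtT (measurable_wrt_var _); rewrite (leq_trans kj')// ltnW.
have Iv : I (fun w => H w * (v j w - v k w)).
  apply: (Int_bounded hZ (M := M * 2)); first by msolve.
  by move=> w; rewrite normrM ler_pM.
have -> : E (fun w => H w * (v j.+1 w - v k w)) = E (fun w => H w * (v j w - v k w)) + E (fun w => H w * s j w).
  by rewrite -ExD//; apply: eq_Ex => w; rewrite psumS; ring.
rewrite ExD// in B1.
(* [(1 + s) expR (- s) <= 1]: the decrease of the exponential factor between [v j] and [v j.+1] pays
   for the drift. *)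
have C1 : E (fun w => H w * X w * W w ^+ 2) + E (fun w => H w * X w * W w ^+ 2 * s j w)
   <= E (fun w => H w * (expR (- v j w) * W w ^+ 2)).
  rewrite -ExD//; apply: Ex_le => //; first exact: IntD.
  move=> w; have /andP[s1 s2] := s0 w jn.
  have -> : H w * X w * W w ^+ 2 + H w * X w * W w ^+ 2 * s j w =
     H w * (X w * (1 + s j w) * W w ^+ 2) by ring.
  rewrite ler_wpM2l// ler_wpM2r ?sqr_ge0//.
  rewrite /X psumS opprD expRD -mulrA ler_piMr ?expR_ge0//.
  by rewrite expRN mulrC ler_pdivrMr ?expR_gt0// mul1r expR_ge1Dx.
have C2 : E (fun w => H w * X w * s j w) <= E (fun w => H w * s j w).
  apply: Ex_le => // w; have /andP[s1 s2] := s0 w jn; have /andP[x0 x1] := X01 w.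
  by rewrite ler_wpM2r// ler_piMr.
(* Each step brings three copies of the expectation of [H X s]: one from the drift, one from the
   variance error since [mu <= 1], one from the variance itself. Hence the constant 3. *)
exact (aux1 _ _ _ _ _ _ _ _ IH2 B1 B2 C1 C2).
Qed.

Variable g : R.
Hypotheses (eg : e <= g) (dg : del <= g) (g1 : g <= 1).

(** Remaining variance with a floor: it starts from a deterministic value, is predictable, and never
    falls below [g^2] because the total is at most [1 + del^2]. *)
Definition remvar k w : R := 1 + del ^+ 2 + g ^+ 2 - v k w.
Local Notation a := remvar.
(** Time of the variance and time of the position are kept apart, so that the position can be sent
    to [n] while the variance stays at [k]. *)
Definition dist k j y w : R := Num.sqrt (a k w + (y - U j w) ^+ 2).
(** The 2 comes from [(y - U n)^2 <= 2 (y - U k)^2 + 2 (U n - U k)^2]; the second term is bounded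
    through [lyapunov], with constant 3, and [v n <= 2] costs the factor [expR 2]. *)
Definition jensenC : R := Num.sqrt (2 + 6 * expR 2).

Let g0 : 0 < g. Proof. exact: lt_le_trans eg. Qed.

Let g20 : 0 < g ^+ 2. Proof. by rewrite exprn_gt0. Qed.

Lemma remvar_ge k w : (k <= n)%N -> g ^+ 2 <= a k w.
Proof.
move=> kn; have : v k w <= v n w by rewrite v_incr// kn leqnn.
by have := vle w; have := g20; rewrite /remvar; lra.
Qed.

Let remvar_gt0 k w : (k <= n)%N -> 0 < a k w.
Proof. by move=> kn; exact: lt_le_trans (remvar_ge w kn). Qed.

Let del2 : del ^+ 2 <= 1.
Proof. by case/andP: del01 => d0 d1; rewrite expr_le1. Qed.

Let g2 : g ^+ 2 <= 1. Proof. by rewrite expr_le1// ltW. Qed.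

Lemma remvar_le3 k w : (k <= n)%N -> a k w <= 3.
Proof. by move=> kn; have := v_ge0 w kn; have := del2; have := g2; rewrite /remvar; lra. Qed.

Lemma remvarS k w : a k.+1 w = a k w - s k w.
Proof. by rewrite /remvar psumS; ring. Qed.

Lemma dist_sqr k j y w : (k <= n)%N -> dist k j y w ^+ 2 = a k w + (y - U j w) ^+ 2.
Proof.
move=> kn; rewrite sqr_sqrtr//.
by have := remvar_gt0 w kn; have := sqr_ge0 (y - U j w); lra.
Qed.

Lemma dist_ge k j y w : (k <= n)%N -> g <= dist k j y w.
Proof.
move=> kn; rewrite -(@ler_pXn2r _ 2) ?nnegrE ?sqrtr_ge0 ?(ltW g0)// dist_sqr//.
by have := remvar_ge w kn; have := sqr_ge0 (y - U j w); lra.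
Qed.

Lemma dist_gt0 k j y w : (k <= n)%N -> 0 < dist k j y w.
Proof. by move=> kn; exact: lt_le_trans (dist_ge _ _ _ kn). Qed.

Lemma measurable_wrt_remvar k : (k <= n)%N -> measurable_wrt (F k) (a k).
Proof. by move=> kn; have := measurable_wrt_var kn; rewrite /measurable_wrt /remvar => ?; msolve. Qed.

Lemma measurable_wrt_dist k j i y : (k <= i)%N -> (j <= i)%N -> (i <= n)%N ->
  measurable_wrt (F i) (dist k j y).
Proof.
move=> ki ji ni; rewrite /measurable_wrt /dist.
have := measurable_wrt_remvar (leq_trans ki ni) => /(@measurable_wrt_le _ i) ma.
have := measurable_wrt_psum (leq_trans ji ni) => /(@measurable_wrt_le _ i) mUj.
have {}ma := ma ltac:(by rewrite ki ni).
have {}mUj := mUj ltac:(by rewrite ji ni).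
by msolve.
Qed.

(** Jensen's inequality for the convex function [t^(-3/2)]: against [F k]-measurable weights, the
    mean of [dist k n] squared is at most that of [jensenC^2] times [dist k k] squared. It moves the
    position from time [k] to time [n], after which the sum over [k] can be bounded pointwise. *)
Lemma dist_jensen k y : (k < n)%N ->
  E (fun w => s k w * (dist k k y w)^-1 ^+ 3)
    <= jensenC ^+ 3 * E (fun w => s k w * (dist k n y w)^-1 ^+ 3).
Proof.
move=> kn; have kn' := ltnW kn.
pose L : R := 2 + 6 * expR 2.
have e20 : 0 < expR 2 :> R := expR_gt0 2.
have L0 : 0 < L by rewrite /L; lra.
have sL0 : 0 < jensenC by rewrite sqrtr_gt0.
have sL : jensenC ^+ 2 = L by rewrite sqr_sqrtr// ltW.
pose m w := jensenC * dist k k y w.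
pose p w := dist k n y w.
have m0 w : 0 < m w by rewrite mulr_gt0// dist_gt0.
have p0 w : 0 < p w by rewrite dist_gt0.
have L1 : 1 <= jensenC.
  by rewrite -(@ler_pXn2r _ 2) ?nnegrE ?(ltW sL0)// sL expr1n /L; lra.
have mg w : g <= m w.
  apply: le_trans (dist_ge k y w kn') _.
  by rewrite ler_peMl// ltW// dist_gt0.
have mi w : (m w)^-1 <= g^-1 by rewrite lef_pV2 ?posrE.
have mi0 w : 0 <= (m w)^-1 by rewrite invr_ge0 ltW.
have sn0 w : 0 <= s k w by case/andP: (s0 w kn).
have sb w : s k w <= 12 * e ^+ 2 by case/andP: (s0 w kn).
have mmw : measurable_wrt (F k) m.
  by have := @measurable_wrt_dist k k k y (leqnn _) (leqnn _) kn'; rewrite /measurable_wrt /m => ?; msolve.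
have msk := ms kn.
(* Up to the factor [- 3 / 2], this is [s k] times the slope at [m^2] of the tangent line of
   [t^(-3/2)]. *)
pose H w := s k w * (m w)^-1 ^+ 5.
have mH : measurable_wrt (F k) H by rewrite /measurable_wrt /H; msolve.
have H0 w : 0 <= H w by rewrite mulr_ge0// exprn_ge0.
have HM w : 0 <= H w <= 12 * e ^+ 2 * g^-1 ^+ 5.
  rewrite H0/= ler_pM ?exprn_ge0//.
  by rewrite lerXn2r ?nnegrE// ltW// invr_gt0.
have knn : (k <= n <= n)%N by rewrite kn' leqnn.
have [IL EL] := lyapunov knn mH HM.
have mHT := measurable_wrtT kn' mH.
have mmT := measurable_wrtT kn' mmw.
have msT := measurable_wrtT kn' msk.
have maT := measurable_wrtT kn' (measurable_wrt_remvar kn').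
have mUkT := measurable_wrtT kn' (measurable_wrt_psum kn').
have mUnT := measurable_wrtT (leqnn n) (measurable_wrt_psum (leqnn n)).
have mvnT := measurable_wrtT (leqnn n) (measurable_wrt_var (leqnn n)).
have mvkT := measurable_wrtT kn' (measurable_wrt_var kn').
have mpT : measurable_fun setT p.
  exact: measurable_wrtT (leqnn n) (measurable_wrt_dist y kn' (leqnn n) (leqnn n)).
have Ib (i : nat) : I (fun w => s k w * (m w)^-1 ^+ i).
  apply: (Int_bounded hZ (M := 12 * e ^+ 2 * g^-1 ^+ i)); first by msolve.
  move=> w; rewrite ger0_norm; last by rewrite mulr_ge0 ?exprn_ge0.
  rewrite ler_pM ?exprn_ge0//.
  by rewrite lerXn2r ?nnegrE// ltW// invr_gt0.
have Ip : I (fun w => s k w * (p w)^-1 ^+ 3).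
  apply: (Int_bounded hZ (M := 12 * e ^+ 2 * g^-1 ^+ 3)); first by msolve.
  have pi0 w : 0 <= (p w)^-1 by rewrite invr_ge0 ltW.
  move=> w; rewrite ger0_norm; last by rewrite mulr_ge0 ?exprn_ge0.
  rewrite ler_pM ?exprn_ge0//.
  rewrite lerXn2r ?nnegrE//; first by rewrite ltW// invr_gt0.
  by rewrite lef_pV2 ?posrE// dist_ge.
have m2 w : m w ^+ 2 = L * (a k w + (y - U k w) ^+ 2).
  by rewrite /m exprMn sL dist_sqr.
have Hm w : H w * m w ^+ 2 = s k w * (m w)^-1 ^+ 3.
  by rewrite /H; field; rewrite gt_eqF.
have IHm : I (fun w => H w * m w ^+ 2) by apply: eq_Int (Ib 3) => w; rewrite Hm.
have IHa : I (fun w => H w * a k w).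
  apply: (Int_le hZ (g := fun w => H w * m w ^+ 2)) => //; first by msolve.
  move=> w; have a0 := remvar_gt0 w kn'; rewrite ger0_norm ?(mulr_ge0 _ (ltW a0))//.
  rewrite ler_wpM2l// m2 /L mulrDr; have u2 := sqr_ge0 (y - U k w).
  by have := mulr_ge0 (ltW L0) u2; rewrite /L; have := mulr_gt0 e20 a0; lra.
have IHu : I (fun w => H w * (y - U k w) ^+ 2).
  apply: (Int_le hZ (g := fun w => H w * m w ^+ 2)) => //; first by msolve.
  move=> w; have a0 := remvar_gt0 w kn'; have u2 := sqr_ge0 (y - U k w).
  rewrite ger0_norm ?(mulr_ge0 _ u2)// ler_wpM2l// m2 mulrDr.
  have L1' : 1 <= L by rewrite /L; lra.
  by have := mulr_gt0 L0 a0; have := ler_peMl u2 L1'; lra.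
have vn2 w : v n w <= 2 by have := vle w; have := del2; lra.
have E1 : E (fun w => H w * (U n w - U k w) ^+ 2) <= 3 * expR 2 * E (fun w => H w * a k w).
  have IX : I (fun w => H w * (expR (- v n w) * (U n w - U k w) ^+ 2)).
    apply: (Int_le hZ (g := fun w => H w * (U n w - U k w) ^+ 2)) => //; first by msolve.
    move=> w; rewrite ger0_norm; last by rewrite mulr_ge0// mulr_ge0 ?expR_ge0 ?sqr_ge0.
    rewrite ler_wpM2l// ler_piMl ?sqr_ge0// -expR0 ler_expR oppr_le0 v_ge0//.
  apply: (@le_trans _ _ (expR 2 * E (fun w => H w * (expR (- v n w) * (U n w - U k w) ^+ 2)))).
    rewrite -ExZ//; apply: Ex_le => //; first exact: IntZ.
    move=> w; rewrite [leRHS]mulrCA ler_wpM2l// mulrA ler_peMl ?sqr_ge0// -expRD -[leLHS]expR0 ler_expR.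
    by have := vn2 w; lra.
  rewrite [leRHS]mulrAC [leRHS]mulrC ler_pM2l//; apply: le_trans EL _.
  rewrite ler_pM2l//; apply: Ex_le => //.
    apply: (Int_le hZ (g := fun w => H w * a k w)) => //; first by msolve.
    move=> w; have v1 := v_incr w knn; rewrite ger0_norm; last by rewrite mulr_ge0// subr_ge0.
    by rewrite ler_wpM2l//; have := vle w; have := g20; rewrite /remvar; lra.
  by move=> w; rewrite ler_wpM2l//; have := vle w; have := g20; rewrite /remvar; lra.
have IHp : I (fun w => H w * p w ^+ 2).
  apply: (Int_le hZ (g := fun w => H w * a k w + (2 * (H w * (y - U k w) ^+ 2)
     + 2 * (H w * (U n w - U k w) ^+ 2)))) => //; first by msolve.
    by apply: IntD => //; apply: IntD; apply: IntZ.
  move=> w; rewrite ger0_norm; last by rewrite mulr_ge0// sqr_ge0.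
  rewrite dist_sqr// !(mulrCA 2) -!mulrDr ler_wpM2l// lerD2l.
  have -> : y - U n w = (y - U k w) + - (U n w - U k w) by ring.
  by apply: (le_trans (sqrD_le2 _ _)); apply: eq_le_of; ring.
have E2 : E (fun w => H w * p w ^+ 2) <= E (fun w => H w * m w ^+ 2).
  apply: (@le_trans _ _ (E (fun w => H w * a k w + (2 * (H w * (y - U k w) ^+ 2)
     + 2 * (H w * (U n w - U k w) ^+ 2))))).
    apply: Ex_le => //; first by apply: IntD => //; apply: IntD; apply: IntZ.
    move=> w; rewrite dist_sqr// !(mulrCA 2) -!mulrDr ler_wpM2l// lerD2l.
    have -> : y - U n w = (y - U k w) + - (U n w - U k w) by ring.
    by apply: (le_trans (sqrD_le2 _ _)); apply: eq_le_of; ring.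
  rewrite ExD//; last by apply: IntD; apply: IntZ.
  rewrite ExD ?ExZ//; [|exact: IntZ|exact: IntZ].
  have -> : E (fun w => H w * m w ^+ 2) = L * (E (fun w => H w * a k w) + E (fun w => H w * (y - U k w) ^+ 2)).
    rewrite -ExD// -ExZ; last exact: IntD.
    by apply: eq_Ex => w; rewrite m2; ring.
  have A0 : 0 <= E (fun w => H w * a k w).
    by apply: Ex_ge0 => // w; rewrite mulr_ge0// ltW// remvar_gt0.
  have B0 : 0 <= E (fun w => H w * (y - U k w) ^+ 2).
    by apply: Ex_ge0 => // w; rewrite mulr_ge0// sqr_ge0.
  by have := mulr_ge0 (ltW e20) B0; rewrite /L; move: E1; lra.
(* The tangent line lies below the convex function, and by [E2] its linear correction has
   nonnegative mean. *)
have E3 : E (fun w => s k w * (m w)^-1 ^+ 3) <= E (fun w => s k w * (p w)^-1 ^+ 3).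
  apply: (@le_trans _ _ (E (fun w => s k w * (m w)^-1 ^+ 3 - 3 / 2 * (H w * p w ^+ 2 - s k w * (m w)^-1 ^+ 3)))).
    rewrite ExB//; last by apply: IntZ; exact: IntB.
    rewrite ExZ; last exact: IntB.
    by rewrite ExB//; move: E2; rewrite (eq_Ex Hm); lra.
  apply: Ex_le => //; first by apply: IntB => //; apply: IntZ; exact: IntB.
  move=> w; have := ler_wpM2l (sn0 w) (tangent_pow32 (m0 w) (p0 w)).
  by apply: le_trans; rewrite /H le_eqVlt; apply/orP; left; apply/eqP; ring.
rewrite -/(p _); apply: le_trans (ler_wpM2l (exprn_ge0 3 (ltW sL0)) E3).
rewrite -ExZ//; apply: Ex_le => //; [|exact: IntZ|].
  apply: eq_Int (IntZ (jensenC ^+ 3) (Ib 3)) => w.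
  by rewrite /m; field; rewrite (gt_eqF sL0) gt_eqF// dist_gt0.
move=> w; rewrite /m le_eqVlt; apply/orP; left; apply/eqP; field.
by rewrite (gt_eqF sL0) gt_eqF// dist_gt0.
Qed.

Variable Ch : R.
Hypotheses (Ch0 : 0 < Ch) (Chb : heat_bound Ch).

(** The conditional probability that [U k] plus an independent centred Gaussian of variance [a k] is
    at most [y]. It interpolates between a normal distribution function at [k = 0] and a smoothed
    indicator at [k = n]. *)
Definition smoothed k y w : R := Phi ((y - U k w) / Num.sqrt (a k w)).

Lemma smoothed01 k y w : 0 <= smoothed k y w <= 1.
Proof. by rewrite /smoothed Phi_ge0 Phi_le1. Qed.

Lemma Int_smoothed k y : (k <= n)%N -> I (smoothed k y).
Proof.
move=> kn; apply: (Int_bounded hZ (M := 1)).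
  have ma := measurable_wrtT kn (measurable_wrt_remvar kn); have mUk := measurable_wrtT kn (measurable_wrt_psum kn).
  by rewrite /smoothed; msolve.
by move=> w; have /andP[? ?] := smoothed01 k y w; rewrite ger0_norm.
Qed.

(** [mu <= sqrt (kap e)] and the arithmetic-geometric inequality. It distributes the variance error
    over the drift error and the third-order error. *)
Let mu_split t : 0 <= t -> mu * t ^+ 2 <= kap * t + e * t ^+ 3.
Proof.
move=> t0; have -> : kap * t + e * t ^+ 3 = t * (kap + e * t ^+ 2) by ring.
rewrite expr2 mulrCA ler_wpM2l//.
case/andP: kap01 => k0 _; case/andP: mu01 => m0 _.
have et : 0 <= e * t ^+ 2 by rewrite mulr_ge0 ?sqr_ge0// ltW.
rewrite -(@ler_pXn2r _ 2) ?nnegrE ?addr_ge0//; last exact: mulr_ge0.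
rewrite exprMn; have := ler_wpM2r (sqr_ge0 t) mukap.
by have := sqr_ge0 (kap - e * t ^+ 2); nra.
Qed.

(** The coefficients [A] and [B] of the expansion are [F k]-measurable because [a k.+1] already is.
    They can thus serve as test functions in the moment hypotheses, which cancel the first and
    second order terms up to [kap] and [mu]. *)
Lemma smooth_step k y : (k < n)%N ->
  `|E (smoothed k.+1 y) - E (smoothed k y)| <=
  Ch * (2 * kap * E (fun w => s k w / Num.sqrt (a k w))
        + (K + 2) * e * E (fun w => s k w * (dist k k y w)^-1 ^+ 3)).
Proof.
move=> kn; have kn' := ltnW kn.
case/andP: (kap01) => kp0 _; case/andP: (mu01) => m0 _.
pose A w := gauss ((y - U k w) / Num.sqrt (a k.+1 w)) / Num.sqrt (a k.+1 w).
pose B w := 2^-1 * (gauss1 ((y - U k w) / Num.sqrt (a k.+1 w)) / a k.+1 w).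
pose ri w := (dist k k y w)^-1.
pose D w := smoothed k.+1 y w - smoothed k y w + A w * eta k w
   - B w * (eta k w ^+ 2 - s k w).
have sn0 w : 0 <= s k w by case/andP: (s0 w kn).
have sb w : s k w <= 12 * e ^+ 2 by case/andP: (s0 w kn).
have sa0 w : 0 < Num.sqrt (a k w) by rewrite sqrtr_gt0 remvar_gt0.
have ri0 w : 0 < ri w by rewrite invr_gt0 dist_gt0.
have ria w : ri w <= (Num.sqrt (a k w))^-1.
  rewrite lef_pV2 ?posrE ?dist_gt0// ler_wsqrtr//.
  by rewrite lerDl sqr_ge0.
have sag w : (Num.sqrt (a k w))^-1 <= g^-1.
  rewrite lef_pV2 ?posrE//.
  rewrite -(@ler_pXn2r _ 2) ?nnegrE ?(ltW g0) ?(ltW (sa0 w))//.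
  by rewrite sqr_sqrtr ?remvar_ge// ltW// remvar_gt0.
have rig w : ri w <= g^-1 := le_trans (ria w) (sag w).
have HB w : [/\ `|A w| <= Ch / Num.sqrt (a k w), `|B w| <= Ch * ri w ^+ 2 &
  `|D w| <= Ch * (ri w ^+ 3 * q3 k w + e * (s k w * ri w ^+ 3))].
  have [|||b1 b2 b3] := @Chb e (a k w) (a k.+1 w) (y - U k w) (eta k w) e0.
  - apply: le_trans (remvar_ge w kn).
    by rewrite lerXn2r ?nnegrE// ltW.
  - by rewrite remvarS gerBl.
  - by rewrite remvarS; have := sb w; lra.
  have aa : a k w - a k.+1 w = s k w by rewrite remvarS; ring.
  split.
  - rewrite ger0_norm//.
    by rewrite /A divr_ge0 ?sqrtr_ge0// ltW// gauss_gt0.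
  - rewrite -exprVn -/(dist k k y w) in b2; apply: le_trans b2.
    by rewrite /B normrM ger0_norm// ler_piMl//; lra.
  have -> : D w = Phi ((y - U k w - eta k w) / Num.sqrt (a k.+1 w)) -
           Phi ((y - U k w) / Num.sqrt (a k w)) +
           eta k w * (gauss ((y - U k w) / Num.sqrt (a k.+1 w)) / Num.sqrt (a k.+1 w)) -
           (eta k w ^+ 2 - (a k w - a k.+1 w)) / 2 *
           (gauss1 ((y - U k w) / Num.sqrt (a k.+1 w)) / a k.+1 w).
    rewrite /D /smoothed /A /B aa psumS opprD addrA.
    by move: (Phi _) => x1; move: (Phi _) (gauss _) (gauss1 _) => x2 x3 x4; ring.
  apply: le_trans b3 _; rewrite aa -exprVn -/(ri w) -mulrA ler_pM2l// -/(dist k k y w).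
  rewrite /ri /q3; apply: eq_le_of; field.
  by rewrite (gt_eqF e0) (gt_eqF (dist_gt0 k y w kn')).
have mak := measurable_wrt_remvar kn'.
have ma1 : measurable_wrt (F k) (a k.+1).
  by have := measurable_wrt_varS kn; rewrite /measurable_wrt /remvar => ?; msolve.
have mUk := measurable_wrt_psum kn'.
have mri : measurable_wrt (F k) ri.
  by have := @measurable_wrt_dist k k k y (leqnn _) (leqnn _) kn'; rewrite /measurable_wrt /ri => ?; msolve.
have mA : measurable_wrt (F k) A by rewrite /measurable_wrt /A; msolve.
have mB : measurable_wrt (F k) B by rewrite /measurable_wrt /B; msolve.
have msk := ms kn.
have mAT := measurable_wrtT kn' mA; have mBT := measurable_wrtT kn' mB.
have mriT := measurable_wrtT kn' mri; have msT := measurable_wrtT kn' msk.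
have maT := measurable_wrtT kn' mak.
have Vg0 : 0 <= g^-1 by rewrite invr_ge0 ltW.
have Ch0' := ltW Ch0.
have IA : I A.
  apply: (Int_bounded hZ (M := Ch / g)) => // w; have [h _ _] := HB w.
  by rewrite (le_trans h)// ler_wpM2l.
have IB : I B.
  apply: (Int_bounded hZ (M := Ch * g^-1 ^+ 2)) => // w; have [_ h _] := HB w.
  by rewrite (le_trans h)// ler_wpM2l// lerXn2r ?nnegrE// ltW.
have mr3 : measurable_wrt (F k) (fun w => ri w ^+ 3).
  by rewrite /measurable_wrt; msolve.
have Ir3 : I (fun w => ri w ^+ 3).
  apply: (Int_bounded hZ (M := g^-1 ^+ 3)) => //; first by msolve.
  by move=> w; rewrite ger0_norm ?exprn_ge0 ?(ltW (ri0 w))// lerXn2r ?nnegrE// ltW.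
have Is (c : T -> R) (M : R) : measurable_fun setT c -> (forall w, 0 <= c w <= M) ->
   I (fun w => s k w * c w).
  move=> mc cM; apply: (Int_bounded hZ (M := 12 * e ^+ 2 * M)); first by msolve.
  move=> w; have /andP[c1 c2] := cM w; rewrite ger0_norm ?mulr_ge0//.
  by rewrite ler_pM.
have IX : I (fun w => s k w / Num.sqrt (a k w)).
  apply: (Is _ g^-1); first by msolve.
  by move=> w; rewrite sag invr_ge0 sqrtr_ge0.
have IY : I (fun w => s k w * ri w ^+ 3).
  apply: (Is _ (g^-1 ^+ 3)); first by msolve.
  by move=> w; rewrite exprn_ge0 ?(ltW (ri0 w))//= lerXn2r ?nnegrE// ltW.
have [A1 _ A3] := moment_Int kn mA IA.
have [_ B2 B3] := moment_Int kn mB IB.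
have [_ _ R3] := moment_Int kn mr3 Ir3.
have [_ KA _ _] := Heta kn mA IA.
have [_ _ KB _] := Heta kn mB IB.
have [Iq _ _ Kq] := Heta kn mr3 Ir3.
have IBs : I (fun w => B w * s k w).
  apply: (Int_le hZ _ B3); first by msolve.
  by move=> w; rewrite normrM (ger0_norm (sn0 w)).
have IB' : I (fun w => B w * (eta k w ^+ 2 - s k w)).
  by apply: eq_Int (IntB B2 IBs) => w; rewrite mulrBr.
have IS1 := Int_smoothed y kn; have IS0 := Int_smoothed y kn'.
have ID : I D.
  rewrite /D; apply: IntB => //.
  by apply: IntD => //; exact: IntB.
have r3n w : `|ri w ^+ 3| = ri w ^+ 3 by rewrite ger0_norm// exprn_ge0// ltW.
have Iq' : I (fun w => ri w ^+ 3 * q3 k w) by apply: eq_Int Iq => w; rewrite r3n.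
have Y0 : 0 <= E (fun w => s k w * ri w ^+ 3).
  by apply: Ex_ge0 => // w; rewrite mulr_ge0// exprn_ge0// ltW.
have X0 : 0 <= E (fun w => s k w / Num.sqrt (a k w)).
  by apply: Ex_ge0 => // w; rewrite divr_ge0// sqrtr_ge0.
have -> : E (smoothed k.+1 y) - E (smoothed k y) =
  - E (fun w => A w * eta k w) + E (fun w => B w * (eta k w ^+ 2 - s k w)) + E D.
  rewrite -ExB// -mulN1r -ExZ// -ExD//; last exact: IntZ.
  rewrite -ExD//; last by apply: IntD => //; exact: IntZ.
  apply: eq_Ex => w; rewrite /D.
  by move: (A w) (B w) (smoothed k.+1 y w) (smoothed k y w) => x1 x2 x3 x4; ring.
have bA : `|E (fun w => A w * eta k w)| <= Ch * kap * E (fun w => s k w / Num.sqrt (a k w)).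
  apply: le_trans KA _; rewrite (mulrC Ch) -mulrA ler_wpM2l//.
  rewrite -ExZ//; apply: Ex_le => //; first exact: IntZ.
  by move=> w; have [h _ _] := HB w; rewrite mulrC mulrCA ler_wpM2l.
(* The bound [mu ri^2] is split by [mu_split], and [ri <= 1 / sqrt a] gives its first part the form
   of the drift error. *)
have bB : `|E (fun w => B w * (eta k w ^+ 2 - s k w))| <=
   Ch * (kap * E (fun w => s k w / Num.sqrt (a k w)) + e * E (fun w => s k w * ri w ^+ 3)).
  apply: le_trans KB _; rewrite -!ExZ// -ExD; [|exact: IntZ|exact: IntZ].
  rewrite -ExZ; last by apply: IntD; exact: IntZ.
  apply: Ex_le => //; [exact: IntZ|by apply: IntZ; apply: IntD; exact: IntZ|].
  move=> w; have [_ h _] := HB w.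
  have P1 := mu_split (ltW (ri0 w)).
  have P2 := ler_wpM2l kp0 (ria w).
  have P3 : mu * ri w ^+ 2 <= kap / Num.sqrt (a k w) + e * ri w ^+ 3.
    by apply: (le_trans P1); rewrite lerD2r.
  have P4 := ler_wpM2l (mulr_ge0 Ch0' (sn0 w)) P3.
  have P5 := ler_wpM2l (mulr_ge0 m0 (sn0 w)) h.
  rewrite [leLHS](_ : _ = mu * s k w * `|B w|); last by ring.
  apply: le_trans P5 _.
  rewrite [leLHS](_ : _ = Ch * s k w * (mu * ri w ^+ 2)); last by ring.
  by apply: le_trans P4 _; apply: eq_le_of; ring.
have bD : `|E D| <= Ch * ((K + 1) * e * E (fun w => s k w * ri w ^+ 3)).
  apply: (@le_trans _ _ (E (fun w => Ch * (ri w ^+ 3 * q3 k w + e * (s k w * ri w ^+ 3))))).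
    apply: Ex_norm => //; first by apply: IntZ; apply: IntD => //; exact: IntZ.
    by move=> w; have [] := HB w.
  rewrite ExZ; last by apply: IntD => //; exact: IntZ.
  rewrite ler_pM2l// ExD//; last exact: IntZ.
  rewrite ExZ// mulrDl mulrDl mul1r lerD2r.
  rewrite (eq_Ex (g := fun w => ri w ^+ 3 * q3 k w)) in Kq; last by move=> w; rewrite r3n.
  apply: le_trans Kq _; rewrite le_eqVlt; apply/orP; left; apply/eqP; congr (_ * _).
  by apply: eq_Ex => w; rewrite r3n mulrC.
rewrite -/(ri _); apply: le_trans (ler_normD _ _) _; apply: le_trans (lerD (ler_normD _ _) (lexx _)) _.
rewrite normrN; move: bA bB bD.
have -> : E (fun w => s k w * (dist k k y w)^-1 ^+ 3) = E (fun w => s k w * ri w ^+ 3) by [].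
move: (E (fun w => s k w / _)) (E (fun w => s k w * ri w ^+ 3)) => X Y c1 c2 c3.
lra.
Qed.

Lemma Int_step1 k : (k < n)%N -> I (fun w => s k w / Num.sqrt (a k w)).
Proof.
move=> kn; have kn' := ltnW kn.
have msT := measurable_wrtT kn' (ms kn); have maT := measurable_wrtT kn' (measurable_wrt_remvar kn').
apply: (Int_bounded hZ (M := 12 * e ^+ 2 * g^-1)); first by msolve.
move=> w; have /andP[s1 s2] := s0 w kn.
have sa0 : 0 < Num.sqrt (a k w) by rewrite sqrtr_gt0 remvar_gt0.
rewrite ger0_norm; last by rewrite divr_ge0// ltW.
rewrite ler_pM ?invr_ge0 ?(ltW sa0)// lef_pV2 ?posrE//.
rewrite -(@ler_pXn2r _ 2) ?nnegrE ?(ltW g0) ?(ltW sa0)//.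
by rewrite sqr_sqrtr ?remvar_ge// ltW// remvar_gt0.
Qed.

Lemma Int_step3 k j y : (k < n)%N -> (j <= n)%N ->
  I (fun w => s k w * (dist k j y w)^-1 ^+ 3).
Proof.
move=> kn jn; have kn' := ltnW kn.
have msT := measurable_wrtT kn' (ms kn).
have mdT := measurable_wrtT (leqnn n) (measurable_wrt_dist y kn' jn (leqnn n)).
apply: (Int_bounded hZ (M := 12 * e ^+ 2 * g^-1 ^+ 3)); first by msolve.
move=> w; have /andP[s1 s2] := s0 w kn.
have d0 := dist_gt0 j y w kn'.
rewrite ger0_norm; last by rewrite mulr_ge0// exprn_ge0// invr_ge0 ltW.
rewrite ler_pM ?exprn_ge0 ?invr_ge0 ?(ltW d0)// lerXn2r ?nnegrE ?invr_ge0 ?(ltW d0) ?(ltW g0)//.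
by rewrite lef_pV2 ?posrE ?dist_ge.
Qed.

Let enddist y w : R := Num.sqrt (g ^+ 2 + (y - U n w) ^+ 2).

(** Summed over the steps, [s / sqrt a] and [s / dist^3] are lower Riemann sums. The first is at
    most [2 sqrt (a 0) <= 4], the second at most twice the inverse final distance, which involves
    only the law of [U n]. *)
Lemma smoothed_total y :
  `|E (smoothed n y) - Phi (y / Num.sqrt (1 + del ^+ 2 + g ^+ 2))| <=
  Ch * (8 * kap + 2 * (K + 2) * jensenC ^+ 3 * e
        * E (fun w => (Num.sqrt (g ^+ 2 + (y - U n w) ^+ 2))^-1)).
Proof.
have -> : Phi (y / Num.sqrt (1 + del ^+ 2 + g ^+ 2)) = E (smoothed 0 y).
  rewrite -[LHS](Ex_cst hZ); apply: eq_Ex => w.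
  by rewrite /smoothed /remvar !psum0 !subr0.
pose X k := E (fun w => s k w / Num.sqrt (a k w)).
pose Y k := E (fun w => s k w * (dist k n y w)^-1 ^+ 3).
have jC0 : 0 <= jensenC ^+ 3 by rewrite exprn_ge0// sqrtr_ge0.
have [kp0 _] := andP kap01.
have S m : (m <= n)%N -> `|E (smoothed m y) - E (smoothed 0 y)| <=
    Ch * (2 * kap * (\sum_(i < m) X i) + (K + 2) * e * (jensenC ^+ 3 * \sum_(i < m) Y i)).
  elim: m => [|m IH] mn; first by rewrite subrr normr0 !big_ord0 !mulr0 addr0 mulr0.
  rewrite !big_ord_recr/=.
  have := IH (ltnW mn); have := smooth_step y mn.
  have := dist_jensen y mn; rewrite -/(Y m) -/(X m).
  move: (\sum_(i < m) X i) (\sum_(i < m) Y i) (X m) (Y m) => SX SY Xm Ym.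
  set W := E (fun w => s m w * (dist m m y w)^-1 ^+ 3) => WY b1 b2.
  have Ke : 0 <= (K + 2) * e by rewrite mulr_ge0 ?addr_ge0// ltW.
  have {}WY := ler_wpM2l Ke WY.
  have Tr : `|E (smoothed m.+1 y) - E (smoothed 0 y)| <= 
     `|E (smoothed m.+1 y) - E (smoothed m y)| + `|E (smoothed m y) - E (smoothed 0 y)|.
    by apply: le_trans (ler_normD _ _); rewrite addrA subrK.
  have b3 : Ch * (2 * kap * Xm + (K + 2) * e * W) <= Ch * (2 * kap * Xm + (K + 2) * e * (jensenC ^+ 3 * Ym)).
    by rewrite ler_pM2l// lerD2l.
  apply: le_trans Tr _; apply: le_trans (lerD (le_trans b1 b3) b2) _.
  by apply: eq_le_of; ring.
apply: le_trans (S n (leqnn n)) _; rewrite ler_pM2l//.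
have a0w w : a 0 w = 1 + del ^+ 2 + g ^+ 2 by rewrite /remvar psum0 subr0.
have tel1 m w : (m <= n)%N -> \sum_(i < m) s i w / Num.sqrt (a i w) <=
   2 * (Num.sqrt (a 0 w) - Num.sqrt (a m w)).
  elim: m => [|m IH] mn; first by rewrite big_ord0 subrr mulr0.
  rewrite big_ord_recr/=; have := IH (ltnW mn).
  have := @sqrt_step _ (a m w) (a m.+1 w) (remvar_gt0 w mn).
  have -> : a m w - a m.+1 w = s m w by rewrite remvarS; ring.
  have -> : a m.+1 w <= a m w.
    by rewrite remvarS gerBl; case/andP: (s0 w mn).
  move=> /(_ isT); lra.
have tel3 m w : (m <= n)%N -> \sum_(i < m) s i w * (dist i n y w)^-1 ^+ 3 <=
   2 * ((dist m n y w)^-1 - (dist 0 n y w)^-1).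
  elim: m => [|m IH] mn; first by rewrite big_ord0 subrr mulr0.
  rewrite big_ord_recr/=; have := IH (ltnW mn).
  have y2 := sqr_ge0 (y - U n w).
  have := @inv_sqrt_step _ (a m w + (y - U n w) ^+ 2) (a m.+1 w + (y - U n w) ^+ 2).
  have -> : 0 < a m.+1 w + (y - U n w) ^+ 2 by have := remvar_gt0 w mn; lra.
  have -> : a m w + (y - U n w) ^+ 2 - (a m.+1 w + (y - U n w) ^+ 2) = s m w by rewrite remvarS; ring.
  have -> : a m.+1 w + (y - U n w) ^+ 2 <= a m w + (y - U n w) ^+ 2.
    by rewrite lerD2r remvarS gerBl; case/andP: (s0 w mn).
  move=> /(_ isT isT); rewrite -/(dist m n y w) -/(dist m.+1 n y w) -exprVn; lra.
have IXo (i : 'I_n) : I (fun w => s i w / Num.sqrt (a i w)) by exact: Int_step1.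
have IYo (i : 'I_n) : I (fun w => s i w * (dist i n y w)^-1 ^+ 3) by exact: Int_step3.
have SX : \sum_(i < n) X i <= 4.
  rewrite /X -(Ex_sum hZ (index_enum 'I_n) (fun i : 'I_n => IXo i)).
  rewrite -[leRHS](Ex_cst hZ); apply: Ex_le => //; [exact: Int_sum|exact: Int_cst|].
  move=> w; apply: le_trans (tel1 n w (leqnn n)) _.
  have : Num.sqrt (a 0 w) <= 2.
    rewrite -(@ler_pXn2r _ 2) ?nnegrE ?sqrtr_ge0// sqr_sqrtr; last by rewrite ltW// remvar_gt0.
    by apply: le_trans (remvar_le3 w (leq0n n)) _; rewrite -natrX ler_nat.
  have := sqrtr_ge0 (a n w); lra.
have Irho : I (fun w => (enddist y w)^-1).
  have mUnT := measurable_wrtT (leqnn n) (measurable_wrt_psum (leqnn n)).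
  apply: (Int_bounded hZ (M := g^-1)); first by rewrite /enddist; msolve.
  move=> w; have y2 := sqr_ge0 (y - U n w).
  have r0 : 0 < enddist y w by rewrite sqrtr_gt0; have := g20; lra.
  rewrite ger0_norm ?invr_ge0 ?(ltW r0)// lef_pV2 ?posrE//.
  rewrite -(@ler_pXn2r _ 2) ?nnegrE ?(ltW g0) ?(ltW r0)// sqr_sqrtr ?lerDl//.
  by have := g20; lra.
have SY : \sum_(i < n) Y i <= 2 * E (fun w => (enddist y w)^-1).
  rewrite /Y -(Ex_sum hZ (index_enum 'I_n) (fun i : 'I_n => IYo i)).
  rewrite -ExZ//; apply: Ex_le => //; [exact: Int_sum|exact: IntZ|].
  move=> w; apply: le_trans (tel3 n w (leqnn n)) _.
  have : 0 < (dist 0 n y w)^-1 by rewrite invr_gt0 dist_gt0.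
  have : (dist n n y w)^-1 <= (enddist y w)^-1.
    have y2 := sqr_ge0 (y - U n w).
    rewrite lef_pV2 ?posrE ?dist_gt0//; last by rewrite sqrtr_gt0; have := g20; lra.
    by rewrite ler_wsqrtr// lerD2r remvar_ge.
  lra.
have Ke : 0 <= (K + 2) * e by rewrite mulr_ge0 ?addr_ge0// ltW.
have T1 := ler_wpM2l kp0 SX.
have T2 := ler_wpM2l (mulr_ge0 Ke jC0) SY.
rewrite [X in _ <= 8 * kap + X](_ : _ = (K + 2) * e * jensenC ^+ 3 * (2 * E (fun w => (enddist y w)^-1))); last first.
  by rewrite /enddist; ring.
rewrite [X in _ + X <= _](_ : _ = (K + 2) * e * jensenC ^+ 3 * \sum_(i < n) Y i); last by ring.
rewrite lerD//; lra.
Qed.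

End martingale_smoothing.

(** * From smoothed to Kolmogorov distance *)

(** A shift [t], in units of [g], for which [9 K / t^2 <= 1 / 24], where [K = 864] is the constant
    of [Phi_tail]. *)
Definition smoothing_shift {R : realType} : R := Num.sqrt (9 * 864 * 24 + 1).

(** With [v = u / g], the squared Gaussian argument is at least [(t + v)^2 / 3], and
    [(t + v)^4 >= t^2 (1 + v^2)] trades two of the four powers for the small factor [1 / t^2]. *)
Lemma gaussian_tail_le_bump {R : realType} (K t th g a u : R) : 0 < K -> 1 <= t ->
  th = 9 * K / t ^+ 2 -> 0 < g -> g ^+ 2 <= a <= 3 * g ^+ 2 -> 0 <= u ->
  K / (1 + ((t * g + u) / Num.sqrt a) ^+ 2) ^+ 2 <= th / (1 + (u / g) ^+ 2).
Proof.
move=> K0 t1 thE g0 /andP[ga ag] u0; have t0 : 0 < t by lra.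
have t20 : 0 < t ^+ 2 by rewrite exprn_gt0.
have g20 : 0 < g ^+ 2 by rewrite exprn_gt0.
have a0 : 0 < a by lra.
rewrite expr_div_n (sqr_sqrtr (ltW a0)).
pose v := u / g; have v0 : 0 <= v by rewrite divr_ge0// ltW.
have uE : u = g * v by rewrite /v; field; rewrite gt_eqF.
rewrite -/v; have v2 := sqr_ge0 v.
have X : (t + v) ^+ 2 / 3 <= 1 + (t * g + u) ^+ 2 / a.
  have -> : (t * g + u) ^+ 2 = g ^+ 2 * (t + v) ^+ 2 by rewrite uE; ring.
  have tv := sqr_ge0 (t + v).
  have : (t + v) ^+ 2 / 3 <= g ^+ 2 * (t + v) ^+ 2 / a.
    rewrite ler_pdivlMr// mulrAC ler_pdivrMr//.
    by have := ler_wpM2l tv ag; lra.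
  lra.
have tv0 : 0 < (t + v) ^+ 2 / 3 by rewrite divr_gt0// exprn_gt0//; lra.
have Y : t ^+ 2 * (1 + v ^+ 2) <= (t + v) ^+ 2 * (t + v) ^+ 2.
  have tv : 0 <= t * v by rewrite mulr_ge0// ltW.
  have t21 : 1 <= t ^+ 2 by rewrite exprn_ege1.
  by apply: ler_pM; lra.
have X2 := ler_sqr_of (ltW tv0) X.
move: X2; set Q := 1 + (t * g + u) ^+ 2 / a => X2.
have Q0 : 0 < Q ^+ 2 by apply: lt_le_trans X2; rewrite exprn_gt0.
rewrite thE -mulrA -invfM ler_pdivrMr// [leRHS]mulrAC ler_pdivlMr; last first.
  by rewrite mulr_gt0//; lra.
have : t ^+ 2 * (1 + v ^+ 2) <= 9 * Q ^+ 2.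
  by move: X2 Y; rewrite expr_div_n; set W := (t + v) ^+ 2; rewrite expr2; lra.
by move=> /(ler_wpM2l (ltW K0)); lra.
Qed.

Section concentration.
Context d (T : measurableType d) (R : realType) (P : probability T R).
Variable Z : T -> R.
Hypothesis hZ : density P Z.
Local Notation E := (Ex P Z).
Local Notation I := (Int P Z).
Variable U : T -> R.
Implicit Types y rho t g : R.
Hypothesis mU : measurable_fun setT U.

Definition ind_le y w : R := (U w <= y)%R%:R.

Lemma measurable_ind_le y : measurable_fun setT (ind_le y).
Proof.
have -> : ind_le y = \1_(U @^-1` `]-oo, y]).
  apply/funext => w; rewrite /ind_le indicE.
  suff -> : (w \in U @^-1` `]-oo, y]) = (U w <= y) by [].
  by apply/idP/idP; rewrite inE/= in_itv.
apply: measurable_indic; rewrite -[X in measurable X]setTI.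
exact: mU.
Qed.

Lemma ind_le01 y w : 0 <= ind_le y w <= 1.
Proof. by rewrite /ind_le; case: (U w <= y); rewrite ?lexx ?ler01. Qed.

Lemma Int_ind_le y : I (ind_le y).
Proof.
apply: (Int_bounded hZ (M := 1)) (measurable_ind_le y) _ => w.
by have /andP[? ?] := ind_le01 y w; rewrite ger0_norm.
Qed.

Definition ind_ball y rho w : R := (`|U w - y| <= rho)%R%:R.

Lemma ind_ballE y rho : ind_ball y rho =
  fun w => (ind_le (y + rho) w) * (1 - (\1_(U @^-1` `]-oo, y - rho[) w)).
Proof.
apply/funext => w; rewrite /ind_ball /ind_le indicE.
have -> : (w \in U @^-1` `]-oo, y - rho[) = (U w < y - rho).
  by apply/idP/idP; rewrite inE/= in_itv.
rewrite ler_norml lerBlDl lerBrDl (leNgt (y - rho)).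
by case: (U w <= _); case: (U w < _); rewrite /= ?mul0r ?mul1r ?subrr ?subr0.
Qed.

Lemma measurable_ind_ball y rho : measurable_fun setT (ind_ball y rho).
Proof.
rewrite ind_ballE; apply: measurable_funM; first exact: measurable_ind_le.
apply: measurable_funB; first exact: measurable_cst.
by apply: measurable_indic; rewrite -[X in measurable X]setTI; exact: mU.
Qed.

Lemma Int_ind_ball y rho : I (ind_ball y rho).
Proof.
apply: (Int_bounded hZ (M := 1)) (measurable_ind_ball y rho) _ => w.
by rewrite /ind_ball; case: (`|U w - y| <= rho); rewrite ?normr1 ?normr0 ?ler01.
Qed.

Variable D : R.
Hypothesis KD : forall y, `|E (ind_le y) - Phi y| <= D.

(** The closed ball is enlarged to []y - 2 rho, y + rho]], whose mass is a difference of two values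
    of the distribution function; hence 3 in place of 2. *)
Lemma concentration y rho : 0 < rho -> E (ind_ball y rho) <= 3 * rho + 2 * D.
Proof.
move=> r0.
apply: (@le_trans _ _ (E (ind_le (y + rho)) - E (ind_le (y - 2 * rho)))).
  rewrite -ExB; [|exact: Int_ind_le|exact: Int_ind_le].
  apply: Ex_le => //; [exact: Int_ind_ball|by apply: IntB; exact: Int_ind_le|].
  move=> w; rewrite /ind_ball /ind_le.
  have [h1|h1] := leP (U w) (y - 2 * rho).
    have -> : U w <= y + rho by lra.
    rewrite subrr; suff -> : (`|U w - y| <= rho) = false by [].
    by apply/negbTE; rewrite -ltNge ltr_normr; apply/orP; right; lra.
  rewrite subr0; case: (leP `|U w - y| rho) => // h2.
  suff -> : U w <= y + rho by [].
  by move: h2; rewrite ler_norml => /andP[? ?]; lra.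
have h1 := KD (y + rho); have h2 := KD (y - 2 * rho).
have yr : y - 2 * rho <= y + rho by lra.
have /andP[_ h3] := PhiB yr.
by move: h1 h2; rewrite !ler_norml => /andP[_ ?] /andP[? _]; lra.
Qed.

(** For [|t|] between [2^j g] and [2^(j+1) g] the summand of index [j + 1], with coefficient [b j],
    suffices; beyond the last shell [b J] does. Since the predecessor of 0 is 0, [b 0] also serves
    the innermost ball. *)
Lemma dyadic_le (f : R -> R) (b : nat -> R) (g : R) (J : nat) t :
  (forall j, 0 <= b j) -> f t <= b 0%N ->
  (forall j, 2 ^+ j * g <= `|t| -> f t <= b j) ->
  f t <= b J + \sum_(j < J.+1) b j.-1 * (`|t| <= 2 ^+ j * g)%R%:R.
Proof.
move=> b0 f0 fb; elim: J => [|J IH].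
  rewrite big_ord_recl big_ord0 /= addr0.
  by case: (`|t| <= 2 ^+ 0 * g); rewrite ?mulr1 ?mulr0 ?addr0// (le_trans f0)// lerDl.
have S0 : 0 <= \sum_(j < J.+1) b j.-1 * (`|t| <= 2 ^+ j * g)%R%:R.
  by apply: sumr_ge0 => j _; rewrite mulr_ge0.
rewrite big_ord_recr/=.
have [h|/ltW h] := leP `|t| (2 ^+ J.+1 * g); last first.
  by rewrite mulr0 addr0 (le_trans (fb _ h))// lerDl.
have [h'|h'] := leP (2 ^+ J * g) `|t|.
  by rewrite mulr1 (le_trans (fb _ h'))// addrCA addrA lerDr addr_ge0.
move: IH; rewrite mulr1; have := b0 J.+1; lra.
Qed.

Lemma Ex_dyadic_le (f : R -> R) (b : nat -> R) (g : R) (J : nat) y : 0 < g ->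
  I (fun w => f (U w - y)) ->
  (forall j, 0 <= b j) -> (forall t, f t <= b 0%N) ->
  (forall j t, 2 ^+ j * g <= `|t| -> f t <= b j) ->
  E (fun w => f (U w - y)) <=
    b J + \sum_(j < J.+1) b j.-1 * (3 * (2 ^+ j * g) + 2 * D).
Proof.
move=> g0 If b0 f0 fb.
have IS (j : 'I_J.+1) : I (fun w => b j.-1 * ind_ball y (2 ^+ j * g) w).
  by apply: IntZ; exact: Int_ind_ball.
apply: (@le_trans _ _ (E (fun w => b J + \sum_(j < J.+1) b j.-1 * ind_ball y (2 ^+ j * g) w))).
  apply: Ex_le => //; first by apply: IntD; [exact: Int_cst|exact: Int_sum].
  by move=> w; apply: dyadic_le => // j; exact: fb.
rewrite ExD; [|exact: Int_cst|exact: Int_sum].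
rewrite (Ex_cst hZ) (Ex_sum hZ (index_enum _) IS) lerD2l.
apply: ler_sum => j _; rewrite ExZ; last exact: Int_ind_ball.
by rewrite ler_wpM2l// concentration// mulr_gt0// exprn_gt0.
Qed.

Let D0 : 0 <= D. Proof. exact: le_trans (normr_ge0 _) (KD 0). Qed.

(** In each of the [J + 1] shells the size of the integrand cancels the Gaussian mass, so every
    shell costs a constant: this is the source of the logarithm. The terms in [D] form a geometric
    series. *)
Lemma Ex_inv_dist_le g (J : nat) y : 0 < g -> 1 <= 2 ^+ J * g ->
  E (fun w => (Num.sqrt (g ^+ 2 + (y - U w) ^+ 2))^-1) <= 7 * J.+1%:R + 6 * D / g.
Proof.
move=> g0 Jg; have g20 : 0 < g ^+ 2 by rewrite exprn_gt0.
pose f t : R := (Num.sqrt (g ^+ 2 + t ^+ 2))^-1.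
pose b j : R := (2 ^+ j * g)^-1.
have p0 j : 0 < 2 ^+ j * g by rewrite mulr_gt0// exprn_gt0.
have b0 j : 0 <= b j by rewrite invr_ge0 ltW.
have s0 t : 0 < Num.sqrt (g ^+ 2 + t ^+ 2).
  by rewrite sqrtr_gt0; have := sqr_ge0 t; lra.
have f0 t : f t <= b 0%N.
  rewrite lef_pV2 ?posrE// expr0 mul1r -[leLHS](ger0_norm (ltW g0)) -sqrtr_sqr.
  by rewrite ler_wsqrtr// lerDl sqr_ge0.
have fb j t : 2 ^+ j * g <= `|t| -> f t <= b j.
  move=> h; rewrite lef_pV2 ?posrE// (le_trans h)// -sqrtr_sqr.
  by rewrite ler_wsqrtr// lerDr ltW.
have fE w : f (U w - y) = (Num.sqrt (g ^+ 2 + (y - U w) ^+ 2))^-1.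
  by rewrite /f -(sqrrN (U w - y)) opprB.
have If : I (fun w => f (U w - y)).
  apply: (Int_bounded hZ (M := b 0%N)); first by rewrite /f; msolve.
  by move=> w; rewrite ger0_norm// invr_ge0 ltW.
rewrite -(eq_Ex fE); apply: le_trans (@Ex_dyadic_le f b g J y g0 If b0 f0 fb) _.
have bJ : b J <= 1 by rewrite -invr1 lef_pV2 ?posrE.
have S : \sum_(j < J.+1) b j.-1 * (3 * (2 ^+ j * g) + 2 * D) <=
    6 * J.+1%:R + 2 * D / g * (3 - 2 / 2 ^+ J).
  elim: (J) => [|j IH].
    rewrite big_ord_recl big_ord0 /= /b !expr0 !mul1r addr0 divr1.
    have -> : g^-1 * (3 * g + 2 * D) = 3 + 2 * D / g by field; rewrite gt_eqF.
    lra.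
  rewrite big_ord_recr/=.
  have -> : b j * (3 * (2 ^+ j.+1 * g) + 2 * D) = 6 + 2 * D / g / 2 ^+ j.
    by rewrite /b exprS; field; rewrite (gt_eqF g0) expf_neq0.
  have -> : 2 / 2 ^+ j.+1 = (2 ^+ j)^-1 :> R.
    by rewrite exprS; field; rewrite expf_neq0.
  apply: le_trans (lerD IH (lexx _)) _; rewrite -[j.+2%:R]natr1.
  move: (2 * D / g) => V; move: (j.+1%:R) => u; lra.
have Dg : 0 <= D / g by rewrite divr_ge0// ltW.
have i2 : 0 <= 2 / 2 ^+ J :> R by rewrite divr_ge0// exprn_ge0.
have : 2 * D / g * (3 - 2 / 2 ^+ J) <= 6 * D / g.
  have -> : 6 * D / g = 2 * D / g * 3 by ring.
  by rewrite ler_wpM2l ?gerBl// -mulrA mulr_ge0.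
have J1 : 1 <= J.+1%:R :> R by rewrite ler1n.
lra.
Qed.

(** The bump decays quadratically, so both the Gaussian terms and the terms in [D] sum geometrically
    and no logarithm appears. *)
Lemma Ex_bump_le g (J : nat) y : 0 < g -> g <= 1 -> 1 <= 2 ^+ J * g ->
  E (fun w => (1 + ((U w - y) / g) ^+ 2)^-1) <= 19 * g + 6 * D.
Proof.
move=> g0 g1 Jg.
pose f t : R := (1 + (t / g) ^+ 2)^-1.
pose b j : R := (4 ^+ j)^-1.
have b0 j : 0 <= b j by rewrite invr_ge0 exprn_ge0.
have t0 t : 0 < 1 + (t / g) ^+ 2 by have := sqr_ge0 (t / g); lra.
have f0 t : f t <= b 0%N.
  by rewrite /b expr0 lef_pV2 ?posrE// lerDl sqr_ge0.
have fb j t : 2 ^+ j * g <= `|t| -> f t <= b j.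
  move=> h; rewrite lef_pV2 ?posrE ?exprn_gt0//.
  have : 2 ^+ j <= `|t / g| by rewrite normrM normfV (gtr0_norm g0) ler_pdivlMr.
  move=> /(ler_sqr_of (exprn_ge0 j (ler0n R 2))).
  rewrite real_normK ?num_real//.
  have -> : 4 ^+ j = 2 ^+ j ^+ 2 :> R.
    by rewrite -exprM mulnC exprM; congr (_ ^+ _); ring.
  lra.
have If : I (fun w => f (U w - y)).
  apply: (Int_bounded hZ (M := b 0%N)); first by rewrite /f; msolve.
  by move=> w; rewrite ger0_norm// invr_ge0 ltW.
rewrite -[X in E X]/(fun w => f (U w - y)).
apply: le_trans (@Ex_dyadic_le f b g J y g0 If b0 f0 fb) _.
have J0 : 0 < 2 ^+ J :> R by rewrite exprn_gt0.
have bJ : b J <= g.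
  have -> : b J = (2 ^+ J)^-1 * (2 ^+ J)^-1.
    by rewrite /b -invfM -exprMn -natrM.
  have h : (2 ^+ J)^-1 <= g by rewrite -[leLHS]mul1r ler_pdivrMr// mulrC.
  by rewrite -[leRHS]mulr1 ler_pM ?invr_ge0 ?(ltW J0)// (le_trans h).
have S : \sum_(j < J.+1) b j.-1 * (3 * (2 ^+ j * g) + 2 * D) <=
    (6 * g + 2 * D) * (3 - 2 / 2 ^+ J).
  elim: (J) => [|j IH].
    rewrite big_ord_recl big_ord0 /= /b !expr0 invr1; lra.
  rewrite big_ord_recr/=.
  have p2 : 0 < 2 ^+ j :> R by rewrite exprn_gt0.
  have -> : b j * (3 * (2 ^+ j.+1 * g) + 2 * D) = 6 * g * (2 ^+ j)^-1 + 2 * D * ((2 ^+ j)^-1 * (2 ^+ j)^-1).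
    have -> : b j = (2 ^+ j)^-1 * (2 ^+ j)^-1 by rewrite /b -invfM -exprMn -natrM.
    by rewrite exprS; field; rewrite gt_eqF.
  have -> : 2 / 2 ^+ j.+1 = (2 ^+ j)^-1 :> R.
    by rewrite exprS; field; rewrite gt_eqF.
  have q1 : (2 ^+ j)^-1 * (2 ^+ j)^-1 <= (2 ^+ j)^-1 :> R.
    by rewrite ler_piMl ?invr_ge0 ?(ltW p2)// invf_le1// exprn_ege1// ler1n.
  have := ler_wpM2l (mulr_ge0 (ler0n R 2) D0) q1.
  move: IH; move: (2 ^+ j)^-1 ((2 ^+ j)^-1 * (2 ^+ j)^-1) => u u2; lra.
have i2 : 0 <= 2 / 2 ^+ J :> R by rewrite divr_ge0// ltW.
have : (6 * g + 2 * D) * (3 - 2 / 2 ^+ J) <= (6 * g + 2 * D) * 3.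
  by rewrite ler_wpM2l ?gerBl// addr_ge0 ?mulr_ge0// ltW.
lra.
Qed.

(** After a shift of [y] by [t g] in either direction the smoothed indicator is comparable to the
    sharp one up to [th] times a bump centred at [y]. The mean of the bump is at most [19 g + 6 D],
    so [th <= 1 / 24] returns only [D / 4]. *)
Lemma smoothing_inequality (A : T -> R) g (J : nat) (Rm : R) y :
  measurable_fun setT A ->
  0 < g -> g <= 1 -> 1 <= 2 ^+ J * g -> (forall w, 0 < A w) ->
  {ae P, forall w, g ^+ 2 <= A w <= 3 * g ^+ 2} ->
  (forall y, `|E (fun w => Phi ((y - U w) / Num.sqrt (A w))) - Phi y| <= Rm) ->
  `|E (ind_le y) - Phi y| <= D / 4 + (smoothing_shift + 1) * g + Rm.
Proof.
have aux1 (x h d' : R) : 0 < h -> x <= 19 * h + 6 * d' -> 24^-1 * x <= h + d' / 4.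
  by move=> *; lra.
have aux2 (x p a b pa pb tg h b' rm d' : R) : x <= a + b' -> b - b' <= x ->
  a - pa <= rm -> - rm <= b - pb -> pa - p <= tg -> p - pb <= tg ->
  b' <= h + d' / 4 -> - (d' / 4 + (tg + h) + rm) <= x - p <= d' / 4 + (tg + h) + rm.
  by move=> *; apply/andP; split; lra.
have [K KE] : exists K : R, K = 864 by exists 864.
have K0 : 0 < K by lra.
rewrite /smoothing_shift -KE.
have [t tS] : exists t : R, t = Num.sqrt (9 * K * 24 + 1) by exists (Num.sqrt (9 * K * 24 + 1)).
rewrite -tS.
have s0 : 0 < 9 * K * 24 + 1 by lra.
have t0 : 0 < t by rewrite tS sqrtr_gt0.
have tE : t ^+ 2 = 9 * K * 24 + 1 by rewrite tS sqr_sqrtr// ltW.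
clear tS s0.
have t1 : 1 <= t by rewrite -(@ler_pXn2r _ 2) ?nnegrE ?(ltW t0)// tE expr1n; lra.
move=> mA g0 g1 Jg A0 Abd HR.
have [th thE] : exists th : R, th = 9 * K / t ^+ 2 by exists (9 * K / t ^+ 2).
have t20 : 0 < t ^+ 2 by rewrite exprn_gt0.
have th24 : th <= 24^-1.
  by rewrite thE ler_pdivrMr// tE; lra.
have th0 : 0 <= th by rewrite thE divr_ge0 ?(ltW t20)//; lra.
pose bump w : R := (1 + ((U w - y) / g) ^+ 2)^-1.
have bp w : 0 < 1 + ((U w - y) / g) ^+ 2 by have := sqr_ge0 ((U w - y) / g); lra.
have Ib : I bump.
  apply: (Int_bounded hZ (M := 1)); first by rewrite /bump; msolve.
  move=> w; rewrite ger0_norm ?invr_ge0 ?(ltW (bp w))// invf_le1// lerDl sqr_ge0//.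
have Eb : E bump <= 19 * g + 6 * D by exact: Ex_bump_le Jg.
(* The distance [g t] of the shift makes the Gaussian tail smaller than a
   small multiple [th] of the bump. *)
have tail a u : g ^+ 2 <= a <= 3 * g ^+ 2 -> 0 <= u ->
    K / (1 + ((t * g + u) / Num.sqrt a) ^+ 2) ^+ 2 <= th / (1 + (u / g) ^+ 2).
  exact: gaussian_tail_le_bump.
have I1 y' : I (fun w => Phi ((y' - U w) / Num.sqrt (A w))).
  apply: (Int_bounded hZ (M := 1)); first by msolve.
  by move=> w; rewrite ger0_norm ?Phi_ge0 ?Phi_le1.
have tg0 : 0 < t * g by rewrite mulr_gt0.
have up : E (ind_le y) <= E (fun w => Phi ((y + t * g - U w) / Num.sqrt (A w))) + th * E bump.
  rewrite -ExZ// -ExD//; last exact: IntZ.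
  apply: Ex_le_ae => //; [exact: Int_ind_le|by apply: IntD => //; exact: IntZ|].
  apply: filterS Abd => w Aw; rewrite /ind_le.
  have [Uy|Uy] := leP (U w) y; last first.
    by rewrite addr_ge0 ?Phi_ge0// mulr_ge0// invr_ge0 ltW.
  have u0 : 0 <= y - U w by rewrite subr_ge0.
  have sA : 0 < Num.sqrt (A w) by rewrite sqrtr_gt0.
  have v0 : 0 <= (t * g + (y - U w)) / Num.sqrt (A w) by apply: divr_ge0; [apply: addr_ge0 => //; exact: ltW|exact: ltW].
  have := tail _ _ Aw u0; have := Phi_tail v0; rewrite -KE.
  have -> : t * g + (y - U w) = y + t * g - U w by ring.
  have -> : th / (1 + ((y - U w) / g) ^+ 2) = th * bump w.
    by rewrite /bump -(sqrrN ((U w - y) / g)) -mulNr opprB.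
  move: (bump w) (Phi _) => b p.
  rewrite [true%:R]/=; lra.
have lo : E (fun w => Phi ((y - t * g - U w) / Num.sqrt (A w))) - th * E bump <= E (ind_le y).
  rewrite -ExZ// -ExB//; last exact: IntZ.
  apply: Ex_le_ae => //; [by apply: IntB => //; exact: IntZ|exact: Int_ind_le|].
  apply: filterS Abd => w Aw; rewrite /ind_le.
  have [Uy|/ltW Uy] := leP (U w) y.
    have b0 : 0 <= th * bump w by rewrite mulr_ge0// invr_ge0 ltW.
    have := Phi_le1 ((y - t * g - U w) / Num.sqrt (A w)); rewrite [true%:R]/=; lra.
  have u0 : 0 <= U w - y by rewrite subr_ge0.
  have sA : 0 < Num.sqrt (A w) by rewrite sqrtr_gt0.
  have v0 : 0 <= (t * g + (U w - y)) / Num.sqrt (A w) by apply: divr_ge0; [apply: addr_ge0 => //; exact: ltW|exact: ltW].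
  have := tail _ _ Aw u0; have := PhiN_tail v0; rewrite -KE -/(bump w).
  rewrite -mulNr (_ : - (t * g + (U w - y)) = y - t * g - U w); last by ring.
  move: (bump w) (Phi _) => b p.
  rewrite [false%:R]/=; lra.
clear tail; have tg0' := ltW tg0; have h1 := HR (y + t * g); have h2 := HR (y - t * g).
have /PhiB/andP[_ h3] : y <= y + t * g by rewrite lerDl.
have /PhiB/andP[_ h4] : y - t * g <= y by rewrite gerBl.
have thb : th * E bump <= g + D / 4.
  have Eb0 : 0 <= E bump by apply: Ex_ge0 => // w; rewrite invr_ge0 ltW.
  by apply: le_trans (ler_wpM2r Eb0 th24) _; exact: aux1.
move: h1 h2; rewrite !ler_norml => /andP[_ h1] /andP[h2 _].
rewrite [leRHS]addrAC subrr add0r in h3; rewrite subKr in h4.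
by rewrite mulrDl mul1r; apply: aux2 up lo h1 h2 h3 h4 thb.
Qed.

End concentration.

Section gaussian_scale.
Context {R : realType}.
Implicit Types q y e : R.

(** The intermediate point [c] satisfies [|y / r| <= |c|], so the growing factor [y / r] is absorbed
    by [|c| gauss c <= 1]; what remains is [r - 1 <= q / 2]. *)
Lemma Phi_scale q y : 0 <= q -> `|Phi (y / Num.sqrt (1 + q)) - Phi y| <= q / 2.
Proof.
move=> q0; have q1 : 0 < 1 + q by lra.
pose r := Num.sqrt (1 + q); have r0 : 0 < r by rewrite sqrtr_gt0.
have rE : r ^+ 2 = 1 + q by rewrite sqr_sqrtr// ltW.
have r1 : 1 <= r by rewrite -(@ler_pXn2r _ 2) ?nnegrE ?(ltW r0)// rE; lra.
have rq : r - 1 <= q / 2 by have := sqr_ge0 (r - 1); nra.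
rewrite -/r; have [c cb ->] := @mvt_exists _ (@Phi R) gauss y (y / r) (fun t _ => is_derive_Phi t).
apply: le_trans rq; rewrite normrM (ger0_norm (ltW (gauss_gt0 c))).
have -> : y / r - y = - (y / r) * (r - 1) by field; rewrite gt_eqF.
rewrite normrM normrN (ger0_norm (x := r - 1)); last by lra.
rewrite mulrA ler_piMl//; first by lra.
have yr : `|y / r| <= `|c|.
  have [y0|y0] := leP 0 y.
    have yr0 : 0 <= y / r by rewrite divr_ge0// ltW.
    have : y / r <= y by rewrite ler_pdivrMr// ler_peMr.
    by case/orP: cb => /andP[? ?] ?; rewrite !ger0_norm; lra.
  have yr0 : y / r <= 0 by rewrite mulr_le0_ge0 ?invr_ge0 ?(ltW r0) ?(ltW y0).
  have : y <= y / r by rewrite ler_pdivlMr// ler_neMr ?(ltW y0)//; lra.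
  by case/orP: cb => /andP[? ?] ?; rewrite !ler0_norm; lra.
have c2 := sqr_ge0 c.
apply: (@le_trans _ _ (gauss c * `|c|)); first by rewrite ler_wpM2l// ltW// gauss_gt0.
have G := @gauss_le _ 1 c isT; rewrite mulr1 !expr1 in G.
apply: (@le_trans _ _ (2 / (1 + c ^+ 2) * `|c|)); first by rewrite ler_wpM2r.
rewrite mulrAC ler_pdivrMr; last by lra.
by rewrite mul1r -(real_normK (num_real c)); have := sqr_ge0 (`|c| - 1); nra.
Qed.

Lemma expR_half_le2 : expR (2^-1) <= 2 :> R.
Proof.
have h := expR_ge1Dx (- 2^-1 : R); rewrite expRN in h.
have p := expR_gt0 (2^-1 : R).
have {}h : 2^-1 <= (expR 2^-1)^-1 :> R by apply: le_trans h; lra.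
by rewrite -[leRHS]invrK -[leLHS]invrK lef_pV2 ?posrE ?invr_gt0.
Qed.

(** Follows from [expR (1 / 2) <= 2]. Keeping the logarithm away from 0 allows [e] itself to be
    absorbed into [e |ln e|]. *)
Lemma norm_ln_ge e : 0 < e <= 1 / 2 -> [/\ ln e <= - 2^-1, `|ln e| = - ln e & 2^-1 <= `|ln e|].
Proof.
move=> /andP[e0 e2].
have l : ln e <= - 2^-1.
  rewrite -ler_expR lnK ?posrE// expRN.
  have := expR_half_le2; have := expR_gt0 (2^-1 : R) => p q.
  apply: (le_trans e2); rewrite div1r lef_pV2 ?posrE//.
by have ln0 : `|ln e| = - ln e; [rewrite ler0_norm//; lra|split => //; lra].
Qed.

(** For [J] the integer part of [2 |ln e|] plus one, [2^J >= expR (J / 2) >= 1 / e], while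
    [J + 1 <= 2 |ln e| + 2 <= 6 |ln e|] because [|ln e| >= 1 / 2]. *)
Lemma dyadic_cover e : 0 < e <= 1 / 2 ->
  exists J : nat, 1 <= 2 ^+ J * e /\ J.+1%:R <= 6 * `|ln e|.
Proof.
move=> he; have [l ln0 l2] := norm_ln_ge he; case/andP: (he) => e0 e2.
pose L := `|ln e|; exists (Num.truncn (2 * L)).+1.
have L0 : 0 <= 2 * L by rewrite mulr_ge0// normr_ge0.
have /andP[t1 t2] := truncn_itv L0.
split.
  rewrite -ler_pdivrMr// div1r.
  have -> : e^-1 = expR L by rewrite /L ln0 expRN lnK.
  apply: (@le_trans _ _ (expR (2^-1) ^+ (Num.truncn (2 * L)).+1)).
    rewrite -expRM_natl ler_expR; move: t2; lra.
  by rewrite lerXn2r ?nnegrE ?expR_ge0// expR_half_le2.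
rewrite -addn2 natrD.
have h : 2 * 2^-1 <= 2 * L by rewrite ler_pM2l.
by move: t1 h; rewrite -/L; move: (Num.truncn _)%:R => u; move: (L) => l'; lra.
Qed.

End gaussian_scale.

(* Testing against all [F k]-measurable [H] encodes conditioning on [F k] under the
   weight [Z]: the conditional mean and variance of [eta k] differ from [0] and
   [s k] by at most [kap * s k] and [mu * s k]. *)
Record near_martingale d (T : measurableType d) (R : realType) (P : probability T R)
    (Z : T -> R) (n : nat) (F : nat -> set (set T)) (eta s : nat -> T -> R)
    (e del kap mu K : R) : Prop := {
  nm_density : density P Z ;
  nm_e : 0 < e <= 1 / 2 ;
  nm_del : 0 <= del <= 1 ;
  nm_kap : 0 <= kap <= 1 ;
  nm_mu : 0 <= mu <= 1 ;
  nm_mukap : mu ^+ 2 <= kap * e ;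
  nm_FT : forall k, (k <= n)%N -> F k `<=` measurable ;
  nm_Fincr : forall k, (k < n)%N -> F k `<=` F k.+1 ;
  nm_meta : forall k, (k < n)%N -> measurable_wrt (F k.+1) (eta k) ;
  nm_ms : forall k, (k < n)%N -> measurable_wrt (F k) (s k) ;
  nm_s : forall k w, (k < n)%N -> 0 <= s k w <= 12 * e ^+ 2 ;
  nm_vle : forall w, psum s n w <= 1 + del ^+ 2 ;
  nm_vge : {ae P, forall w, 1 - del ^+ 2 <= psum s n w} ;
  nm_moments : forall k (H : T -> R), (k < n)%N -> measurable_wrt (F k) H ->
    Int P Z H ->
    [/\ Int P Z (fun w => `|H w| * (`|eta k w| ^+ 3 * (1 + eta k w ^+ 2 / e ^+ 2) ^+ 2)),
      `|Ex P Z (fun w => H w * eta k w)| <= kap * Ex P Z (fun w => `|H w| * s k w),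
      `|Ex P Z (fun w => H w * (eta k w ^+ 2 - s k w))|
         <= mu * Ex P Z (fun w => `|H w| * s k w) &
      Ex P Z (fun w => `|H w| * (`|eta k w| ^+ 3 * (1 + eta k w ^+ 2 / e ^+ 2) ^+ 2))
         <= K * e * Ex P Z (fun w => `|H w| * s k w)] }.

(** * Berry-Esseen bound: closing the self-consistent inequality *)

Section constants.
Context {R : realType}.
Implicit Types t c h kap x del g : R.

Lemma berry_esseen_const1 t c h (c2 : R) kap x del : 0 <= t -> 0 <= c -> 0 <= h -> 0 <= c2 ->
  0 <= kap -> 0 <= x -> 0 <= del ->
  c * (x + del) <= 2 * ((t + 2) * c + 8 * h + 42 * c2) * (kap + x + del).
Proof.
move=> t0 c0 h0 c20 k0 x0 d0.
apply: ler_pM => //; [by lra| |by lra].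
by have := mulr_ge0 t0 c0; lra.
Qed.

Lemma berry_esseen_const2 t c h (c2 : R) kap x del g : 0 <= t -> 0 <= c -> 0 <= h -> 0 <= c2 ->
  0 <= kap -> 0 <= x -> 0 <= del -> g <= c * (x + del) ->
  2 * ((t + 2) * g + 8 * h * kap + 42 * c2 * x)
    <= 2 * ((t + 2) * c + 8 * h + 42 * c2) * (kap + x + del).
Proof.
move=> t0 c0 h0 c20 k0 x0 d0 gc.
have t2 : 0 <= t + 2 by lra.
have q1 : (t + 2) * g <= (t + 2) * c * (kap + x + del).
  rewrite -mulrA; apply: ler_wpM2l => //; apply: (le_trans gc).
  by apply: ler_wpM2l => //; lra.
have q2 : h * kap <= h * (kap + x + del) by apply: ler_wpM2l => //; lra.
have q3 : c2 * x <= c2 * (kap + x + del) by apply: ler_wpM2l => //; lra.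
by move: q1 q2 q3; set m := kap + x + del; lra.
Qed.

(** As [g >= 24 C2 e], the term [6 C2 e D / g] is at most [D / 4], which together with the other
    [D / 4] makes [D / 2]. The rest uses [7 j <= 42 L] and [g^2 <= g]. *)
Lemma berry_esseen_const3 (t g h kap D e L b j del : R) (C2 := h * b) :
  0 < e -> 0 <= h -> 0 <= C2 -> 0 <= kap -> 0 < g -> g <= 1 -> 0 <= D ->
  del ^+ 2 <= g ^+ 2 -> j <= 6 * L -> 24 * C2 * e <= g ->
  D / 4 + (t + 1) * g + (h * (8 * kap + b * e * (7 * j + 6 * D / g)) + (del ^+ 2 + g ^+ 2) / 2)
    <= D / 2 + ((t + 2) * g + 8 * h * kap + 42 * C2 * (e * L)).
Proof.
move=> e0 h0 C20 k0 g0 g1 D0 d2 jL C2g.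
have g2 : g ^+ 2 <= g by rewrite expr2 ler_piMl// ltW.
have Ce0 : 0 <= C2 * e by rewrite mulr_ge0// ltW.
have q1 : C2 * e * j <= C2 * e * (6 * L) by exact: ler_wpM2l.
have q2 : C2 * e * (D / g) <= D / 24.
  rewrite mulrA ler_pdivrMr//.
  by have := ler_wpM2r D0 C2g; lra.
have -> : h * (8 * kap + b * e * (7 * j + 6 * D / g))
  = 8 * h * kap + 7 * (C2 * e * j) + 6 * (C2 * e * (D / g)) by rewrite /C2; ring.
by move: q1 q2; lra.
Qed.

End constants.

(** The supremum [D] of the differences is finite, being at most 1, and satisfies [D <= D / 2 + B];
    hence [D <= 2 B]. *)
Theorem berry_esseen (R : realType) (K : R) : 0 <= K -> exists2 C : R, 0 < C &
  forall d (T : measurableType d) (P : probability T R) Z n F eta s e del kap mu,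
  near_martingale P Z n F eta s e del kap mu K ->
  forall y, `|Ex P Z (ind_le (psum eta n) y) - Phi y|
    <= C * (kap + e * `|ln e| + del).
Proof.
move=> K0; have [Ch Ch0 Chb] := @heat_step R.
pose C2 := Ch * (2 * (K + 2) * jensenC R ^+ 3).
have jC0 : 0 <= jensenC R ^+ 3 by rewrite exprn_ge0// sqrtr_ge0.
have C20 : 0 <= C2.
  rewrite /C2 mulr_ge0// ?(ltW Ch0)// mulr_ge0// mulr_ge0// addr_ge0//.
pose K1 := 1 + 24 * C2.
have K11 : 1 <= K1 by rewrite /K1; lra.
have t0 : 0 <= smoothing_shift :> R by rewrite sqrtr_ge0.
pose C := 2 * ((smoothing_shift + 2) * (2 * K1 + 1) + 8 * Ch + 42 * C2).
have tK : 0 <= smoothing_shift * (2 * K1 + 1) by rewrite mulr_ge0//; lra.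
exists C; first by rewrite /C; lra.
move=> d T P Z n F eta s e del kap mu [hZ he hdel hkap hmu mukap FT Fincr meta ms hs vle vge hm] y.
have [l ln0 l2] := norm_ln_ge he; case/andP: (he) => e0 e2.
case/andP: (hdel) => d0 d1; case/andP: (hkap) => k0 _.
set L := `|ln e| in l2 *.
(* The multiple [K1 >= 24 C2] of [e] makes the returning coefficient of [D] small; [del] keeps the
   final remaining variance comparable to [g^2]. *)
pose g := K1 * e + del.
have eL : e <= 2 * (e * L) by have := ler_wpM2l (ltW e0) l2; clear; lra.
have K1e : K1 * e <= 2 * K1 * (e * L).
  by rewrite (mulrC 2) -mulrA ler_wpM2l//; clear -K11 eL; lra.
have mU : measurable_fun setT (psum eta n).
  by apply: (measurable_wrt_fun (FT n (leqnn n))); apply: (measurable_wrt_psum Fincr meta).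
have F1 y' : 0 <= Ex P Z (ind_le (psum eta n) y') <= 1.
  have -> /= : 0 <= Ex P Z (ind_le (psum eta n) y').
    by apply: (Ex_ge0 hZ) => w; case/andP: (ind_le01 (psum eta n) y' w).
  rewrite -[leRHS](Ex_cst hZ); apply: Ex_le => //; [exact: Int_ind_le|exact: Int_cst|].
  by move=> w; case/andP: (ind_le01 (psum eta n) y' w).
have triv y' : `|Ex P Z (ind_le (psum eta n) y') - Phi y'| <= 1.
  have /andP[a1 a2] := F1 y'; have b1 := Phi_ge0 y'; have b2 := Phi_le1 y'.
  by rewrite ler_norml; clear -a1 a2 b1 b2; apply/andP; split; lra.
have eL0 : 0 <= e * L by apply: mulr_ge0; [exact: ltW|exact: normr_ge0].
have gB : g <= (2 * K1 + 1) * (e * L + del).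
  have : 0 <= K1 * del by apply: mulr_ge0 => //; clear -K11; lra.
  by rewrite /g; clear -K1e eL0 d0; lra.
(* If [g > 1] the claimed bound exceeds 1, while a difference of two values in [[0, 1]] does not. *)
have [g1|g1] := leP g 1; last first.
  apply: le_trans (triv y) _; apply: (le_trans (ltW g1)); apply: (le_trans gB).
  apply: berry_esseen_const1 => //; first by clear -K11; lra.
  exact: ltW.
have g0 : 0 < g by rewrite /g ltr_wpDr// mulr_gt0//; clear -K11; lra.
have eg : e <= g.
  by rewrite /g; have := ler_peMl (ltW e0) K11; clear -d0; lra.
have dg : del <= g by rewrite /g lerDr mulr_ge0 ?(ltW e0)//; clear -K11; lra.
have [J [J1 J2]] := dyadic_cover he.
have Jg : 1 <= 2 ^+ J * g.
  by apply: le_trans J1 _; rewrite ler_wpM2l// exprn_ge0.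
pose Sd := [set r | exists y', r = `|Ex P Z (ind_le (psum eta n) y') - Phi y'|].
have hS : has_sup Sd.
  split; first by exists `|Ex P Z (ind_le (psum eta n) 0) - Phi 0|, 0.
  by exists 1 => r [y' ->]; exact: triv.
pose D := sup Sd.
have HD y' : `|Ex P Z (ind_le (psum eta n) y') - Phi y'| <= D.
  by apply: sup_upper_bound => //; exists y'.
pose B := (smoothing_shift + 2) * g + 8 * Ch * kap + 42 * C2 * (e * L).
have step y' : `|Ex P Z (ind_le (psum eta n) y') - Phi y'| <= D / 2 + B.
  have D0 : 0 <= D by apply: le_trans (HD 0).
  pose Rm := Ch * (8 * kap + 2 * (K + 2) * jensenC R ^+ 3 * e * (7 * J.+1%:R + 6 * D / g))
    + (del ^+ 2 + g ^+ 2) / 2.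
  have Age w : g ^+ 2 <= remvar s del g n w by exact: (remvar_ge e0 hs vle eg).
  have g20 : 0 < g ^+ 2 by rewrite exprn_gt0.
  have d2g : del ^+ 2 <= g ^+ 2 by exact: ler_sqr_of.
  apply: le_trans (@smoothing_inequality _ _ _ _ _ hZ _ mU _ HD (remvar s del g n) g J Rm y' _ g0 g1 Jg _ _ _) _.
  - by apply: (measurable_wrt_fun (FT n (leqnn n))); exact: (measurable_wrt_remvar del Fincr ms).
  - by move=> w; exact: lt_le_trans g20 (Age w).
  (* The lower bound on the total variance gives a final remaining variance of at most
     [2 del^2 + g^2 <= 3 g^2]. *)
  - apply: filterS vge => w vw; rewrite Age /= /remvar; clear -vw d2g; lra.
  - move=> z.
    have ST := smoothed_total hZ e0 hdel hkap hmu mukap K0 FT Fincr meta ms hs vle hm eg g1 Ch0 Chb z.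
    have ID := Ex_inv_dist_le hZ mU HD z g0 Jg.
    have q0 : 0 <= del ^+ 2 + g ^+ 2 by rewrite addr_ge0// sqr_ge0.
    have PS := Phi_scale z q0; rewrite addrA in PS.
    apply: (le_trans (ler_distD (Phi (z / Num.sqrt (1 + del ^+ 2 + g ^+ 2))) _ _)).
    rewrite /Rm lerD//; apply: (le_trans ST).
    rewrite ler_wpM2l ?(ltW Ch0)// lerD2l ler_wpM2l//.
    by rewrite mulr_ge0 ?(ltW e0)// mulr_ge0// mulr_ge0// addr_ge0.
  apply: berry_esseen_const3 => //.
  - exact: ltW.
  - by rewrite -/C2 /g; have := mulr_ge0 (ltW e0) C20; rewrite /K1; clear -d0 e0; lra.
have DB : D <= D / 2 + B.
  by apply: ge_sup => [|r [y' ->]] //; case: hS.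
apply: le_trans (HD y) _.
have {DB} : D <= 2 * B by clear -DB; lra.
move/le_trans; apply; apply: berry_esseen_const2 => //; first by clear -K11; lra.
exact: ltW.
Qed.

(** * Moments under Bernstein's condition *)

Section exponential_tilt.
Context {R : realType}.
Implicit Types e l s t u x : R.

Lemma expR_sub1_le u : `|expR u - 1| <= `|u| * expR `|u|.
Proof.
have h1 := expR_ge1Dx u; have h2 := expR_ge1Dx (- u).
have h3 : expR u * (1 - u) <= 1.
  by rewrite -[leRHS](mulfV (lt0r_neq0 (expR_gt0 u))) -expRN ler_wpM2l ?expR_ge0.
have E1 : 1 <= expR `|u| by rewrite -expR0 ler_expR.
have [u0|u0] := leP 0 u.
  by rewrite !ger0_norm; lra.
have : expR u <= 1 by rewrite -expR0 ler_expR ltW.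
rewrite (ltr0_norm u0) => hu; rewrite ler0_norm; last by lra.
have {}E1 : 1 <= expR (- u) by move: E1; rewrite (ltr0_norm u0).
have : - u * 1 <= - u * expR (- u) by rewrite ler_wpM2l//; lra.
lra.
Qed.

Lemma expR_sub1D_le u : `|expR u - 1 - u| <= u ^+ 2 * expR `|u|.
Proof.
have h1 := expR_ge1Dx u; have h2 := expR_ge1Dx (- u).
have h3 : expR u * (1 - u) <= 1.
  by rewrite -[leRHS](mulfV (lt0r_neq0 (expR_gt0 u))) -expRN ler_wpM2l ?expR_ge0.
rewrite ger0_norm; last by lra.
apply: (@le_trans _ _ (u * (expR u - 1))); first by lra.
apply: le_trans (ler_norm _) _; rewrite normrM -(real_normK (num_real u)) expr2 -mulrA.
by rewrite ler_wpM2l// expR_sub1_le.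
Qed.

(** [72 = 8 * 9]: take the ninth power of [1 + t <= 72 (1 + t / 72) <= 72 expR (t / 72)]. *)
Lemma poly_le_expR t : 0 <= t -> (1 + t) ^+ 9 <= 72 ^+ 9 * expR (t / 8).
Proof.
move=> t0.
have -> : expR (t / 8) = expR (t / 72) ^+ 9.
  by rewrite -expRM_natl; congr expR; field.
rewrite -exprMn lerXn2r ?nnegrE; [|lra|by rewrite mulr_ge0 ?expR_ge0|]; first by [].
have := expR_ge1Dx (t / 72); lra.
Qed.

(* [|x| = e t] with [t] the size of the jump in units of [e]. *)
Lemma tilt_weight_le : exists2 M : R, 0 < M & forall e s t, 0 < e -> 0 <= s <= 12 * e ^+ 2 ->
  0 <= t -> (s + (e * t) ^+ 2) * ((1 + t) ^+ 9 * expR (t / 8))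
    <= M * (s + (e * t) ^+ 2 * expR (t / 4)).
Proof.
have [N NE] : exists N : R, N = 72 ^+ 9 by exists (72 ^+ 9).
have N0 : 0 < N by rewrite NE exprn_gt0.
exists (13 * N); first by rewrite mulr_gt0.
move=> e s t e0 /andP[s0 se] t0.
pose Q := expR (t / 4); pose q := expR (t / 8).
have Qq : Q = q * q by rewrite /Q /q -expRD; congr expR; field.
have pq : (1 + t) ^+ 9 * q <= N * Q.
  by rewrite Qq mulrA ler_wpM2r ?expR_ge0// NE; exact: poly_le_expR.
have K0 : 0 <= (e * t) ^+ 2 * Q by rewrite mulr_ge0 ?sqr_ge0 ?expR_ge0.
(* For [t <= 1] the exponential is at most 2; for [t > 1] the bound [s <= 12 e^2] makes [s] at most
   [12 (e t)^2]. *)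
have sQ : s * Q <= 12 * (s + (e * t) ^+ 2 * Q).
  have [t1|t1] := leP t 1.
    have Q2 : Q <= 2.
      by apply: le_trans (@expR_half_le2 R); rewrite /Q ler_expR; lra.
    by have := ler_wpM2l s0 Q2; lra.
  have : s * Q <= 12 * ((e * t) ^+ 2 * Q).
    rewrite mulrA ler_wpM2r ?expR_ge0//; apply: (le_trans se).
    rewrite exprMn ler_wpM2l// ler_peMr ?sqr_ge0//.
    by rewrite -(expr1n _ 2) lerXn2r ?nnegrE// ltW.
  by lra.
have W0 : 0 <= s + (e * t) ^+ 2 by rewrite addr_ge0// sqr_ge0.
apply: (le_trans (ler_wpM2l W0 pq)).
rewrite mulrCA (mulrC 13) -mulrA; apply: ler_wpM2l; first exact: ltW.
by rewrite -/Q; lra.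
Qed.

(** The subtracted terms [x + l x^2 - l s] and [x^2 - s] have conditional mean zero, so only the
    errors survive in expectation. With [|x| = e t] and [l e <= 1 / 8] the tilt is at most
    [expR (t / 8)], and the weight [expR (t / 4)] in [B] leaves room for the powers of [t]. *)
Lemma tilt_pathwise : exists2 M : R, 0 < M & forall e l s x,
  0 < e -> 0 <= l -> l * e <= 1 / 8 -> 0 <= s <= 12 * e ^+ 2 ->
  let y := x - l * s in let B := s + x ^+ 2 * expR (`|x| / e / 4) in
  [/\ `|expR (l * x) * y - (x + l * x ^+ 2 - l * s)| <= M * (l ^+ 2 * e) * B,
      `|expR (l * x) * (y ^+ 2 - s) - (x ^+ 2 - s)| <= M * (l * e) * B &
      expR (l * x) * (`|y| ^+ 3 * (1 + y ^+ 2 / e ^+ 2) ^+ 2) <= M * e * B].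
Proof.
have [M0 M00 MP] := tilt_weight_le; exists (40 * M0); first by rewrite mulr_gt0.
move=> e l s x e0 l0 le8 hs y B.
pose t := `|x| / e; have t0 : 0 <= t by rewrite divr_ge0// ltW.
have xt : `|x| = e * t by rewrite /t mulrC divfK// gt_eqF.
have {MP}:= MP _ _ _ e0 hs t0; rewrite -xt (real_normK (num_real x)) -/B.
rewrite -/t; set q := expR (t / 8); set p := (1 + t) ^+ 9; set W := s + x ^+ 2 => MP.
case/andP: hs => s0 se.
have x20 : 0 <= x ^+ 2 by exact: sqr_ge0.
have q1 : 1 <= q by rewrite -expR0 ler_expR divr_ge0.
have W0 : 0 <= W by rewrite addr_ge0.
have lx : `|l * x| <= t / 8.
  rewrite normrM (ger0_norm l0) xt mulrA.
  by have := ler_wpM2r t0 le8; lra.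
have eq1 : expR `|l * x| <= q by rewrite ler_expR.
have E1 : expR (l * x) <= q by rewrite ler_expR (le_trans (ler_norm _)).
have E2 : `|expR (l * x) - 1| <= l * e * (t * q).
  apply: le_trans (expR_sub1_le _) _.
  have -> : l * e * (t * q) = `|l * x| * q by rewrite normrM (ger0_norm l0) xt; ring.
  by rewrite ler_wpM2l.
have E3 : `|expR (l * x) - 1 - l * x| <= l ^+ 2 * x ^+ 2 * q.
  by apply: le_trans (expR_sub1D_le _) _; rewrite exprMn ler_wpM2l// mulr_ge0// sqr_ge0.
have p1 k : (k <= 9)%N -> (1 + t) ^+ k <= p by move=> k9; rewrite /p ler_weXn2l//; lra.
have p5 := p1 5%N isT; have {p1} p1 := p1 1%N isT.
have q0 : 0 <= q by lra.
pose V := W * (p * q).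
have tW : t * q * W <= V.
  by rewrite mulrC /V ler_wpM2l// ler_wpM2r//; move: p1; rewrite expr1; lra.
have qW : q * W <= V.
  by rewrite mulrC /V ler_wpM2l// ler_peMl//; move: p1; rewrite expr1; lra.
have tq0 : 0 <= t * q by rewrite mulr_ge0.
have tqs : t * q * s + t * q * x ^+ 2 <= V by rewrite -mulrDr.
have qs : q * s + q * x ^+ 2 <= V by rewrite -mulrDr.
have le0 : 0 <= l * e by rewrite mulr_ge0// ltW.
have l2e0 : 0 <= l ^+ 2 * e by rewrite mulr_ge0 ?sqr_ge0// ltW.
have tqs0 : 0 <= t * q * s by rewrite mulr_ge0.
have tqx0 : 0 <= t * q * x ^+ 2 by rewrite mulr_ge0.
have qs0 : 0 <= q * s by rewrite mulr_ge0.
have qx0 : 0 <= q * x ^+ 2 by rewrite mulr_ge0.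
have V0 : 0 <= V by lra.
suff [H1 H2 H3] : [/\ `|expR (l * x) * y - (x + l * x ^+ 2 - l * s)| <= l ^+ 2 * e * (40 * V),
      `|expR (l * x) * (y ^+ 2 - s) - (x ^+ 2 - s)| <= l * e * (40 * V) &
      expR (l * x) * (`|y| ^+ 3 * (1 + y ^+ 2 / e ^+ 2) ^+ 2) <= e * (40 * V)].
  have VB : 40 * V <= 40 * (M0 * B) by rewrite ler_wpM2l.
  have VM c : 0 <= c -> c * (40 * V) <= 40 * M0 * c * B.
    by move=> c0; apply: le_trans (ler_wpM2l c0 VB) _; apply: eq_le_of; ring.
  split.
  - exact: le_trans H1 (VM _ l2e0).
  - exact: le_trans H2 (VM _ le0).
  - exact: le_trans H3 (VM _ (ltW e0)).
split.
- have -> : expR (l * x) * y - (x + l * x ^+ 2 - l * s)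
    = x * (expR (l * x) - 1 - l * x) - l * s * (expR (l * x) - 1) by rewrite /y; ring.
  apply: le_trans (ler_normB _ _) _; rewrite !normrM (ger0_norm l0) (ger0_norm s0).
  have a1 : `|x| * `|expR (l * x) - 1 - l * x| <= l ^+ 2 * e * (t * q * x ^+ 2).
    have -> : l ^+ 2 * e * (t * q * x ^+ 2) = `|x| * (l ^+ 2 * x ^+ 2 * q) by rewrite xt; ring.
    exact: ler_wpM2l.
  have a2 : l * s * `|expR (l * x) - 1| <= l ^+ 2 * e * (t * q * s).
    have -> : l ^+ 2 * e * (t * q * s) = l * s * (l * e * (t * q)) by ring.
    by apply: ler_wpM2l => //; rewrite mulr_ge0.
  apply: (le_trans (lerD a1 a2)); rewrite -mulrDr; apply: ler_wpM2l => //; clear -tqs V0; lra.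
- have -> : expR (l * x) * (y ^+ 2 - s) - (x ^+ 2 - s)
    = (x ^+ 2 - s) * (expR (l * x) - 1) + expR (l * x) * (l ^+ 2 * s ^+ 2 - 2 * l * s * x).
    by rewrite /y; ring.
  apply: le_trans (ler_normD _ _) _; rewrite !normrM (ger0_norm (expR_ge0 (l * x))).
  have a1 : `|x ^+ 2 - s| * `|expR (l * x) - 1| <= l * e * (t * q * W).
    have -> : l * e * (t * q * W) = W * (l * e * (t * q)) by ring.
    apply: ler_pM => //; apply: le_trans (ler_normB _ _) _.
    by rewrite !ger0_norm// /W addrC.
  have a2 : expR (l * x) * `|l ^+ 2 * s ^+ 2 - 2 * l * s * x| <= l * e * (2 * (q * s) + 2 * (t * q * s)).
    have -> : l * e * (2 * (q * s) + 2 * (t * q * s)) = q * (l * e * (2 * s + 2 * t * s)) by ring.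
    apply: ler_pM => //.
    apply: le_trans (ler_normB _ _) _.
    rewrite !normrM xt (ger0_norm l0) (ger0_norm s0) (ger0_norm (ler0n _ _)).
    have b1 : l * s * (l * s) <= l * s * (12 * (l * e * e)).
      have -> : 12 * (l * e * e) = l * (12 * e ^+ 2) by ring.
      by apply: ler_wpM2l; [rewrite mulr_ge0|apply: ler_wpM2l].
    have b2 : l * s * e * (l * e) <= l * s * e * (1 / 8).
      by apply: ler_wpM2l => //; rewrite mulr_ge0 ?(ltW e0)// mulr_ge0.
    have b3 : 0 <= l * s * e by rewrite mulr_ge0 ?(ltW e0)// mulr_ge0.
    by clear -b1 b2 b3; lra.
  apply: (le_trans (lerD a1 a2)); rewrite -mulrDr; apply: ler_wpM2l => //.
  by clear -tW qs tqs tqx0 tqs0 qx0 V0; lra.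
(* From [l s <= 12 l e^2] and [l e <= 1 / 8]: recentring displaces the jump only on the scale
   [e]. *)
- have ls : l * s <= 3 / 2 * e.
    have b1 : l * s <= l * (12 * e ^+ 2) by apply: ler_wpM2l.
    have b2 : 12 * e * (l * e) <= 12 * e * (1 / 8) by apply: ler_wpM2l => //; clear -e0; lra.
    by clear -b1 b2; lra.
  have ls0 : 0 <= l * s by rewrite mulr_ge0.
  have y1 : `|y| <= 3 / 2 * e * (1 + t).
    apply: le_trans (ler_normB _ _) _; rewrite (ger0_norm ls0) xt.
    have : 0 <= e * t by rewrite mulr_ge0// ltW.
    by clear -ls; lra.
  have y2 : y ^+ 2 <= 2 * W.
    have b1 : l * s * (l * s) <= s.
      have c1 : l * s * (l * s) <= l * s * (3 / 2 * e) by apply: ler_wpM2l.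
      have c2 : s * (l * e) <= s * (1 / 8) by apply: ler_wpM2l.
      by clear -c1 c2 s0; lra.
    have := sqr_ge0 (x + l * s); rewrite /W /y; clear -b1; lra.
  have y3 : 1 + y ^+ 2 / e ^+ 2 <= 13 / 4 * (1 + t) ^+ 2.
    have : y ^+ 2 / e ^+ 2 <= 9 / 4 * (1 + t) ^+ 2.
      rewrite ler_pdivrMr ?exprn_gt0//.
      have -> : 9 / 4 * (1 + t) ^+ 2 * e ^+ 2 = (3 / 2 * e * (1 + t)) ^+ 2 by field.
      by rewrite -(real_normK (num_real y)); apply: ler_sqr_of.
    have : 1 <= (1 + t) ^+ 2 by rewrite exprn_ege1//; clear -t0; lra.
    by clear; lra.
  have y4 : 0 <= 1 + y ^+ 2 / e ^+ 2 by rewrite addr_ge0// divr_ge0// sqr_ge0.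
  have y5 : (1 + y ^+ 2 / e ^+ 2) ^+ 2 <= 169 / 16 * (1 + t) ^+ 4.
    have -> : 169 / 16 * (1 + t) ^+ 4 = (13 / 4 * (1 + t) ^+ 2) ^+ 2 by field.
    exact: ler_sqr_of.
  have y6 : `|y| ^+ 3 <= 3 * e * (1 + t) * W.
    have -> : `|y| ^+ 3 = `|y| * y ^+ 2 by rewrite -(real_normK (num_real y)); ring.
    have -> : 3 * e * (1 + t) * W = 3 / 2 * e * (1 + t) * (2 * W) by field.
    by apply: ler_pM => //; exact: sqr_ge0.
  have y7 : `|y| ^+ 3 * (1 + y ^+ 2 / e ^+ 2) ^+ 2
      <= (3 * e * (1 + t) * W) * (169 / 16 * (1 + t) ^+ 4).
    by apply: ler_pM => //; exact: sqr_ge0.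
  have y8 : expR (l * x) * (`|y| ^+ 3 * (1 + y ^+ 2 / e ^+ 2) ^+ 2)
      <= q * ((3 * e * (1 + t) * W) * (169 / 16 * (1 + t) ^+ 4)).
    by apply: ler_pM => //; apply: mulr_ge0 => //; exact: sqr_ge0.
  apply: (le_trans y8).
  have -> : q * (3 * e * (1 + t) * W * (169 / 16 * (1 + t) ^+ 4))
    = e * (507 / 16 * (W * ((1 + t) ^+ 5 * q))) by field.
  apply: ler_wpM2l; first exact: ltW.
  have : W * ((1 + t) ^+ 5 * q) <= V by apply: ler_wpM2l => //; exact: ler_wpM2r.
  by clear -V0; lra.
Qed.

End exponential_tilt.

Section fatou.
Context d (T : measurableType d) (R : realType) (P : probability T R).
Variable Z : T -> R.
Hypothesis hZ : density P Z.

(** Fatou's lemma delivers integrability of the limit along with the bound; exponential moments are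
    obtained in this way from partial sums of power moments. *)
Lemma Int_fatou (f : nat -> T -> R) (g : T -> R) (B : R) :
  measurable_fun setT g -> (forall N, Int P Z (f N)) -> (forall N w, 0 <= f N w) ->
  (forall w, f N w @[N --> \oo] --> g w) -> (forall N, Ex P Z (f N) <= B) ->
  Int P Z g /\ Ex P Z g <= B.
Proof.
move=> mg If f0 fg fB; have [mZ Z0 _] := hZ.
have g0 w : 0 <= g w.
  rewrite -(cvg_lim _ (fg w))//; apply: limr_ge; first exact: cvgP (fg w).
  exact: nearW.
have fZ N : (\int[P]_w (f N w * Z w)%:E = (Ex P Z (f N))%:E)%E.
  by rewrite /Ex /Rintegral fineK// integrable_fin_num//; exact: If.
have gB : (\int[P]_w (g w * Z w)%:E <= B%:E)%E.
  have -> : (fun w => (g w * Z w)%:E) = fun w => limn_einf (fun N => (f N w * Z w)%:E).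
    apply/funext => w; symmetry.
    have cw : (f N w * Z w)%:E @[N --> \oo] --> (g w * Z w)%:E.
      by apply: cvg_EFin; [exact: nearW|apply: cvgM => //; exact: cvg_cst].
    exact: (cvg_limn_einf_sup cw).1.
  apply: le_trans (fatou P measurableT _ _) _.
  - by move=> N; exact: measurable_int (If N).
  - by move=> N w _; rewrite lee_fin mulr_ge0.
  rewrite limn_einf_lim; apply: lime_le; first exact: is_cvg_einfs.
  apply: nearW => N; apply: le_trans (_ : (\int[P]_w (f N w * Z w)%:E <= _)%E).
    by apply: ereal_inf_lbound; exists N => //=.
  by rewrite fZ lee_fin.
have Ig : Int P Z g.
  apply/integrableP; split; first by apply/measurable_EFinP; exact: measurable_funM.
  rewrite (eq_integral (fun w => (g w * Z w)%:E)); first exact: le_lt_trans gB (ltry B).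
  by move=> w _; rewrite gee0_abs// lee_fin mulr_ge0.
split => //; rewrite -lee_fin; apply: le_trans gB.
by rewrite /Ex /Rintegral fineK// integrable_fin_num//; exact: Ig.
Qed.

End fatou.

(* Meant for the densities [Z = 1_A / P A] with [A] in a sigma-algebra: estimates
   conditional on it become estimates under every such [Z]. *)
Record bernstein_moments d (T : measurableType d) (R : realType) (P : probability T R)
    (Z : T -> R) (e : R) (x s : T -> R) : Prop := {
  bm_density : density P Z ;
  bm_e : 0 < e ;
  bm_mx : measurable_fun setT x ;
  bm_ms : measurable_fun setT s ;
  bm_s : forall w, 0 <= s w <= 12 * e ^+ 2 ;
  bm_Int : forall k, Int P Z (fun w => x w ^+ k) ;
  bm_mean : Ex P Z x = 0 ;
  bm_var : Ex P Z (fun w => x w ^+ 2) = Ex P Z s ;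
  bm_moment : forall k, Ex P Z (fun w => x w ^+ k.+2)
    <= 1 / 2 * (k.+2)`!%:R * e ^+ k * Ex P Z s }.

Section exponential_moments.
Context {R : realType}.
Implicit Types t u : R.

Lemma series_exp_coeffE u N : series (exp_coeff u) N = \sum_(i < N) u ^+ i / i`!%:R.
Proof. by rewrite /series /= big_mkord; apply: eq_bigr. Qed.

Lemma cvg_exp_sum u : (\sum_(i < N) u ^+ i / i`!%:R) @[N --> \oo] --> expR u.
Proof.
under eq_fun do rewrite -series_exp_coeffE.
exact: is_cvg_series_exp_coeff.
Qed.

Lemma exp_sum_le u N : 0 <= u -> \sum_(i < N) u ^+ i / i`!%:R <= expR u.
Proof.
move=> u0; rewrite -series_exp_coeffE.
apply: nondecreasing_cvgn_le; last exact: is_cvg_series_exp_coeff.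
apply: nondecreasing_series => i _ _; exact: exp_coeff_ge0.
Qed.

Lemma geometric_sum_le t N : 0 <= t < 1 -> \sum_(i < N) t ^+ i <= (1 - t)^-1.
Proof.
move=> /andP[t0 t1].
have h : (1 - t) * (\sum_(i < N) t ^+ i) = 1 - t ^+ N.
  by rewrite -opprB mulNr -subrX1 opprB.
rewrite -[leRHS]mul1r ler_pdivlMr; last by lra.
by rewrite mulrC h gerBl exprn_ge0.
Qed.

(** Majorant of an exponential series under Bernstein's condition: the terms of orders 0 and 1 are
    explicit, and from order 2 on the factorials cancel and leave a geometric progression. *)
Definition head2_geom (c0 c1 a t : R) (j : nat) : R :=
  if j is i.+2 then a * t ^+ i else if j is 1%N then c1 else c0.

Lemma head2_geom_ge0 (c0 c1 a t : R) j : 0 <= c0 -> 0 <= c1 -> 0 <= a -> 0 <= t ->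
  0 <= head2_geom c0 c1 a t j.
Proof. by case: j => [|[|i]] //= c00 c10 a0 t0; rewrite mulr_ge0// exprn_ge0. Qed.

Lemma head2_geom_sum_le (c0 c1 a t : R) N : 0 <= c0 -> 0 <= c1 -> 0 <= a -> 0 <= t < 1 ->
  \sum_(j < N) head2_geom c0 c1 a t j <= c0 + c1 + a / (1 - t).
Proof.
move=> c00 c10 a0 t01; have /andP[t0 t1] := t01.
have S : \sum_(j < N.+2) head2_geom c0 c1 a t j <= c0 + c1 + a / (1 - t).
  rewrite 2!big_ord_recl /= addrA lerD2l -mulr_sumr ler_wpM2l//.
  exact: geometric_sum_le.
have h j : 0 <= head2_geom c0 c1 a t j by exact: head2_geom_ge0.
apply: le_trans S; rewrite big_ord_recr; apply: ler_wpDr; first exact: h.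
by rewrite big_ord_recr; apply: ler_wpDr; first exact: h.
Qed.

End exponential_moments.

Section bernstein_moments_theory.
Context d (T : measurableType d) (R : realType) (P : probability T R).
Variables (Z : T -> R) (e : R) (x s : T -> R).
Hypothesis hb : bernstein_moments P Z e x s.
Local Notation E := (Ex P Z).
Local Notation I := (Int P Z).

Let hZ : density P Z. Proof. by case: hb. Qed.
Let e0 : 0 < e. Proof. by case: hb. Qed.
Let mx : measurable_fun setT x. Proof. by case: hb. Qed.
Let Is : I s.
Proof.
apply: (Int_bounded hZ (bm_ms hb) (M := 12 * e ^+ 2)) => w.
by have /andP[h1 h2] := bm_s hb w; rewrite ger0_norm.
Qed.
Let Es0 : 0 <= E s. Proof. by apply: (Ex_ge0 hZ) => w; case/andP: (bm_s hb w). Qed.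

Let ch u j : R := (u ^+ j + (- u) ^+ j) / j`!%:R.

Let ch_ge0 u j : 0 <= ch u j.
Proof.
rewrite /ch divr_ge0// exprNn -signr_odd.
have [oj|ej] := boolP (odd j); first by rewrite expr1 mulN1r subrr.
by rewrite expr0 mul1r addr_ge0// exprn_even_ge0.
Qed.

(** Bernstein's condition bounds signed moments, not those of [|x|]. Symmetrising in the sign of [t]
    kills the odd powers, so the partial sums are nonnegative and Fatou's lemma applies. *)
Lemma Int_cosh_moment (p : nat) t B (b : nat -> R) : 0 <= t -> ~~ odd p ->
  (forall j, 2 * t ^+ j / j`!%:R * E (fun w => x w ^+ (p + j)) <= b j) ->
  (forall j, 0 <= b j) -> (forall N, \sum_(j < N) b j <= B) ->
  I (fun w => x w ^+ p * (expR (t * x w) + expR (- (t * x w)))) /\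
  E (fun w => x w ^+ p * (expR (t * x w) + expR (- (t * x w)))) <= B.
Proof.
move=> t0 pe hj b0 bB.
pose f j w := (t ^+ j * (1 + (-1) ^+ j) / j`!%:R) * x w ^+ (p + j).
have fE j w : f j w = x w ^+ p * ch (t * x w) j.
  by rewrite /f /ch exprD (exprNn (t * x w)) !exprMn; ring.
have If j : I (f j) by apply: IntZ; exact: (bm_Int hb).
apply: (Int_fatou hZ (f := fun N w => \sum_(j < N) f j w)).
- by msolve.
- by move=> N; apply: Int_sum => // i.
- move=> N w; apply: sumr_ge0 => j _; rewrite fE mulr_ge0// exprn_even_ge0//.
- move=> w; under eq_fun do (under eq_bigr do rewrite fE).
  under eq_fun do rewrite -mulr_sumr.
  apply: cvgM; first exact: cvg_cst.
  under eq_fun do (under eq_bigr do rewrite /ch mulrDl).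
  under eq_fun do rewrite big_split.
  by apply: cvgD; exact: cvg_exp_sum.
- move=> N; rewrite Ex_sum//; apply: le_trans (bB N); apply: ler_sum => j _.
  rewrite /f ExZ; last exact: (bm_Int hb).
  rewrite -signr_odd; have [oj|ej] := boolP (odd j).
    by rewrite expr1 subrr mulr0 !mul0r.
  by rewrite expr0 (mulrC _ (1 + 1)).
Qed.

Let moment_le j : E (fun w => x w ^+ (2 + j)) <= 1 / 2 * (j.+2)`!%:R * e ^+ j * E s.
Proof. exact: (bm_moment hb). Qed.

Lemma Int_exp_jump t : 0 <= t -> t * e < 1 -> I (fun w => expR (t * x w) + expR (- (t * x w))).
Proof.
move=> t0 te; have te0 : 0 <= t * e by rewrite mulr_ge0// ltW.
have a0 : 0 <= t ^+ 2 * E s by rewrite mulr_ge0// exprn_ge0.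
have b0 j : 0 <= head2_geom 2 0 (t ^+ 2 * E s) (t * e) j by exact: head2_geom_ge0.
have B N : \sum_(j < N) head2_geom 2 0 (t ^+ 2 * E s) (t * e) j
    <= 2 + 0 + t ^+ 2 * E s / (1 - t * e).
  by apply: head2_geom_sum_le => //; rewrite te0.
have hj j : 2 * t ^+ j / j`!%:R * E (fun w => x w ^+ (0 + j))
    <= head2_geom 2 0 (t ^+ 2 * E s) (t * e) j.
  case: j => [|[|i]] /=.
  - by under eq_Ex do rewrite expr0; rewrite (Ex_cst hZ) expr0 fact0; lra.
  - by under eq_Ex do rewrite expr1; rewrite (bm_mean hb) mulr0.
  - rewrite add0n; have f0 : 0 < (i.+2)`!%:R :> R by rewrite ltr0n fact_gt0.
    have c0 : 0 <= 2 * t ^+ i.+2 / (i.+2)`!%:R.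
      by apply: divr_ge0; [apply: mulr_ge0 => //; exact: exprn_ge0|exact: ltW].
    apply: le_trans (ler_wpM2l c0 (bm_moment hb i)) _.
    by apply: eq_le_of; rewrite exprMn !exprS; field; rewrite gt_eqF.
have [h _] := Int_cosh_moment (p := 0%N) t0 isT hj b0 B.
by apply: eq_Int h => w; rewrite expr0 mul1r.
Qed.

Lemma Ex_exp_jump_le t : 0 <= t -> t * e < 1 -> I (fun w => expR (t * x w)) /\
  E (fun w => expR (t * x w)) <= 1 + t ^+ 2 / (2 * (1 - t * e)) * E s.
Proof.
move=> t0 te.
have Ig := Int_exp_jump t0 te.
pose g w := expR (t * x w) + expR (- (t * x w)).
have te0 : 0 <= t * e by rewrite mulr_ge0// ltW.
pose f N w := \sum_(j < N) (t ^+ j / j`!%:R * x w ^+ j).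
have Ij j : I (fun w => t ^+ j / j`!%:R * x w ^+ j) by apply: IntZ; exact: (bm_Int hb).
have If N : I (f N) by apply: Int_sum.
have I1 : I (fun w => expR (t * x w)).
  apply: (Int_le hZ _ Ig); first by msolve.
  by move=> w; rewrite ger0_norm ?expR_ge0// lerDl expR_ge0.
split => //.
pose B := 1 + t ^+ 2 / (2 * (1 - t * e)) * E s.
have fB N : E (f N) <= B.
  have BE : B = 1 + 0 + t ^+ 2 / 2 * E s / (1 - t * e).
    by rewrite /B; field; rewrite gt_eqF// subr_gt0.
  rewrite BE Ex_sum//; apply: le_trans (@head2_geom_sum_le _ _ _ _ _ N _ _ _ _) => //.
  - apply: ler_sum => j _; rewrite ExZ; last exact: (bm_Int hb).
    case: (nat_of_ord j) => [|[|i]] /=.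
    + by under eq_Ex do rewrite expr0; rewrite (Ex_cst hZ) expr0 fact0; lra.
    + by under eq_Ex do rewrite expr1; rewrite (bm_mean hb) mulr0.
    + have f0 : 0 < (i.+2)`!%:R :> R by rewrite ltr0n fact_gt0.
      have c0 : 0 <= t ^+ i.+2 / (i.+2)`!%:R by rewrite divr_ge0 ?exprn_ge0// ltW.
      apply: le_trans (ler_wpM2l c0 (bm_moment hb i)) _.
      by apply: eq_le_of; rewrite exprMn !exprS; field; rewrite gt_eqF.
  - by rewrite mulr_ge0// divr_ge0// exprn_ge0.
  - by rewrite te0.
have ge w : expR `|t * x w| <= g w.
  rewrite /g; have [h|h] := leP 0 (t * x w).
    by rewrite ger0_norm// lerDl expR_ge0.
  by rewrite ltr0_norm// lerDr expR_ge0.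
have fg N w : `|f N w| <= g w.
  apply: le_trans (ge w); apply: le_trans (ler_norm_sum _ _ _) _.
  apply: le_trans (exp_sum_le N (normr_ge0 (t * x w))).
  apply: ler_sum => j _; rewrite mulrAC -exprMn normrM normrX.
  by rewrite (ger0_norm (x := (_)^-1)) ?invr_ge0.
(* The partial sums [f N] may be negative; adding the integrable majorant [g] of [|f N|] makes
   Fatou's lemma applicable. *)
have H : I (fun w => expR (t * x w) + g w) /\ E (fun w => expR (t * x w) + g w) <= B + E g.
  apply: (Int_fatou hZ (f := fun N w => f N w + g w)).
  - by rewrite /g; msolve.
  - by move=> N; apply: IntD.
  - by move=> N w; have := fg N w; rewrite ler_norml => /andP[h _]; lra.
  - move=> w; apply: cvgD; last exact: cvg_cst.
    have := @cvg_exp_sum R (t * x w).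
    by under eq_fun do (under eq_bigr do rewrite exprMn mulrAC).
  - by move=> N; rewrite ExD// lerD2r.
by move: H.2; rewrite ExD// lerD2r.
Qed.

Lemma Ex_exp_jump_ge t : 0 <= t -> t * e < 1 -> 1 <= E (fun w => expR (t * x w)).
Proof.
move=> t0 te; have [Ie _] := Ex_exp_jump_le t0 te.
have Ix : I x by apply: eq_Int (bm_Int hb 1) => w; rewrite expr1.
have <- : E (fun w => cst 1 w + t * x w) = 1.
  rewrite ExD; [|exact: (Int_cst hZ)|exact: IntZ].
  by rewrite (Ex_cst hZ) ExZ// (bm_mean hb) mulr0 addr0.
apply: (Ex_le hZ) => //; last by move=> w; exact: expR_ge1Dx.
by apply: IntD; [exact: (Int_cst hZ)|exact: IntZ].
Qed.

Let K w := x w ^+ 2 * expR (`|x w| / e / 4).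

(** With [t e = 1 / 4] the term of order [j] is at most [(j + 2) (j + 1) / 4^j <= 3 / 2^j] times
    [E s], and these sum to 6. *)
Lemma Ex_sqr_exp_jump_le : I K /\ E K <= 6 * E s.
Proof.
pose t := (4 * e)^-1; have t0 : 0 <= t by rewrite invr_ge0 mulr_ge0// ltW.
pose b j := 3 * (2^-1) ^+ j * E s.
have b0 j : 0 <= b j by rewrite mulr_ge0// mulr_ge0// exprn_ge0.
have B N : \sum_(j < N) b j <= 6 * E s.
  rewrite -mulr_suml ler_wpM2r// -mulr_sumr.
  have := @geometric_sum_le R (2^-1) N; have -> : (1 - 2^-1)^-1 = 2 :> R by field.
  by move=> h; have := h ltac:(lra); lra.
have fk j : (j.+2 * j.+1)%:R <= 3 * 2 ^+ j :> R.
  elim: j => [|j IH]; first by rewrite expr0; lra.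
  have [->|j0] := eqVneq j 0%N; first by rewrite expr1; lra.
  rewrite exprS; apply: le_trans (_ : 2 * (j.+2 * j.+1)%:R <= _); last by lra.
  rewrite -natrM ler_nat (mulnC j.+3) mulnCA leq_mul2l /=.
  by case: j j0 {IH} => // j _; rewrite mul2n -addnn !addSn !addnS !ltnS leq_addr.
have hj j : 2 * t ^+ j / j`!%:R * E (fun w => x w ^+ (2 + j)) <= b j.
  have f0 : 0 < j`!%:R :> R by rewrite ltr0n fact_gt0.
  have c0 : 0 <= 2 * t ^+ j / j`!%:R by rewrite divr_ge0 ?mulr_ge0 ?exprn_ge0// ltW.
  apply: le_trans (ler_wpM2l c0 (moment_le j)) _; rewrite /b !mulrA ler_wpM2r//.
  rewrite !factS mulnA natrM.
  have -> : 2 * t ^+ j / j`!%:R * 1 / 2 * ((j.+2 * j.+1)%:R * j`!%:R) * e ^+ j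
     = (j.+2 * j.+1)%:R * (t * e) ^+ j.
    by rewrite exprMn; field; rewrite gt_eqF.
  have -> : t * e = (2^-1) * (2^-1) by rewrite /t; field; rewrite gt_eqF.
  rewrite exprMn mulrA ler_wpM2r ?exprn_ge0//.
  apply: le_trans (ler_wpM2r (exprn_ge0 j _) (fk j)) _ => //.
  by rewrite -mulrA -exprMn mulfV// expr1n; lra.
have [h1 h2] := Int_cosh_moment (p := 2%N) t0 isT hj b0 B.
have Kle w : K w <= x w ^+ 2 * (expR (t * x w) + expR (- (t * x w))).
  rewrite /K ler_wpM2l ?sqr_ge0//.
  have -> : `|x w| / e / 4 = `|t * x w|.
    by rewrite normrM (ger0_norm t0) /t; field; rewrite gt_eqF.
  have [h|h] := leP 0 (t * x w).
    by rewrite ger0_norm// lerDl expR_ge0.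
  by rewrite ltr0_norm// lerDr expR_ge0.
have K0 w : 0 <= K w by rewrite mulr_ge0 ?sqr_ge0 ?expR_ge0.
have IK : I K.
  apply: (Int_le hZ _ h1); first by rewrite /K; msolve.
  by move=> w; rewrite ger0_norm.
by split => //; apply: le_trans h2; exact: (Ex_le hZ).
Qed.

Variable l : R.
Hypotheses (l0 : 0 <= l) (le8 : l * e <= 1 / 8).
Variable M : R.
Hypothesis M0 : 0 < M.
Hypothesis hM : forall x s, 0 <= s <= 12 * e ^+ 2 ->
  let y := x - l * s in let B := s + x ^+ 2 * expR (`|x| / e / 4) in
  [/\ `|expR (l * x) * y - (x + l * x ^+ 2 - l * s)| <= M * (l ^+ 2 * e) * B,
      `|expR (l * x) * (y ^+ 2 - s) - (x ^+ 2 - s)| <= M * (l * e) * B &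
      expR (l * x) * (`|y| ^+ 3 * (1 + y ^+ 2 / e ^+ 2) ^+ 2) <= M * e * B].

Let y w := x w - l * s w.
Let B w := s w + K w.
Let IB : I B. Proof. by apply: IntD => //; exact: Ex_sqr_exp_jump_le.1. Qed.
Let EB : E B <= 7 * E s.
Proof. by have [h1 h2] := Ex_sqr_exp_jump_le; rewrite ExD//; lra. Qed.
Let my : measurable_fun setT y. Proof. by have ms := bm_ms hb; rewrite /y; msolve. Qed.

(** The 7 is [1 + 6]: the mean of [B] is [E s] plus the bound of [Ex_sqr_exp_jump_le]. *)
Let approx (f g : T -> R) c : measurable_fun setT f -> measurable_fun setT g ->
  I g -> E g = 0 -> 0 <= c ->
  (forall w, `|f w - g w| <= M * c * B w) -> I f /\ `|E f| <= 7 * M * c * E s.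
Proof.
move=> mf mg Ig Eg c0 fg.
have Mc : 0 <= M * c by rewrite mulr_ge0// ltW.
have Id : I (fun w => f w - g w).
  by apply: (Int_le hZ (measurable_funB mf mg) (IntZ (M * c) IB)).
have fE w : f w = g w + (f w - g w) by rewrite addrC subrK.
have If : I f by apply: eq_Int (IntD Ig Id) => w; rewrite -fE.
split => //; rewrite (eq_Ex fE) ExD// Eg add0r.
apply: (le_trans (Ex_norm hZ Id (IntZ (M * c) IB) fg)).
rewrite ExZ//; apply: (le_trans (ler_wpM2l Mc EB)); apply: eq_le_of; ring.
Qed.

Let Ix : I x. Proof. by apply: eq_Int (bm_Int hb 1) => w; rewrite expr1. Qed.

Lemma tilted_mean :
  I (fun w => expR (l * x w) * y w) /\
  `|E (fun w => expR (l * x w) * y w)| <= 7 * M * (l ^+ 2 * e) * E s.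
Proof.
have ms := bm_ms hb.
apply: (@approx _ (fun w => x w + (l * x w ^+ 2 - l * s w))).
- by msolve.
- by msolve.
- by apply: IntD => //; apply: IntB; apply: IntZ => //; exact: (bm_Int hb).
- rewrite ExD ?ExB ?ExZ//; try exact: (bm_Int hb).
  + by rewrite (bm_var hb) subrr (bm_mean hb) addr0.
  + by apply: IntZ; exact: (bm_Int hb).
  + exact: IntZ.
  + by apply: IntB; apply: IntZ => //; exact: (bm_Int hb).
- by rewrite mulr_ge0 ?exprn_ge0// ltW.
- by move=> w; rewrite addrA; have [h _ _] := hM (x w) (bm_s hb w).
Qed.

Lemma tilted_var :
  I (fun w => expR (l * x w) * (y w ^+ 2 - s w)) /\
  `|E (fun w => expR (l * x w) * (y w ^+ 2 - s w))| <= 7 * M * (l * e) * E s.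
Proof.
have ms := bm_ms hb.
apply: (@approx _ (fun w => x w ^+ 2 - s w)).
- by msolve.
- by msolve.
- by apply: IntB => //; exact: (bm_Int hb).
- by rewrite ExB//; [rewrite (bm_var hb) subrr|exact: (bm_Int hb)].
- by rewrite mulr_ge0// ltW.
- by move=> w; have [_ h _] := hM (x w) (bm_s hb w).
Qed.

Lemma tilted_third :
  I (fun w => expR (l * x w) * (`|y w| ^+ 3 * (1 + y w ^+ 2 / e ^+ 2) ^+ 2)) /\
  E (fun w => expR (l * x w) * (`|y w| ^+ 3 * (1 + y w ^+ 2 / e ^+ 2) ^+ 2))
    <= 7 * M * e * E s.
Proof.
have ms := bm_ms hb.
have mf : measurable_fun setT (fun w => expR (l * x w) * (`|y w| ^+ 3 * (1 + y w ^+ 2 / e ^+ 2) ^+ 2)).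
  by msolve.
have [|If h] := @approx _ (cst 0) e mf (measurable_cst _) (Int_cst hZ 0) (Ex_cst hZ 0) (ltW e0).
  move=> w; rewrite subr0 ger0_norm; first by have [_ _ h] := hM (x w) (bm_s hb w).
  by rewrite mulr_ge0 ?expR_ge0// mulr_ge0 ?sqr_ge0// exprn_ge0.
by split => //; exact: le_trans (ler_norm _) h.
Qed.

End bernstein_moments_theory.

(** * Conditioning and exponential tilting *)

Section pull_out.
Context d (T : measurableType d) (R : realType) (P : probability T R).
Variable G : set (set T).
Hypotheses (sG : sigma_algebra setT G) (GT : G `<=` measurable).

Lemma sub_measurableE (A : set (g_sigma_algebraType G)) : measurable A -> G A.
Proof. by move=> mA; rewrite -(measurable_g_measurableTypeE sG). Qed.

(** The inequality of the conditional expectations of [X] and [Y] given [G], written with integrals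
    over events. For nonnegative functions it makes sense before any integrability is known. *)
Definition cond_le (X Y : T -> R) := forall A, G A ->
  (\int[P]_(w in A) (X w)%:E <= \int[P]_(w in A) (Y w)%:E)%E.

Section simple.
Variable h : {nnsfun (g_sigma_algebraType G) >-> R}.

Let Gpre r : G (h @^-1` [set r]).
Proof. by apply: sub_measurableE; exact: measurable_funPTI. Qed.

Lemma integral_mul_nnsfun (X : T -> R) : measurable_fun setT X -> (forall w, 0 <= X w) ->
  (\int[P]_w (h w * X w)%:E =
   \sum_(r \in range h) r%:E * \int[P]_(w in h @^-1` [set r]) (X w)%:E)%E.
Proof.
move=> mX X0.
have mh r : measurable_fun setT (\1_(h @^-1` [set r]) : T -> R).
  by apply: measurable_indic; exact: GT.
have h0 r w : 0 <= r * \1_(h @^-1` [set r]) w :> R.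
  rewrite indicE; case: (boolP (w \in _)) => [|_]; last by rewrite mulr0.
  by rewrite inE /= => <-; rewrite mulr1; exact: fun_ge0.
transitivity (\int[P]_w (\sum_(r \in range h) (r * \1_(h @^-1` [set r]) w * X w)%:E))%E.
  apply: eq_integral => w _; rewrite fsumEFin//; congr EFin.
  rewrite {1}fimfunE mulrC mulr_fsumr; apply: eq_fsbigr => r _; rewrite mulrC; congr (_ * _).
rewrite ge0_integral_fsum//; last 2 first.
- move=> r; apply/measurable_EFinP; apply: measurable_funM => //.
  by apply: measurable_funM => //; exact: measurable_cst.
- by move=> r w _; rewrite lee_fin mulr_ge0.
apply: eq_fsbigr => r; rewrite inE => -[w0 _ hr].
rewrite [in RHS]integral_mkcond epatch_indic -ge0_integralZl//.
- by apply: eq_integral => w _; rewrite -EFinM /=; congr EFin; ring.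
- apply/measurable_EFinP; apply: measurable_funM => //.
- by move=> w _; rewrite /= -EFinM lee_fin mulr_ge0.
- by rewrite lee_fin -hr; exact: fun_ge0.
Qed.

Lemma pull_out_nnsfun (X Y : T -> R) : measurable_fun setT X -> (forall w, 0 <= X w) ->
  measurable_fun setT Y -> (forall w, 0 <= Y w) -> cond_le X Y ->
  (\int[P]_w (h w * X w)%:E <= \int[P]_w (h w * Y w)%:E)%E.
Proof.
move=> mX X0 mY Y0 XY; rewrite !integral_mul_nnsfun//; apply: lee_fsum => //.
move=> r [w0 _ hr]; apply: lee_wpmul2l; first by rewrite lee_fin -hr; exact: fun_ge0.
exact: XY.
Qed.

End simple.

(** For [G]-simple [H] this is a finite combination of the inequalities on events; the general case
    follows by monotone convergence. *)
Lemma pull_out (X Y H : T -> R) : measurable_fun setT X -> (forall w, 0 <= X w) ->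
  measurable_fun setT Y -> (forall w, 0 <= Y w) -> cond_le X Y ->
  measurable_wrt G H -> (forall w, 0 <= H w) ->
  (\int[P]_w (H w * X w)%:E <= \int[P]_w (H w * Y w)%:E)%E.
Proof.
move=> mX X0 mY Y0 XY mH H0.
have mH' : measurable_fun [set: g_sigma_algebraType G] (EFin \o H).
  exact/measurable_EFinP.
have [|h [hincr hcvg]] := approximation measurableT mH'.
  by move=> w _ /=; rewrite lee_fin.
have mh j : measurable_fun setT (h j : T -> R).
  by apply: (measurable_wrt_fun GT); exact: measurable_funPT.
have h0 j w : 0 <= h j w by exact: fun_ge0.
have lim (W : T -> R) : measurable_fun setT W -> (forall w, 0 <= W w) ->
  (\int[P]_w (h j w * W w)%:E @[j --> \oo] --> \int[P]_w (H w * W w)%:E)%E.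
  move=> mW W0.
  have -> : (fun w => (H w * W w)%:E) = fun w => limn (fun j => (h j w * W w)%:E).
    apply/funext => w; symmetry; apply/cvg_lim => //.
    have := hcvg w I => /= hw.
    rewrite EFinM; under eq_fun do rewrite EFinM.
    by apply: cvgeM => //; exact: cvg_cst.
  apply: cvg_monotone_convergence => //.
  - by move=> j; apply/measurable_EFinP; exact: measurable_funM.
  - by move=> j w _; rewrite lee_fin mulr_ge0.
  - move=> w _ i j ij; rewrite lee_fin ler_wpM2r//.
    by have /lefP := hincr _ _ ij; apply.
rewrite -(cvg_lim _ (lim X mX X0))// -(cvg_lim _ (lim Y mY Y0))//.
apply: lee_lim; [exact: cvgP (lim X mX X0)|exact: cvgP (lim Y mY Y0)|].
by apply: nearW => j; exact: pull_out_nnsfun.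
Qed.

Lemma pull_out_eq (X Y H : T -> R) : measurable_fun setT X -> (forall w, 0 <= X w) ->
  measurable_fun setT Y -> (forall w, 0 <= Y w) -> cond_le X Y -> cond_le Y X ->
  measurable_wrt G H -> (forall w, 0 <= H w) ->
  (\int[P]_w (H w * X w)%:E = \int[P]_w (H w * Y w)%:E)%E.
Proof.
move=> mX X0 mY Y0 XY YX mH H0.
by apply/eqP; rewrite eq_le; apply/andP; split; apply: pull_out.
Qed.

(** The event [Y < X] belongs to [G]; testing on it shows that the positive difference [X - Y] has
    integral zero there. *)
Lemma cond_le_ae (X Y : T -> R) : measurable_wrt G X -> measurable_wrt G Y ->
  P.-integrable setT (EFin \o X) -> P.-integrable setT (EFin \o Y) ->
  (forall A, G A -> (\int[P]_(w in A) (X w)%:E <= \int[P]_(w in A) (Y w)%:E)%E) ->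
  {ae P, forall w, X w <= Y w}.
Proof.
move=> mX mY iX iY XY.
pose A := [set w | Y w < X w].
have GA : G A.
  apply: sub_measurableE.
  have := measurable_fun_ltr (f := Y : g_sigma_algebraType G -> R) mY mX.
  move=> /(_ measurableT [set true] I); rewrite setTI.
  by congr measurable; apply/seteqP; split => w /=.
have mA := GT GA.
have iXA := integrableS measurableT mA (@subsetT _ _) iX.
have iYA := integrableS measurableT mA (@subsetT _ _) iY.
have iD : P.-integrable A (fun w => (X w)%:E - (Y w)%:E)%E by exact: integrableB.
have D0 : (\int[P]_(w in A) `|(X w)%:E - (Y w)%:E|%E = 0)%E.
  apply/eqP; rewrite eq_le; apply/andP; split; last by apply: integral_ge0 => w _.
  rewrite (eq_integral (fun w => (X w)%:E - (Y w)%:E)%E); last first.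
    move=> w; rewrite inE => /ltW h; rewrite gee0_abs// -EFinB lee_fin subr_ge0//.
  rewrite integralB// sube_le0//; exact: XY.
have /ae_eq_integral_abs h := measurable_int _ iD.
have := (h P mA).1 D0; apply: filterS => w /= hw; rewrite leNgt; apply/negP => Aw.
by move: (hw Aw); rewrite -EFinB => -[] /eqP; rewrite subr_eq0 gt_eqF.
Qed.

End pull_out.

Lemma integrable_bounded d (T : measurableType d) (R : realType) (P : probability T R)
    (f : T -> R) (M : R) : measurable_fun setT f -> (forall w, `|f w| <= M) ->
  P.-integrable setT (EFin \o f).
Proof.
move=> mf fM; have hd : density P (cst 1).
  split; [exact: measurable_cst|by move=> w; exact: ler01|].
  by rewrite (eq_integral (cst 1%E))// integral_cst// mul1e; exact: probability_setT.
have := Int_bounded hd mf fM; rewrite /Int; congr (_.-integrable setT _).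
by apply/funext => w /=; rewrite mulr1.
Qed.

Section conditional_density.
Context d (T : measurableType d) (R : realType) (P : probability T R).
Variable A : set T.
Hypotheses (mA : measurable A) (PA : (0 < P A)%E).

(** The density of [P] conditioned on the event [A]. Inequalities under all these densities, [A] in
    a sigma-algebra, amount to a conditional inequality through [cond_le_Ex]. *)
Definition cdens (w : T) : R := \1_A w / fine (P A).

Let p := fine (P A).
Let pE : P A = p%:E. Proof. by rewrite /p fineK// fin_num_measure. Qed.
Let p0 : 0 < p. Proof. by rewrite -lte_fin -pE. Qed.

Lemma measurable_cdens : measurable_fun setT cdens.
Proof. by apply: measurable_funM; [exact: measurable_indic|exact: measurable_cst]. Qed.

Lemma integral_cdens (X : T -> R) : measurable_fun setT X -> (forall w, 0 <= X w) ->
  (\int[P]_(w in A) (X w)%:E = p%:E * \int[P]_w (X w * cdens w)%:E)%E.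
Proof.
move=> mX X0; rewrite integral_mkcond epatch_indic -ge0_integralZl//.
- apply: eq_integral => w _; rewrite -!EFinM /cdens -/p; congr EFin.
  by field; rewrite gt_eqF.
- by apply/measurable_EFinP; apply: measurable_funM => //; exact: measurable_cdens.
- by move=> w _; rewrite lee_fin mulr_ge0// divr_ge0// ltW.
- by rewrite lee_fin ltW.
Qed.

Lemma density_cdens : density P cdens.
Proof.
split; first exact: measurable_cdens.
  by move=> w; rewrite divr_ge0// ltW.
have h := @integral_cdens (cst 1) (measurable_cst _) (fun=> ler01).
have I1 : (\int[P]_(w in A) (cst 1 w)%:E)%E = p%:E.
  by rewrite (eq_integral (cst 1%E))// integral_cst// mul1e; exact: pE.
rewrite I1 in h.
have p0' : p%:E != 0%E by rewrite eqe gt_eqF.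
rewrite (eq_integral (fun w => (cst 1 w * cdens w)%:E)); last by move=> w _ /=; rewrite mul1r.
have f : (\int[P]_w (cst 1 w * cdens w)%:E \is a fin_num)%E.
  rewrite ge0_fin_numE; last by apply: integral_ge0 => w _; rewrite lee_fin mulr_ge0// divr_ge0// ltW.
  rewrite ltNge leye_eq; apply/negP => /eqP hy; move: h; rewrite hy gt0_muley// lte_fin//.
move: h; rewrite -(fineK f) -EFinM => -[] /eqP; rewrite -[X in X == _]mulr1 => /eqP /(mulfI (lt0r_neq0 p0)) <-.
by [].
Qed.

Lemma Int_cdens (X : T -> R) : P.-integrable setT (EFin \o X) -> Int P cdens X.
Proof.
move=> iX; have mX := measurable_int _ iX; rewrite /Int.
have -> : (fun w => (X w * cdens w)%:E) = (fun w => (p^-1)%:E * ((X w)%:E * (\1_A w)%:E))%E.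
  by apply/funext => w; rewrite -!EFinM /cdens -/p; congr EFin; ring.
apply: integrableZl => //; rewrite -epatch_indic.
by apply: (integrable_mkcond _ mA).1; exact: integrableS iX.
Qed.

Lemma Ex_cdens (X : T -> R) : P.-integrable setT (EFin \o X) ->
  Ex P cdens X = fine (\int[P]_(w in A) (X w)%:E) / p.
Proof.
move=> iX; rewrite /Ex /Rintegral [in RHS]integral_mkcond epatch_indic.
have -> : (fun w => (X w * cdens w)%:E) = (fun w => (p^-1)%:E * ((X w)%:E * (\1_A w)%:E))%E.
  by apply/funext => w; rewrite -!EFinM /cdens -/p; congr EFin; ring.
rewrite integralZl//; last first.
  by rewrite -epatch_indic; apply: (integrable_mkcond _ mA).1; exact: integrableS iX.
rewrite fineM//= 1?mulrC// -epatch_indic -integral_mkcond integrable_fin_num//.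
exact: integrableS iX.
Qed.

End conditional_density.

Arguments cdens {d T R} P A w.

Lemma cond_le_Ex d (T : measurableType d) (R : realType) (P : probability T R)
    (G : set (set T)) (X Y : T -> R) : G `<=` measurable ->
  measurable_fun setT X -> (forall w, 0 <= X w) ->
  measurable_fun setT Y -> (forall w, 0 <= Y w) ->
  (forall A, G A -> (0 < P A)%E ->
    [/\ Int P (cdens P A) X, Int P (cdens P A) Y & Ex P (cdens P A) X <= Ex P (cdens P A) Y]) ->
  cond_le P G X Y.
Proof.
move=> GT mX X0 mY Y0 h A GA; have mA := GT _ GA.
have [PA|PA] := ltP 0%E (P A); last first.
  have PA0 : P A = 0%E by apply/eqP; rewrite eq_le PA/=.
  by rewrite !null_set_integral//; apply/measurable_EFinP; apply: measurable_funTS.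
have [iX iY XY] := h A GA PA.
rewrite (integral_cdens mA PA mX X0) (integral_cdens mA PA mY Y0); apply: lee_wpmul2l; first by rewrite lee_fin fine_ge0.
have E f : Int P (cdens P A) f -> (\int[P]_w (f w * cdens P A w)%:E = (Ex P (cdens P A) f)%:E)%E.
  by move=> If; rewrite /Ex /Rintegral fineK// integrable_fin_num//; exact: If.
by rewrite !E.
Qed.

Record cond_bernstein d (T : measurableType d) (R : realType) (P : probability T R)
    (G : set (set T)) (e : R) (x s : T -> R) : Prop := {
  cb_sG : sigma_algebra setT G ;
  cb_GT : G `<=` measurable ;
  cb_e : 0 < e ;
  cb_mx : measurable_fun setT x ;
  cb_ms : measurable_wrt G s ;
  cb_s : forall w, 0 <= s w <= 12 * e ^+ 2 ;
  cb_bm : forall A, G A -> (0 < P A)%E -> bernstein_moments P (cdens P A) e x s }.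

Section cond_bernstein_theory.
Context d (T : measurableType d) (R : realType) (P : probability T R).
Variables (G : set (set T)) (e : R) (x s : T -> R).
Hypothesis cb : cond_bernstein P G e x s.

Let ms : measurable_fun setT s. Proof. exact: measurable_wrt_fun (cb_GT cb) (cb_ms cb). Qed.

Lemma Int_cb_s A : G A -> (0 < P A)%E -> Int P (cdens P A) s.
Proof.
move=> GA PA; apply: (Int_bounded (bm_density (cb_bm cb GA PA)) ms (M := 12 * e ^+ 2)) => w.
by have /andP[h1 h2] := cb_s cb w; rewrite ger0_norm.
Qed.

(** The conditional Laplace transform is at least 1 by convexity and bounded above by Bernstein's
    condition, but only almost surely. The version chosen here satisfies both bounds everywhere, so
    that it can be divided by without exception. *)
Lemma exists_cond_mgf l : 0 <= l -> l * e < 1 -> exists m : T -> R,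
  [/\ measurable_wrt G m,
      forall w, 1 <= m w <= 1 + l ^+ 2 / (2 * (1 - l * e)) * s w,
      cond_le P G (fun w => expR (l * x w)) m & cond_le P G m (fun w => expR (l * x w))].
Proof.
move=> l0 le1; have mx := cb_mx cb; have GT := cb_GT cb; have sG := cb_sG cb.
set c := l ^+ 2 / _.
have c0 : 0 <= c by rewrite divr_ge0 ?sqr_ge0// mulr_ge0// subr_ge0 ltW.
pose f w := expR (l * x w).
have mf : measurable_fun setT f by rewrite /f; msolve.
have GTT : G setT by case: sG => G0 GC _; have := GC _ G0; rewrite setD0.
have PT : (0 < P setT)%E by rewrite probability_setT.
have f0 w : 0 <= f w by exact: expR_ge0.
have If : P.-integrable setT (EFin \o f).
  have [h _] := Ex_exp_jump_le (cb_bm cb GTT PT) l0 le1.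
  move: h; rewrite /Int; congr (_ .-integrable setT _).
  by apply/funext => w; rewrite /cdens probability_setT indicT /= divr1 mulr1.
have [mm im mE] := condexpP sG GT If.
have cs0 w : 0 <= 1 + c * s w.
  by rewrite addr_ge0// mulr_ge0//; case/andP: (cb_s cb w).
have mcs : measurable_wrt G (fun w => 1 + c * s w).
  have := cb_ms cb; rewrite /measurable_wrt => h; msolve.
have mcsT : measurable_fun setT (fun w => 1 + c * s w) by exact: measurable_wrt_fun mcs.
have ics : P.-integrable setT (EFin \o (fun w => 1 + c * s w)).
  apply: (@integrable_bounded _ _ _ _ _ (1 + c * (12 * e ^+ 2))) => // w.
  by rewrite ger0_norm// lerD2l ler_wpM2l//; case/andP: (cb_s cb w).
pose m0 := condexp P G f.
have ge1 : {ae P, forall w, 1 <= m0 w}.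
  apply: (cond_le_ae sG GT (X := cst 1)) => //.
  - exact: measurable_cst.
  - apply: (@integrable_bounded _ _ _ _ _ 1) => [|w /=]; first exact: measurable_cst.
    by rewrite normr1.
  - move=> A GA; rewrite mE//; move: A GA; apply: cond_le_Ex => // A GA PA.
    have bm := cb_bm cb GA PA; have hd := bm_density bm.
    have [h _] := Ex_exp_jump_le bm l0 le1.
    by split => //; [exact: Int_cst|rewrite (Ex_cst hd); exact: (Ex_exp_jump_ge bm)].
have le2 : {ae P, forall w, m0 w <= 1 + c * s w}.
  apply: (cond_le_ae sG GT) => //.
  move=> A GA; rewrite mE//; move: A GA; apply: cond_le_Ex => // A GA PA.
  have bm := cb_bm cb GA PA; have hd := bm_density bm; have Is := Int_cb_s GA PA.
  have [h1 h2] := Ex_exp_jump_le bm l0 le1.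
  split => //; first by apply: IntD; [exact: Int_cst|exact: IntZ].
  by rewrite ExD ?ExZ ?(Ex_cst hd)//; [exact: Int_cst|exact: IntZ].
(* Clipping changes [m0] only on a null set and preserves measurability with respect to [G]. *)
pose m w := Num.max 1 (Num.min (m0 w) (1 + c * s w)).
have mmm : measurable_wrt G m.
  by apply: measurable_maxr; [exact: measurable_cst|exact: measurable_minr].
have m_m0 : {ae P, forall w, m w = m0 w}.
  by apply: filterS2 ge1 le2 => w h1 h2; rewrite /m (min_idPl h2) (max_idPr h1).
have mE' A : G A -> (\int[P]_(w in A) (m w)%:E = \int[P]_(w in A) (f w)%:E)%E.
  move=> GA; rewrite -mE//; apply: ae_eq_integral.
  - exact: GT.
  - apply/measurable_EFinP; apply: measurable_funTS; exact: measurable_wrt_fun mmm.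
  - apply/measurable_EFinP; apply: measurable_funTS; exact: measurable_wrt_fun mm.
  - by apply: filterS m_m0 => w -> _.
exists m; split => //.
- move=> w; rewrite /m le_max lexx /= ge_max ge_min lexx orbT andbT lerDl mulr_ge0//.
  by case/andP: (cb_s cb w).
- by move=> A GA; rewrite mE'.
- by move=> A GA; rewrite mE'.
Qed.

(** [cond_le] is pulled out for nonnegative functions only, so an upper bound on the conditional
    mean of a signed [V] is rewritten with its positive and negative parts. *)
Lemma cond_le_parts (V : T -> R) c : measurable_fun setT V -> 0 <= c ->
  (forall A, G A -> (0 < P A)%E -> Int P (cdens P A) V /\
     `|Ex P (cdens P A) V| <= c * Ex P (cdens P A) s) ->
  cond_le P G (fun w => (`|V w| + V w) / 2) (fun w => (`|V w| - V w) / 2 + c * s w).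
Proof.
move=> mV c0 h.
have n1 w : 0 <= (`|V w| + V w) / 2.
  by rewrite divr_ge0//; have := ler_norm (- V w); rewrite normrN; lra.
have n2 w : 0 <= (`|V w| - V w) / 2.
  by rewrite divr_ge0//; have := ler_norm (V w); lra.
apply: cond_le_Ex => //; [exact: cb_GT cb|by msolve|by msolve| |].
  by move=> w; rewrite addr_ge0// mulr_ge0//; case/andP: (cb_s cb w).
move=> A GA PA; have [IV EV] := h A GA PA.
have Is := Int_cb_s GA PA; have hd := bm_density (cb_bm cb GA PA).
have InV := Int_norm hd mV IV.
have I1 : Int P (cdens P A) (fun w => (`|V w| - V w) / 2).
  by apply: eq_Int (IntZ 2^-1 (IntB InV IV)) => w; rewrite mulrC.
have I2 : Int P (cdens P A) (fun w => (`|V w| - V w) / 2 + c * s w).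
  by apply: IntD => //; exact: IntZ.
split => //.
  by apply: eq_Int (IntD I1 IV) => w; field.
have -> : Ex P (cdens P A) (fun w => (`|V w| + V w) / 2)
    = Ex P (cdens P A) (fun w => (`|V w| - V w) / 2) + Ex P (cdens P A) V.
  by rewrite -ExD//; apply: eq_Ex => w; field.
rewrite ExD ?ExZ//; last exact: IntZ.
by rewrite lerD2l (le_trans (ler_norm _)).
Qed.

End cond_bernstein_theory.

(** * Exponential tilt by the product of normalised factors *)

Section tilted_martingale.
Context d (T : measurableType d) (R : realType) (P : probability T R).
Variables (n : nat) (F : nat -> set (set T)) (x s m : nat -> T -> R) (e l : R).
Hypothesis l0 : 0 <= l.
Hypothesis cb : forall k, (k < n)%N -> cond_bernstein P (F k) e (x k) (s k).
Hypothesis FT : forall k, (k <= n)%N -> F k `<=` measurable.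
Hypothesis Fincr : forall k, (k < n)%N -> F k `<=` F k.+1.
Hypothesis mx : forall k, (k < n)%N -> measurable_wrt (F k.+1) (x k).
Hypothesis mm : forall k, (k < n)%N -> measurable_wrt (F k) (m k).
Hypothesis m1 : forall k w, (k < n)%N -> 1 <= m k w.
Hypothesis mle : forall k, (k < n)%N -> cond_le P (F k) (fun w => expR (l * x k w)) (m k).
Hypothesis mge : forall k, (k < n)%N -> cond_le P (F k) (m k) (fun w => expR (l * x k w)).
Local Notation "''I' f" := (\int[P]_w (f w)%:E)%E (at level 10, f at level 9).

Definition tilt k w : R := \prod_(i < k) (expR (l * x i w) / m i w).

Lemma tiltS k w : tilt k.+1 w = tilt k w * (expR (l * x k w) / m k w).
Proof. by rewrite /tilt big_ord_recr. Qed.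

Let m0 k w : (k < n)%N -> 0 < m k w.
Proof. by move=> kn; apply: lt_le_trans (m1 w kn). Qed.

Lemma tilt_gt0 k w : (k <= n)%N -> 0 < tilt k w.
Proof.
move=> kn; apply: prodr_gt0 => i _; rewrite divr_gt0 ?expR_gt0//.
by apply: m0; exact: leq_trans (ltn_ord i) kn.
Qed.

Lemma measurable_tilt k : (k <= n)%N -> measurable_wrt (F k) (tilt k).
Proof.
elim: k => [|k IH] kn.
  rewrite /measurable_wrt (_ : tilt 0 = cst 1); first exact: measurable_cst.
  by apply/funext => w; rewrite /tilt big_ord0.
have -> : tilt k.+1 = fun w => tilt k w * (expR (l * x k w) / m k w).
  by apply/funext => w; rewrite tiltS.
have h1 := measurable_wrt_sub (Fincr kn) (IH (ltnW kn)).
have h2 := mx kn; have h3 := measurable_wrt_sub (Fincr kn) (mm kn).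
rewrite /measurable_wrt in h1 h2 h3 *; msolve.
Qed.

Let sG k : (k < n)%N -> sigma_algebra setT (F k). Proof. by move=> /cb[]. Qed.

Let mT k (X : T -> R) : (k <= n)%N -> measurable_wrt (F k) X -> measurable_fun setT X.
Proof. by move=> kn; apply: measurable_wrt_fun; exact: FT. Qed.

(** The factor [expR (l x) / m] has conditional mean one given [F k], so it disappears against an
    [F k]-measurable function. *)
Lemma tower_step k (X : T -> R) : (k < n)%N -> measurable_wrt (F k) X ->
  (forall w, 0 <= X w) -> 'I (fun w => X w * tilt k.+1 w) = 'I (fun w => X w * tilt k w).
Proof.
move=> kn mX X0; have kn' := ltnW kn.
have mxT := mT kn (mx kn); have mmT := mT kn' (mm kn).
have mH : measurable_wrt (F k) (fun w => X w * tilt k w / m k w).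
  have h1 := measurable_tilt kn'; have h2 := mm kn.
  rewrite /measurable_wrt in h1 h2 mX *; msolve.
have := pull_out_eq (sG kn) (FT kn') (X := fun w => expR (l * x k w)) (Y := m k) _ _ _ _ (mle kn) (mge kn) mH.
move=> h; transitivity ('I (fun w => X w * tilt k w / m k w * expR (l * x k w))).
  by apply: eq_integral => w _; rewrite tiltS; congr EFin; ring.
rewrite h.
- by apply: eq_integral => w _; rewrite divfK// gt_eqF// m0.
- by msolve.
- by move=> w; exact: expR_ge0.
- exact: mmT.
- by move=> w; exact: ltW (m0 w kn).
- by move=> w; rewrite divr_ge0 ?mulr_ge0 ?(ltW (m0 w kn))// ltW// tilt_gt0.
Qed.

Lemma tower k j (X : T -> R) : (k <= j <= n)%N -> measurable_wrt (F k) X ->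
  (forall w, 0 <= X w) -> 'I (fun w => X w * tilt j w) = 'I (fun w => X w * tilt k w).
Proof.
move=> + mX X0; elim: j => [|j IH] /andP[kj jn].
  by move: kj; rewrite leqn0 => /eqP ->.
have [->//|kj1] := eqVneq k j.+1.
have {}kj : (k <= j)%N by rewrite -ltnS ltn_neqAle kj1.
rewrite -IH ?kj ?(ltnW jn)//; apply: tower_step => //.
by apply: (measurable_wrt_le Fincr) mX; rewrite kj ltnW.
Qed.

Lemma density_tilt : density P (tilt n).
Proof.
split; first exact: mT (measurable_tilt (leqnn n)).
  by move=> w; exact: ltW (tilt_gt0 w (leqnn n)).
have := tower (k := 0) (j := n) (X := cst 1) (leqnn n) (measurable_cst _) (fun=> ler01).
rewrite (eq_integral (fun w => (tilt n w)%:E)); last by move=> w _ /=; rewrite mul1r.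
move=> ->; rewrite (eq_integral (cst 1%E)); last by move=> w _; rewrite /tilt big_ord0 mulr1.
by rewrite integral_cst// mul1e; exact: probability_setT.
Qed.

(** Passes from a conditional inequality under [P] to one under the tilt. The factors after index
    [k] integrate to one; the earlier ones, together with [1 / m k], are [F k]-measurable and join
    [H] as a test function. *)
Lemma tilt_le k (U V H : T -> R) c : (k < n)%N -> 0 <= c ->
  measurable_wrt (F k.+1) U -> (forall w, 0 <= U w) ->
  measurable_wrt (F k.+1) V -> (forall w, 0 <= V w) ->
  cond_le P (F k) (fun w => expR (l * x k w) * U w) (fun w => expR (l * x k w) * V w + c * s k w) ->
  measurable_wrt (F k) H -> (forall w, 0 <= H w) ->
  ('I (fun w => H w * U w * tilt n w) <= 'I (fun w => (H w * V w + c * (H w * s k w)) * tilt n w))%E.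
Proof.
move=> kn c0 mU U0 mV V0 UV mH H0; have kn' := ltnW kn.
have s0 w : 0 <= s k w by case/andP: (cb_s (cb kn) w).
have msk := cb_ms (cb kn).
have mH1 := measurable_wrt_sub (Fincr kn) mH.
have mZk := measurable_tilt kn'.
have mxT := mT kn (mx kn); have mmT := mT kn' (mm kn).
have mHT := mT kn' mH; have mZT := mT kn' mZk; have mZnT := mT (leqnn n) (measurable_tilt (leqnn n)).
have mUT := mT kn mU; have mVT := mT kn mV; have msT := mT kn' msk.
have mHZ : measurable_wrt (F k) (fun w => H w * tilt k w / m k w).
  have h2 := mm kn; rewrite /measurable_wrt in mH mZk h2 *; msolve.
have HZ0 w : 0 <= H w * tilt k w / m k w.
  by rewrite divr_ge0 ?(ltW (m0 w kn))// mulr_ge0// ltW// tilt_gt0.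
have lift W : measurable_wrt (F k.+1) W -> (forall w, 0 <= W w) ->
    'I (fun w => H w * W w * tilt n w) = 'I (fun w => H w * tilt k w / m k w * (expR (l * x k w) * W w)).
  move=> mW W0; rewrite (tower (k := k.+1)) ?kn ?leqnn//.
  - by apply: eq_integral => w _; rewrite tiltS; congr EFin; ring.
  - by rewrite /measurable_wrt in mH1 mW *; msolve.
  - by move=> w; rewrite mulr_ge0.
have h := pull_out (sG kn) (FT kn') (X := fun w => expR (l * x k w) * U w)
  (Y := fun w => expR (l * x k w) * V w + c * s k w) _ _ _ _ UV mHZ HZ0.
rewrite (lift U)//; apply: le_trans (h _ _ _ _) _.
- by msolve.
- by move=> w; rewrite mulr_ge0 ?expR_ge0.
- by msolve.
- by move=> w; rewrite addr_ge0 ?mulr_ge0 ?expR_ge0.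
have -> : 'I (fun w => (H w * V w + c * (H w * s k w)) * tilt n w)
    = ('I (fun w => H w * V w * tilt n w) + 'I (fun w => c * (H w * s k w) * tilt n w))%E.
  rewrite -ge0_integralD//.
  - by apply: eq_integral => w _; rewrite -EFinD mulrDl.
  - by move=> w _; rewrite lee_fin !mulr_ge0// ltW// tilt_gt0.
  - by apply/measurable_EFinP; msolve.
  - by move=> w _; rewrite lee_fin !mulr_ge0// ltW// tilt_gt0.
  - by apply/measurable_EFinP; msolve.
have -> : 'I (fun w => H w * tilt k w / m k w * (expR (l * x k w) * V w + c * s k w))
    = ('I (fun w => H w * tilt k w / m k w * (expR (l * x k w) * V w))
       + 'I (fun w => H w * tilt k w / m k w * (c * s k w)))%E.
  rewrite -ge0_integralD//.
  - by apply: eq_integral => w _; rewrite -EFinD mulrDr.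
  - by move=> w _; rewrite lee_fin mulr_ge0// mulr_ge0// expR_ge0.
  - by apply/measurable_EFinP; msolve.
  - by move=> w _; rewrite lee_fin mulr_ge0// mulr_ge0.
  - by apply/measurable_EFinP; msolve.
rewrite -lift//; apply: leeD2l.
rewrite (tower (k := k) (X := fun w => c * (H w * s k w))) ?kn' ?leqnn//; last 2 first.
- by rewrite /measurable_wrt in mH msk *; msolve.
- by move=> w; rewrite !mulr_ge0.
apply: ge0_le_integral => //.
- by move=> w _; rewrite lee_fin mulr_ge0// mulr_ge0.
- by apply/measurable_EFinP; msolve.
- by apply/measurable_EFinP; msolve.
(* The factor [1 / m k] left in the error term is at most 1. *)
- move=> w _; rewrite lee_fin.
  have -> : H w * tilt k w / m k w * (c * s k w) = c * (H w * s k w) * tilt k w / m k w by ring.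
  rewrite ler_pdivrMr ?m0//; apply: ler_peMr; last exact: m1.
  by rewrite !mulr_ge0// ltW// tilt_gt0.
Qed.

Local Notation Z := (tilt n).

Let ms k : (k < n)%N -> measurable_fun setT (s k).
Proof. by move=> kn; apply: (mT (ltnW kn)); exact: cb_ms (cb kn). Qed.

Let Int_s k (H : T -> R) : (k < n)%N -> measurable_fun setT H -> Int P Z H ->
  Int P Z (fun w => H w * s k w).
Proof.
move=> kn mH IH.
have InH := Int_norm density_tilt mH IH.
apply: (Int_le density_tilt _ (IntZ (12 * e ^+ 2) InH)).
  by have := ms kn => h; msolve.
move=> w; rewrite normrM mulrC; apply: ler_wpM2r => //.
by have /andP[h1 h2] := cb_s (cb kn) w; rewrite ger0_norm.
Qed.

Let signed_ge0 k (W H : T -> R) c : (k < n)%N -> 0 <= c ->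
  measurable_wrt (F k.+1) W -> measurable_wrt (F k) H -> (forall w, 0 <= H w) ->
  (forall A, F k A -> (0 < P A)%E -> Int P (cdens P A) (fun w => expR (l * x k w) * W w) /\
     `|Ex P (cdens P A) (fun w => expR (l * x k w) * W w)| <= c * Ex P (cdens P A) (s k)) ->
  Int P Z H -> Int P Z (fun w => H w * `|W w|) ->
  Ex P Z (fun w => H w * W w) <= c * Ex P Z (fun w => H w * s k w).
Proof.
move=> kn c0 mW mH H0 hW IH IHW; have kn' := ltnW kn.
have mWT := mT kn mW; have mHT := mT kn' mH; have mxT := mT kn (mx kn).
pose U w := (`|W w| + W w) / 2; pose V w := (`|W w| - W w) / 2.
have U0 w : 0 <= U w.
  by rewrite divr_ge0//; have := ler_norm (- W w); rewrite normrN; lra.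
have V0 w : 0 <= V w.
  by rewrite divr_ge0//; have := ler_norm (W w); lra.
have Ule w : U w <= `|W w| by rewrite /U; have := ler_norm (W w); lra.
have Vle w : V w <= `|W w| by rewrite /V; have := ler_norm (- W w); rewrite normrN; lra.
have mU : measurable_wrt (F k.+1) U by rewrite /measurable_wrt /U in mW *; msolve.
have mV : measurable_wrt (F k.+1) V by rewrite /measurable_wrt /V in mW *; msolve.
have mUT := mT kn mU; have mVT := mT kn mV.
have UV : cond_le P (F k) (fun w => expR (l * x k w) * U w)
    (fun w => expR (l * x k w) * V w + c * s k w).
  have := cond_le_parts (cb kn) (V := fun w => expR (l * x k w) * W w) _ c0 hW.
  have -> : (fun w => expR (l * x k w) * U w)
     = (fun w => (`|expR (l * x k w) * W w| + expR (l * x k w) * W w) / 2).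
    by apply/funext => w; rewrite normrM (ger0_norm (expR_ge0 _)) /U; ring.
  have -> : (fun w => expR (l * x k w) * V w + c * s k w)
     = (fun w => (`|expR (l * x k w) * W w| - expR (l * x k w) * W w) / 2 + c * s k w).
    by apply/funext => w; rewrite normrM (ger0_norm (expR_ge0 _)) /V; ring.
  by apply; msolve.
have Hle := tilt_le kn c0 mU U0 mV V0 UV mH H0.
have IHU : Int P Z (fun w => H w * U w).
  apply: (Int_le density_tilt _ IHW); first by msolve.
  by move=> w; rewrite normrM (ger0_norm (H0 w)) ler_wpM2l// ger0_norm.
have IHV : Int P Z (fun w => H w * V w).
  apply: (Int_le density_tilt _ IHW); first by msolve.
  by move=> w; rewrite normrM (ger0_norm (H0 w)) ler_wpM2l// ger0_norm.
have IHs := Int_s kn mHT IH.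
have -> : Ex P Z (fun w => H w * W w) = Ex P Z (fun w => H w * U w) - Ex P Z (fun w => H w * V w).
  by rewrite -ExB//; apply: eq_Ex => w; rewrite /U /V; field.
rewrite lerBlDl -ExZ// -ExD//; last exact: IntZ.
rewrite /Ex /Rintegral; apply: fine_le Hle.
  by rewrite integrable_fin_num//; exact: IHU.
rewrite integrable_fin_num//.
by apply: IntD => //; exact: IntZ.
Qed.

(** Signs are removed in two stages: [H] is split into its positive and negative parts, and for a
    nonnegative test function the one-sided bound is applied to [W] and to [- W]. *)
Lemma tilt_signed k (W H : T -> R) c : (k < n)%N -> 0 <= c ->
  measurable_wrt (F k.+1) W -> measurable_wrt (F k) H ->
  (forall A, F k A -> (0 < P A)%E -> Int P (cdens P A) (fun w => expR (l * x k w) * W w) /\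
     `|Ex P (cdens P A) (fun w => expR (l * x k w) * W w)| <= c * Ex P (cdens P A) (s k)) ->
  Int P Z H -> Int P Z (fun w => `|H w| * `|W w|) ->
  `|Ex P Z (fun w => H w * W w)| <= c * Ex P Z (fun w => `|H w| * s k w).
Proof.
move=> kn c0 mW mH hW IH IHW; have kn' := ltnW kn.
have mWT := mT kn mW; have mHT := mT kn' mH.
have mnW : measurable_wrt (F k.+1) (fun w => - W w).
  by rewrite /measurable_wrt in mW *; msolve.
have hnW A : F k A -> (0 < P A)%E -> Int P (cdens P A) (fun w => expR (l * x k w) * - W w) /\
     `|Ex P (cdens P A) (fun w => expR (l * x k w) * - W w)| <= c * Ex P (cdens P A) (s k).
  move=> FA PA; have [h1 h2] := hW A FA PA.
  have E w : expR (l * x k w) * - W w = (-1) * (expR (l * x k w) * W w) by ring.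
  split; first by apply: eq_Int (IntZ (-1) h1) => w; rewrite E.
  by rewrite (eq_Ex E) ExZ// normrM normrN1 mul1r.
have pos (H' : T -> R) : measurable_wrt (F k) H' -> (forall w, 0 <= H' w) ->
    (forall w, H' w <= `|H w|) ->
  `|Ex P Z (fun w => H' w * W w)| <= c * Ex P Z (fun w => H' w * s k w) /\
  Int P Z (fun w => H' w * W w) /\ Int P Z (fun w => H' w * s k w).
  move=> mH' H'0 H'H; have mHT' := mT kn' mH'.
  have IH' : Int P Z H'.
    have := Int_norm density_tilt mHT IH.
    by move=> h; apply: (Int_le density_tilt mHT' h) => w; rewrite ger0_norm.
  have IH'W : Int P Z (fun w => H' w * `|W w|).
    apply: (Int_le density_tilt _ IHW); first by msolve.
    by move=> w; rewrite normrM normr_id ger0_norm// ler_wpM2r.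
  have IW : Int P Z (fun w => H' w * W w).
    by apply: (Int_le density_tilt _ IH'W); [msolve|move=> w; rewrite normrM ger0_norm].
  split; last by split => //; exact: Int_s.
  rewrite ler_norml; apply/andP; split; last exact: signed_ge0.
  rewrite lerNl -mulN1r -ExZ//.
  have E w : -1 * (H' w * W w) = H' w * - W w by ring.
  rewrite (eq_Ex E); apply: signed_ge0 => //.
  by apply: eq_Int IH'W => w; rewrite normrN.
have [|||p1 [p2 p3]] := pos (fun w => (`|H w| + H w) / 2).
- by rewrite /measurable_wrt in mH *; msolve.
- by move=> w; rewrite divr_ge0//; have := ler_norm (- H w); rewrite normrN; lra.
- by move=> w; have := ler_norm (H w); lra.
have [|||q1 [q2 q3]] := pos (fun w => (`|H w| - H w) / 2).
- by rewrite /measurable_wrt in mH *; msolve.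
- by move=> w; rewrite divr_ge0//; have := ler_norm (H w); lra.
- by move=> w; have := ler_norm (- H w); rewrite normrN; lra.
have -> : Ex P Z (fun w => H w * W w) = Ex P Z (fun w => (`|H w| + H w) / 2 * W w)
    - Ex P Z (fun w => (`|H w| - H w) / 2 * W w).
  by rewrite -ExB//; apply: eq_Ex => w; field.
have -> : Ex P Z (fun w => `|H w| * s k w) = Ex P Z (fun w => (`|H w| + H w) / 2 * s k w)
    + Ex P Z (fun w => (`|H w| - H w) / 2 * s k w).
  by rewrite -ExD//; apply: eq_Ex => w; field.
by rewrite mulrDr; apply: le_trans (ler_normB _ _) _; exact: lerD.
Qed.

End tilted_martingale.

(** * The tilted martingale *)

Section near_martingale_tilt.
Context d (T : measurableType d) (R : realType) (P : probability T R).
Variables (n : nat) (F : nat -> set (set T)) (x s m : nat -> T -> R) (e l del M : R).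
Hypotheses (e2 : e <= 1 / 2) (del01 : 0 <= del <= 1).
Hypotheses (l0 : 0 <= l) (le8 : l * e <= 1 / 8) (n0 : (0 < n)%N).
Hypothesis cb : forall k, (k < n)%N -> cond_bernstein P (F k) e (x k) (s k).
Hypothesis FT : forall k, (k <= n)%N -> F k `<=` measurable.
Hypothesis Fincr : forall k, (k < n)%N -> F k `<=` F k.+1.
Hypothesis mx : forall k, (k < n)%N -> measurable_wrt (F k.+1) (x k).
Hypothesis mm : forall k, (k < n)%N -> measurable_wrt (F k) (m k).
Hypothesis m1 : forall k w, (k < n)%N -> 1 <= m k w.
Hypothesis mle : forall k, (k < n)%N -> cond_le P (F k) (fun w => expR (l * x k w)) (m k).
Hypothesis mge : forall k, (k < n)%N -> cond_le P (F k) (m k) (fun w => expR (l * x k w)).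
Hypothesis vle : forall w, psum s n w <= 1 + del ^+ 2.
Hypothesis vge : {ae P, forall w, 1 - del ^+ 2 <= psum s n w}.
Hypothesis M0 : 0 < M.
Hypothesis hM : forall x s, 0 <= s <= 12 * e ^+ 2 ->
  let y := x - l * s in let B := s + x ^+ 2 * expR (`|x| / e / 4) in
  [/\ `|expR (l * x) * y - (x + l * x ^+ 2 - l * s)| <= M * (l ^+ 2 * e) * B,
      `|expR (l * x) * (y ^+ 2 - s) - (x ^+ 2 - s)| <= M * (l * e) * B &
      expR (l * x) * (`|y| ^+ 3 * (1 + y ^+ 2 / e ^+ 2) ^+ 2) <= M * e * B].
Let kap := (49 * M ^+ 2 + 7 * M) * (l ^+ 2 * e).
Let mu := 7 * M * (l * e).
Hypotheses (kap1 : kap <= 1) (mu1 : mu <= 1).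
Let eta k w := x k w - l * s k w.
Local Notation Z := (tilt x m l n).

Let e0 : 0 < e. Proof. exact: cb_e (cb n0). Qed.

(** Of the two summands of [kap], [7 M l^2 e] bounds the drift and [49 M^2 l^2 e] ensures
    [mu^2 <= kap e] for [mu = 7 M l e]. *)
Lemma near_martingale_tilt : near_martingale P Z n F eta s e del kap mu (7 * M).
Proof.
have hd : density P Z by exact: density_tilt cb FT Fincr mx mm m1 mle mge.
have meta k : (k < n)%N -> measurable_wrt (F k.+1) (eta k).
  move=> kn; have h1 := mx kn; have h2 := measurable_wrt_sub (Fincr kn) (cb_ms (cb kn)).
  by rewrite /measurable_wrt /eta in h1 h2 *; msolve.
have l2e : 0 <= l ^+ 2 * e by apply: mulr_ge0; [exact: sqr_ge0|exact: ltW].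
have le0 : 0 <= l * e by apply: mulr_ge0 => //; exact: ltW.
have kap0 : 0 <= kap.
  by rewrite /kap mulr_ge0// addr_ge0// mulr_ge0 ?sqr_ge0// ltW.
split => //.
- by rewrite e0.
- by rewrite kap0.
- by rewrite mu1 andbT /mu !mulr_ge0// ltW.
- have -> : mu ^+ 2 = 49 * M ^+ 2 * (l ^+ 2 * e) * e by rewrite /mu; ring.
  by rewrite ler_wpM2r ?(ltW e0)// /kap ler_wpM2r// lerDl mulr_ge0// ltW.
- by move=> k kn; exact: cb_ms (cb kn).
- by move=> k w kn; exact: cb_s (cb kn) w.
move=> k H kn mH IH; have kn' := ltnW kn.
have metaT := measurable_wrt_fun (FT kn) (meta k kn).
have msT := measurable_wrt_fun (FT kn') (cb_ms (cb kn)).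
have mHT := measurable_wrt_fun (FT kn') mH.
have mxT := measurable_wrt_fun (FT kn) (mx kn).
pose q3 w := `|eta k w| ^+ 3 * (1 + eta k w ^+ 2 / e ^+ 2) ^+ 2.
have q30 w : 0 <= q3 w by rewrite /q3 mulr_ge0 ?sqr_ge0// exprn_ge0.
have mq3 : measurable_wrt (F k.+1) q3.
  by have h := meta k kn; rewrite /measurable_wrt /q3 in h *; msolve.
have mq3T := measurable_wrt_fun (FT kn) mq3.
have InH := Int_norm hd mHT IH.
have Ms0 w : 0 <= s k w <= 12 * e ^+ 2 by exact: cb_s (cb kn) w.
have IHs : Int P Z (fun w => `|H w| * s k w).
  apply: (Int_le hd _ (IntZ (12 * e ^+ 2) InH)); first by msolve.
  move=> w; rewrite normrM normr_id mulrC; apply: ler_wpM2r => //.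
  by have /andP[h1 h2] := Ms0 w; rewrite ger0_norm.
have c0 : 0 <= 7 * M * e by rewrite !mulr_ge0// ltW.
have clq : cond_le P (F k) (fun w => expR (l * x k w) * q3 w)
    (fun w => expR (l * x k w) * cst 0 w + 7 * M * e * s k w).
  apply: cond_le_Ex; [exact: FT|by msolve| |by msolve| |].
  - by move=> w; rewrite mulr_ge0 ?expR_ge0.
  - by move=> w; rewrite mulr0 add0r mulr_ge0//; case/andP: (Ms0 w).
  move=> A GA PA; have bm := cb_bm (cb kn) GA PA; have Is := Int_cb_s (cb kn) GA PA.
  have [h1 h2] := tilted_third bm M0 hM.
  split => //; first by apply: eq_Int (IntZ (7 * M * e) Is) => w; rewrite mulr0 add0r.
  apply: (le_trans h2); rewrite -ExZ//; apply: eq_le_of; apply: eq_Ex => w.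
  by rewrite mulr0 add0r.
(* Used with [V = 0]. The right-hand side is finite, which also proves that the third-order weight
   is integrable under the tilt. *)
have Tle := tilt_le cb FT Fincr mx mm m1 mle mge kn c0 mq3 q30 (measurable_cst _) (fun=> lexx 0)
  clq (H := fun w => `|H w|) _ (fun=> normr_ge0 _).
have {}Tle := Tle ltac:(by rewrite /measurable_wrt in mH *; msolve).
have [mZ Z0 _] := hd.
have IcHs : Int P Z (fun w => `|H w| * cst 0 w + 7 * M * e * (`|H w| * s k w)).
  by apply: eq_Int (IntZ (7 * M * e) IHs) => w; rewrite mulr0 add0r.
have Iq : Int P Z (fun w => `|H w| * q3 w).
  apply/integrableP; split.
    by apply/measurable_EFinP; apply: measurable_funM => //; msolve.
  rewrite (eq_integral (fun w => (`|H w| * q3 w * Z w)%:E)); last first.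
    by move=> w _; rewrite gee0_abs// lee_fin mulr_ge0// mulr_ge0.
  apply: le_lt_trans Tle _; have := integrable_fin_num measurableT IcHs.
  by rewrite fin_numE => /andP[_]; rewrite ltey.
have leq w : `|eta k w| <= 1 + q3 w /\ eta k w ^+ 2 <= 1 + q3 w by exact: le_weighted_cube.
have IH1q : Int P Z (fun w => `|H w| + `|H w| * q3 w) by exact: IntD.
split => //.
- apply: le_trans (tilt_signed cb FT Fincr mx mm m1 mle mge kn (c := 7 * M * (l ^+ 2 * e)) _ (meta k kn) mH _ IH _) _.
  + by rewrite !mulr_ge0// ltW.
  + move=> A GA PA; exact: (tilted_mean (cb_bm (cb kn) GA PA) l0 M0 hM).
  + apply: (Int_le hd _ IH1q); first by msolve.
    by move=> w; rewrite normrM !normr_id -{2}[`|H w|]mulr1 -mulrDr ler_wpM2l//; have [] := leq w.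
  + rewrite ler_wpM2r//; first by apply: (Ex_ge0 hd) => w; rewrite mulr_ge0//; case/andP: (Ms0 w).
    by rewrite /kap ler_wpM2r// lerDr mulr_ge0// sqr_ge0.
- apply: (tilt_signed cb FT Fincr mx mm m1 mle mge kn (c := mu) (W := fun w => eta k w ^+ 2 - s k w) _ _ mH _ IH _).
  + by rewrite /mu !mulr_ge0// ltW.
  + have h1 := meta k kn; have h2 := measurable_wrt_sub (Fincr kn) (cb_ms (cb kn)).
    by rewrite /measurable_wrt in h1 h2 *; msolve.
  + move=> A GA PA; exact: (tilted_var (cb_bm (cb kn) GA PA) l0 M0 hM).
  + apply: (Int_le hd _ (IntD IH1q IHs)); first by msolve.
    move=> w; rewrite normrM !normr_id -{2}[`|H w|]mulr1 -!mulrDr ler_wpM2l//.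
    apply: le_trans (ler_normB _ _) _; have [_ h] := leq w; case/andP: (Ms0 w) => s0 _.
    by rewrite !ger0_norm ?sqr_ge0// lerD2r.
- rewrite -ExZ//.
  have -> : Ex P Z (fun w => 7 * M * e * (`|H w| * s k w))
      = Ex P Z (fun w => `|H w| * cst 0 w + 7 * M * e * (`|H w| * s k w)).
    by apply: eq_Ex => w; rewrite mulr0 add0r.
  rewrite /Ex /Rintegral; apply: fine_le Tle.
    by rewrite integrable_fin_num//; exact: Iq.
  by rewrite integrable_fin_num.
Qed.

End near_martingale_tilt.

(** * Conditional Bernstein bounds for the given martingale *)

Section martingale_bernstein.
Context d (T : measurableType d) (R : realType) (P : probability T R).
Variables (n : nat) (xi : nat -> T -> R) (F : nat -> set (set T)) (eps delta : R).
Hypotheses (md : martingale_differences P n xi F) (bc : bernstein_condition P n xi F eps)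
  (qc : quad_char_condition P n xi F delta).

Let e0 : 0 < eps. Proof. by case: bc => /andP[]. Qed.
Let sG k : (k < n)%N -> sigma_algebra setT (F k).
Proof. by move=> kn; apply: (md_sigma_algebra md); exact: ltnW. Qed.
Let FT k : (k <= n)%N -> F k `<=` measurable. Proof. exact: (md_sub md). Qed.
Let mxi k : (k <= n)%N -> measurable_fun setT (xi k).
Proof. by move=> kn; apply: measurable_wrt_fun (md_adapted md kn); exact: FT. Qed.
(** Indices are shifted by one: step [k] leads from [F k] to [F k.+1] and carries the difference
    [xi k.+1]. *)
Let cm k j := cond_moment P xi F k.+1 j.
Let cmP k j : (k < n)%N -> is_condexp P (F k) (fun w => xi k.+1 w ^+ j) (cm k j).
Proof.
move=> kn; apply: (condexpP (sG kn)); first by apply: FT; exact: ltnW.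
exact: (md_moments md).
Qed.

Let int_ae (A : set T) (X Y : T -> R) : measurable A ->
  measurable_fun setT X -> measurable_fun setT Y ->
  {ae P, forall w, X w = Y w} ->
  (\int[P]_(w in A) (X w)%:E = \int[P]_(w in A) (Y w)%:E)%E.
Proof.
move=> mA mX mY XY; apply: ae_eq_integral => //.
- by apply/measurable_EFinP; exact: measurable_funTS.
- by apply/measurable_EFinP; exact: measurable_funTS.
- by apply: filterS XY => w -> _.
Qed.

(** Bernstein's condition at [k = 4] bounds the fourth moment by [t = 12 eps^2] times the second,
    with [12 = 4! / 2]. The mean of [(xi^2 - t)^2 >= 0] then forces the second moment below [t]. *)
Let cm4_le k : (k < n)%N -> {ae P, forall w, cm k 2 w <= 12 * eps ^+ 2}.
Proof.
move=> kn; have [m2 i2 E2] := cmP 2 kn; have [m4 i4 E4] := cmP 4 kn.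
apply: (cond_le_ae (sG kn) (FT (ltnW kn)) (Y := cst (12 * eps ^+ 2))) => //.
- exact: measurable_cst.
- apply: (@integrable_bounded _ _ _ _ _ (12 * eps ^+ 2)) => [|w /=]; first exact: measurable_cst.
  by rewrite ger0_norm// mulr_ge0// sqr_ge0.
move=> A FA; have mA := FT (ltnW kn) FA; rewrite E2//; move: A FA mA.
have H : cond_le P (F k) (fun w => xi k.+1 w ^+ 2) (cst (12 * eps ^+ 2)).
  have mxk := mxi kn.
  apply: cond_le_Ex; [exact: FT (ltnW kn)|by msolve|by move=> w; exact: sqr_ge0|
    exact: measurable_cst|by move=> w; rewrite mulr_ge0// sqr_ge0|].
  move=> A FA PA; have mA := FT (ltnW kn) FA; have hd := density_cdens mA PA.
  have I j : Int P (cdens P A) (fun w => xi k.+1 w ^+ j).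
    by apply: Int_cdens => //; exact: (md_moments md).
  split => //; first exact: Int_cst.
  rewrite (Ex_cst hd).
  pose t := 12 * eps ^+ 2; have t0 : 0 < t by rewrite mulr_gt0// exprn_gt0.
  have h4 : Ex P (cdens P A) (fun w => xi k.+1 w ^+ 4) <= t * Ex P (cdens P A) (fun w => xi k.+1 w ^+ 2).
    have Ecm j : Ex P (cdens P A) (fun w => xi k.+1 w ^+ j) = Ex P (cdens P A) (cm k j).
      by have [mj ij Ej] := cmP j kn; rewrite !Ex_cdens ?Ej//; exact: (md_moments md).
    rewrite !Ecm.
    rewrite -ExZ; last exact: Int_cdens.
    apply: (Ex_le_ae hd); [exact: Int_cdens|by apply: IntZ; exact: Int_cdens|].
    have [_ /(_ k.+1 4%N)] := bc; rewrite ltnS kn => /(_ isT isT).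
    apply: filterS => w h; apply: le_trans (ler_norm _) _; apply: (le_trans h).
    by apply: eq_le_of; rewrite /t /cm; have -> : (4`! = 24)%N by []; field.
  have h2 : 2 * t * Ex P (cdens P A) (fun w => xi k.+1 w ^+ 2) - t ^+ 2
      <= Ex P (cdens P A) (fun w => xi k.+1 w ^+ 4).
    rewrite -ExZ// -[X in _ - X](Ex_cst hd) -ExB//; [|exact: IntZ|exact: Int_cst].
    apply: (Ex_le hd) => //; first by apply: IntB; [exact: IntZ|exact: Int_cst].
    move=> w /=; have := sqr_ge0 (xi k.+1 w ^+ 2 - t); lra.
  rewrite -(ler_pM2l t0) -/t; lra.
by move=> A FA _; exact: H.
Qed.

Let sig k w := Num.max 0 (Num.min (cm k 2 w) (12 * eps ^+ 2)).
(** Capping the cumulated variance keeps every increment between 0 and the corresponding [sig], and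
    makes the bound on the total hold everywhere. *)
Let v k w := Num.min (psum sig k w) (1 + delta ^+ 2).

(* Clipping makes the bounds on the conditional variances, which are only almost
   sure, hold everywhere; [clipped_var] is still a version of them. *)
Definition clipped_var k w := v k.+1 w - v k w.

Let s := clipped_var.

Lemma psum_clipped_var k w : psum s k w = v k w.
Proof.
elim: k => [|k IH]; last by rewrite psumS IH /s /clipped_var addrC subrK.
by rewrite psum0 /v psum0; apply/esym/min_idPl; rewrite addr_ge0// sqr_ge0.
Qed.

Lemma psum_clipped_var_le w : psum s n w <= 1 + delta ^+ 2.
Proof. by rewrite psum_clipped_var ge_min lexx orbT. Qed.

Let sig_bounds k w : 0 <= sig k w <= 12 * eps ^+ 2.
Proof.
by rewrite /sig le_max lexx /= ge_max ge_min lexx orbT andbT mulr_ge0// sqr_ge0.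
Qed.

Lemma clipped_var_bounds k w : 0 <= s k w <= 12 * eps ^+ 2.
Proof.
have /andP[h1 h2] := sig_bounds k w; rewrite /s /clipped_var /v psumS.
set p := psum sig k w; set b := 1 + delta ^+ 2.
have [pb|pb] := leP p b.
  by have [qb|qb] := leP (p + sig k w) b; apply/andP; split; lra.
by have [qb|qb] := leP (p + sig k w) b; apply/andP; split; lra.
Qed.

Lemma measurable_clipped_var k : (k < n)%N -> measurable_wrt (F k) (s k).
Proof.
move=> kn.
have msig i : (i < n)%N -> measurable_wrt (F i) (sig i).
  move=> iN; have [m2 _ _] := cmP 2 iN.
  by apply: measurable_maxr; [exact: measurable_cst|apply: measurable_minr => //; exact: measurable_cst].
have mps i : (i <= k.+1)%N -> measurable_wrt (F k) (psum sig i).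
  elim: i => [|i IH] ik.
    by rewrite psum0E; exact: measurable_cst.
  rewrite psumSE; apply: measurable_funD; first exact: (IH (ltnW ik)).
  apply: (@measurable_wrt_le _ T R n F (md_filtration md) i k); first by rewrite -ltnS ik ltnW.
  by apply: msig; exact: leq_ltn_trans kn.
by apply: measurable_funB; apply: measurable_minr; try exact: measurable_cst; apply: mps.
Qed.

(** Almost surely no cap is active: each conditional variance lies in [[0, 12 eps^2]], and the
    partial sums stay below [quad_char], itself at most [1 + delta^2]. *)
Let clipped_varE : {ae P, forall w, (forall k, (k < n)%N -> s k w = cm k 2 w) /\
  psum s n w = quad_char P n xi F w}.
Proof.
have cm2_ge0 k : (k < n)%N -> {ae P, forall w, 0 <= cm k 2 w}.
  move=> kn; have [_ /(_ k.+1 2%N)] := bc; rewrite ltnS kn => /(_ isT isT).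
  apply: filterS => w; rewrite subnn expr0 mulr1 (_ : 1 / 2 * (2`!)%:R = 1 :> R); last first.
    by rewrite (_ : 2`! = 2)%N//; field.
  by rewrite mul1r => h; exact: le_trans h.
have sigE : {ae P, forall w, forall k, (k < n)%N -> sig k w = cm k 2 w}.
  apply/ae_foralln => k; have [kn|kn] := boolP (k < n)%N; last by apply: aeW => w.
  apply: filterS2 (cm2_ge0 k kn) (cm4_le kn) => w h1 h2 _.
  by rewrite /sig (min_idPl h2) (max_idPr h1).
have [_ qb] := qc; apply: filterS2 sigE qb => w sE; rewrite ler_norml => /andP[_ qw].
have qE : psum sig n w = quad_char P n xi F w.
  rewrite /quad_char big_add1 big_mkord /psum; apply: eq_bigr => i _; exact: sE.
have vE k : (k <= n)%N -> v k w = psum sig k w.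
  move=> kn; apply/min_idPl; apply: le_trans (_ : psum sig n w <= _); last by rewrite qE; lra.
  by apply: (@v_incr _ _ _ n sig eps (fun i w' _ => sig_bounds i w')); rewrite kn leqnn.
split; last by rewrite psum_clipped_var vE.
by move=> k kn; rewrite /s /clipped_var !vE ?(ltnW kn)// psumS addrC addKr sE.
Qed.

Lemma psum_clipped_var_ge : {ae P, forall w, 1 - delta ^+ 2 <= psum s n w}.
Proof.
have [_ qb] := qc; apply: filterS2 clipped_varE qb => w [_ ->].
by rewrite ler_norml => /andP[h _]; lra.
Qed.

Lemma cb_martingale k : (k < n)%N -> cond_bernstein P (F k) eps (xi k.+1) (s k).
Proof.
move=> kn; have FkT := FT (ltnW kn); have mk := measurable_clipped_var kn.
have mkT := measurable_wrt_fun FkT mk.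
split => //; [exact: sG|exact: mxi|exact: clipped_var_bounds|].
move=> A FA PA; have mA := FkT _ FA.
have hd := density_cdens mA PA.
have I j : P.-integrable setT (EFin \o (fun w => xi k.+1 w ^+ j)) by exact: (md_moments md).
have Ecm j : Ex P (cdens P A) (fun w => xi k.+1 w ^+ j) = Ex P (cdens P A) (cm k j).
  by have [mj ij Ej] := cmP j kn; rewrite !Ex_cdens ?Ej.
have [m2 i2 E2] := cmP 2 kn; have m2T := measurable_wrt_fun FkT m2.
have is_ : P.-integrable setT (EFin \o s k).
  apply: (@integrable_bounded _ _ _ _ _ (12 * eps ^+ 2)) => // w.
  by have /andP[h1 h2] := clipped_var_bounds k w; rewrite ger0_norm.
have Es : Ex P (cdens P A) (s k) = Ex P (cdens P A) (cm k 2).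
  rewrite !Ex_cdens// (int_ae mA mkT m2T)//.
  by apply: filterS clipped_varE => w [h _]; exact: h.
split => //.
- exact: mxi.
- exact: clipped_var_bounds.
- by move=> j; exact: Int_cdens.
- have ix : P.-integrable setT (EFin \o xi k.+1).
    by have := I 1%N; congr (_.-integrable _ _); apply/funext => w /=; rewrite expr1.
  have [m0 i0 E0] := condexpP (sG kn) FkT ix.
  rewrite Ex_cdens// -E0// (int_ae (Y := cst 0) mA); [|exact: measurable_wrt_fun m0|exact: measurable_cst|].
    by rewrite (eq_integral (cst 0%E))// integral0 mul0r.
  exact: (md_condexp0 md (i := k.+1) kn).
- by rewrite Ecm Es.
- move=> j; rewrite Ecm Es -ExZ; last exact: Int_cdens.
  have [mj ij Ej] := cmP j.+2 kn.
  apply: (Ex_le_ae hd); [exact: Int_cdens|by apply: IntZ; exact: Int_cdens|].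
  have [_ /(_ k.+1 j.+2)] := bc; rewrite ltnS kn => /(_ isT isT).
  apply: filterS => w h; apply: le_trans (ler_norm _) _; apply: (le_trans h).
  by rewrite subn2.
Qed.

End martingale_bernstein.

(** * The saddle point *)

Section levels.
Context {R : realType}.
Implicit Types (y l z t : R) (N : nat).

Lemma count_le_ub y N : 0 <= y -> \sum_(i < N) ((i.+1%:R <= y)%R%:R : R) <= y.
Proof.
elim: N => [|N IH] y0; first by rewrite big_ord0.
rewrite big_ord_recr /=; have [h|h] := leP N.+1%:R y; last by rewrite addr0 IH.
apply: le_trans h; rewrite -natr1 lerD2r.
apply: le_trans (ler_sum (G := fun=> 1) _ _) _; last by rewrite sumr_const card_ord.
by move=> i _; case: (i.+1%:R <= y); rewrite ?lexx ?ler01.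
Qed.

Lemma count_le_lb y N : y < N.+1%:R -> y - 1 <= \sum_(i < N) ((i.+1%:R <= y)%R%:R : R).
Proof.
elim: N => [|N IH] yN; first by rewrite big_ord0; lra.
rewrite big_ord_recr /=; have [h|h] := leP N.+1%:R y; last by rewrite addr0 IH.
rewrite (eq_bigr (fun=> 1)).
  rewrite sumr_const card_ord; move: yN; rewrite -[N.+2%:R]natr1 -[N.+1%:R]natr1.
  by rewrite -[1 *+ N]/(N%:R) -[true%:R]/(1 : R); lra.
move=> i _; rewrite (le_trans _ h)// ler_nat ltnS.
exact/ltnW.
Qed.

(** The point where [expR (- (l * z))] takes the value [(i + 1) / (N + 1)]; these points cut the
    exponential into horizontal layers. *)
Definition level l N (i : nat) : R := - ln (i.+1%:R / N.+1%:R) / l.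

Lemma level_ge0 l N i : 0 < l -> (i < N)%N -> 0 <= level l N i.
Proof.
move=> l0 iN; rewrite /level divr_ge0 ?(ltW l0)// oppr_ge0 ln_le0//.
by rewrite ler_pdivrMr// mul1r ler_nat ltnS ltnW.
Qed.

Lemma le_level l N i z : 0 < l ->
  (z <= level l N i) = (i.+1%:R <= N.+1%:R * expR (- (l * z))).
Proof.
move=> l0; rewrite /level ler_pdivlMr// lerNr -ler_expR lnK ?posrE ?divr_gt0//.
by rewrite ler_pdivrMr// (mulrC z) (mulrC N.+1%:R).
Qed.

(** A discrete layer-cake formula: at most [(N + 1) expR (- (l * z))] of the levels lie above [z],
    and integrating this count against the density bounds the sum by the integral for [mills l]. *)
Lemma mills_levels l N : 0 < l ->
  N.+1%:R^-1 * \sum_(i < N) (Phi (level l N i) - Phi 0) <= mills l.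
Proof.
move=> l0; pose c := N.+1%:R^-1 : R.
have c0 : 0 <= c by rewrite invr_ge0.
rewrite -lee_fin -integral_exp_gauss mulr_sumr -sumEFin.
pose D := `[0%R, +oo[%classic : set R.
pose f (i : nat) z : R := c * (gauss z * \1_(`]0, level l N i]) z).
have f0 i z : 0 <= f i z by rewrite mulr_ge0// mulr_ge0 ?(ltW (gauss_gt0 z)).
have mf i : measurable_fun D (EFin \o f i).
  apply/measurable_EFinP; apply: measurable_funTS; apply: measurable_funM; first exact: measurable_cst.
  apply: measurable_funM; first by apply: measurable_fun_gauss; exact: measurable_id.
  exact: measurable_indic.
have -> : (\sum_(i < N) (c * (Phi (level l N i) - Phi 0))%:E =
    \sum_(i < N) \int[lebesgue_measure]_(z in D) (f i z)%:E)%E.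
  apply: eq_bigr => i _; rewrite EFinM -normal_prob_oc ?level_ge0//.
  have DI : D `&` `]0, level l N i]%classic = `]0, level l N i]%classic.
    by apply/setIidr => z; rewrite /D /= !in_itv/= andbT => /andP[/ltW].
  rewrite -[in LHS]DI integral_mkcondr -ge0_integralZl//.
  - by apply: eq_integral => z _; rewrite epatch_indic /= -!EFinM.
  - exact: measurable_itv.
  - rewrite epatch_indic; apply/measurable_EFinP; apply: measurable_funTS.
    apply: measurable_funM; first by apply: measurable_fun_gauss; exact: measurable_id.
    exact: measurable_indic.
  - by move=> z _; rewrite epatch_indic /= -EFinM lee_fin mulr_ge0 ?(ltW (gauss_gt0 z)).
rewrite -ge0_integral_sum//; [|exact: measurable_itv|by move=> i; exact: mf|
  by move=> i z _; rewrite lee_fin].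
apply: ge0_le_integral => //.
- exact: measurable_itv.
- by move=> z _; apply: sume_ge0 => i _; rewrite lee_fin.
- by apply: emeasurable_sum => i; exact: mf.
- apply/measurable_EFinP; apply: measurable_funTS; apply: measurable_funM.
    by apply: measurable_fun_exp; apply: measurable_funN; apply: measurable_funM;
      [exact: measurable_cst|exact: measurable_id].
  by apply: measurable_fun_gauss; exact: measurable_id.
move=> z _; rewrite sumEFin lee_fin -mulr_sumr -mulr_sumr (mulrC (gauss z)) mulrA.
apply: ler_wpM2r; first exact: ltW (gauss_gt0 z).
rewrite ler_pdivrMl//.
apply: le_trans (count_le_ub N (_ : 0 <= N.+1%:R * expR (- (l * z)))); last by rewrite mulr_ge0 ?expR_ge0.
apply: ler_sum => i _; rewrite -le_level// indicE.
case: (boolP (z \in _)) => //=; rewrite inE /= in_itv /= => /andP[_ ->].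
by [].
Qed.

End levels.

Section exponential_tail.
Context d (T : measurableType d) (R : realType) (P : probability T R).
Variables (Z U Y : T -> R) (l rho D : R).
Hypothesis hZ : density P Z.
Hypotheses (mU : measurable_fun setT U) (mY : measurable_fun setT Y).
Hypotheses (l0 : 0 <= l) (rho0 : 0 <= rho).
Hypothesis YU : {ae P, forall w, `|Y w - U w| <= rho}.
Hypothesis KD : forall y, `|Ex P Z (ind_le U y) - Phi y| <= D.

Let J t w := ind_le Y t w - ind_le Y 0 w.

Let IJ t : Int P Z (J t).
Proof. by apply: IntB; exact: Int_ind_le. Qed.

Let EJ t : 0 <= t -> Ex P Z (J t) <= Phi t - Phi 0 + 2 * (rho + D).
Proof.
move=> t0; have r0 := rho0.
have h : Ex P Z (J t) <= Ex P Z (fun w => ind_le U (t + rho) w - ind_le U (- rho) w).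
  apply: (Ex_le_ae hZ) => //; first by apply: IntB; exact: Int_ind_le.
  apply: filterS YU => w; rewrite ler_norml => /andP[h1 h2].
  rewrite /J /ind_le.
  have [a|a] := leP (Y w) t; have [b|b] := leP (Y w) 0.
  - have [a'|a'] := leP (U w) (t + rho); last by lra.
    by have [b'|b'] := leP (U w) (- rho) => /=; lra.
  - have [a'|a'] := leP (U w) (t + rho); last by lra.
    by have [b'|b'] := leP (U w) (- rho) => /=; lra.
  - lra.
  - have [b'|b'] := leP (U w) (- rho).
      have [a'|a'] := leP (U w) (t + rho) => /=; lra.
    by have [a'|a'] := leP (U w) (t + rho) => /=; lra.
apply: (le_trans h); rewrite ExB; [|exact: Int_ind_le|exact: Int_ind_le].
have := KD (t + rho); rewrite ler_norml => /andP[_ k1].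
have := KD (- rho); rewrite ler_norml => /andP[k2 _].
have /andP[_ p1] : 0 <= Phi (t + rho) - Phi t <= t + rho - t by apply: PhiB; lra.
have /andP[_ p2] : 0 <= Phi 0 - Phi (- rho) <= 0 - - rho by apply: PhiB; lra.
lra.
Qed.

(** Up to [1 / (N + 1)] the integrand is an average of indicators of [0 < Y <= level]. Each has its
    Gaussian probability up to [2 (rho + D)], an error at both end points, and averaging does not
    increase it; then [N] tends to infinity. *)
Lemma exponential_tail_le :
  Ex P Z (fun w => expR (- (l * Y w)) * (1 - ind_le Y 0 w)) <= mills l + 2 * (rho + D).
Proof.
have r0 := rho0; pose g w := expR (- (l * Y w)) * (1 - ind_le Y 0 w).
have D0 : 0 <= D by apply: le_trans (KD 0).
have g01 w : 0 <= g w <= 1.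
  rewrite /g /ind_le; have [b|b] := leP (Y w) 0; first by rewrite subrr mulr0 lexx ler01.
  rewrite subr0 mulr1 expR_ge0 -[leRHS]expR0 ler_expR oppr_le0 mulr_ge0//.
  exact: ltW.
have mg : measurable_fun setT g.
  by apply: measurable_funM; [msolve|apply: measurable_funB; [exact: measurable_cst|exact: measurable_ind_le]].
have Ig : Int P Z g.
  by apply: (Int_bounded hZ (M := 1) mg) => w; have /andP[h1 h2] := g01 w; rewrite ger0_norm.
(* The levels are defined by division by [l]; for [l = 0] the integrand is the plain indicator of
   [Y > 0]. *)
have [l00|lp] : l = 0 \/ 0 < l by move: l0; rewrite le_eqVlt => /orP[/eqP <-|]; [left|right].
  have h : Ex P Z g <= Ex P Z (fun w => cst 1 w - ind_le U (- rho) w).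
    apply: (Ex_le_ae hZ) => //; first by apply: IntB; [exact: Int_cst|exact: Int_ind_le].
    apply: filterS YU => w; rewrite ler_norml => /andP[h1 h2].
    rewrite /g l00 mul0r oppr0 expR0 mul1r /ind_le /=.
    have [b|b] := leP (Y w) 0; have [b'|b'] := leP (U w) (- rho) => /=; lra.
  apply: (le_trans h); rewrite ExB; [|exact: Int_cst|exact: Int_ind_le].
  rewrite (Ex_cst hZ) l00 /mills expr0n /= mul0r expR0 mul1r.
  have := KD (- rho); rewrite ler_norml => /andP[k2 _].
  have /andP[_ p2] : 0 <= Phi 0 - Phi (- rho) <= 0 - - rho by apply: PhiB; lra.
  lra.
have step N : Ex P Z g <= N.+1%:R^-1 + (mills l + 2 * (rho + D)).
  pose c := N.+1%:R^-1 : R; have c0 : 0 < c by rewrite invr_gt0.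
  have IS : Int P Z (fun w => \sum_(i < N) J (level l N i) w) by apply: Int_sum.
  have h : Ex P Z g <= Ex P Z (fun w => c * (cst 1 w + \sum_(i < N) J (level l N i) w)).
    apply: (Ex_le hZ) => //; first by apply: IntZ; apply: IntD => //; exact: Int_cst.
    move=> w; rewrite ler_pdivlMl//=.
    have [b|b] := leP (Y w) 0.
      rewrite /g /ind_le b subrr !mulr0 addr_ge0// sumr_ge0// => i _.
      by rewrite /J /ind_le b (le_trans b) ?level_ge0// subrr.
    have gE : g w = expR (- (l * Y w)) by rewrite /g /ind_le leNgt b /= subr0 mulr1.
    have g1 : g w < 1 by rewrite gE -[ltRHS]expR0 ltr_expR oppr_lt0 mulr_gt0.
    have := @count_le_lb R (N.+1%:R * g w) N; rewrite gtr_pMr// => /(_ g1).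
    rewrite lerBlDl; move/le_trans; apply; rewrite lerD2l; apply: ler_sum => i _.
    by rewrite gE -le_level// /J /ind_le (leNgt (Y w) 0) b /= subr0.
  apply: (le_trans h); rewrite ExZ; last by apply: IntD => //; exact: Int_cst.
  rewrite ExD//; last exact: Int_cst.
  rewrite (Ex_cst hZ) Ex_sum// mulrDr mulr1 lerD2l.
  apply: le_trans (_ : c * \sum_(i < N) (Phi (level l N i) - Phi 0 + 2 * (rho + D)) <= _).
    by rewrite ler_wpM2l ?(ltW c0)//; apply: ler_sum => i _; apply: EJ; exact: level_ge0.
  rewrite big_split /= mulrDr lerD//; first exact: mills_levels.
  rewrite sumr_const card_ord -[X in c * X]mulr_natl mulrA ler_piMl//; first by rewrite mulr_ge0// addr_ge0.
  by rewrite ler_pdivrMl// mulr1 ler_nat.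
apply/ler_addgt0Pr => z z0.
have [N /= hN] : exists N : nat, N.+1%:R^-1 <= z.
  exists (Num.truncn z^-1); rewrite invf_ple ?posrE//; apply: ltW.
  have zi : 0 <= z^-1 by rewrite invr_ge0 ltW.
  by have /andP[_] := truncn_itv zi.
by apply: (le_trans (step N)); rewrite addrC lerD2l.
Qed.

End exponential_tail.

Section saddle_point.
Context {R : realType}.
Implicit Types eps delta x : R.

(** The witness is [q = sqrt (1 + 2 x eps / (1 + delta^2))]. The equation for [x] is the
    stationarity condition: its right-hand side is the derivative at [lambda] of
    [(1 + delta^2) l^2 / (2 (1 - l eps))]. *)
Lemma saddle_point eps delta x : 0 < eps -> 0 <= x -> exists q : R,
  [/\ 1 <= q, lambda eps delta x * eps * q = q - 1,
      x = (1 + delta ^+ 2) * lambda eps delta x * q * (q + 1) / 2,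
      xhat eps delta x = Num.sqrt (1 + delta ^+ 2) * lambda eps delta x * q &
      0 <= lambda eps delta x <= x].
Proof.
move=> e0 x0; rewrite /lambda /xhat; set b := 1 + delta ^+ 2.
have b1 : 1 <= b by rewrite /b lerDl sqr_ge0.
have b0 : 0 < b by lra.
pose a := 2 * x * eps / b; rewrite -/a.
have a0 : 0 <= a by rewrite divr_ge0 ?(ltW b0)// !mulr_ge0// ltW.
pose q := Num.sqrt (1 + a); rewrite -/q.
have q2 : q ^+ 2 = 1 + a by rewrite sqr_sqrtr// addr_ge0.
have q1 : 1 <= q.
  by rewrite -(@ler_pXn2r _ 2) ?nnegrE ?sqrtr_ge0// q2; lra.
have rb : 0 < Num.sqrt b by rewrite sqrtr_gt0.
have rb2 : Num.sqrt b ^+ 2 = b by rewrite sqr_sqrtr// ltW.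
have q0 : 0 < q by lra.
have [r [r0 rE bE]] : exists r : R, [/\ 0 < r, Num.sqrt b = r & b = r ^+ 2].
  by exists (Num.sqrt b).
exists q; rewrite -q2.
have xE : x = b * (q ^+ 2 - 1) / (2 * eps).
  by rewrite q2 /a; field; rewrite !gt_eqF.
have lE : 2 * x / b / (q ^+ 2 + q) = (q - 1) / (eps * q).
  rewrite xE; field; rewrite !gt_eqF//; first by lra.
rewrite lE; split => //.
- by field; rewrite !gt_eqF//; lra.
- by rewrite [LHS]xE; field; rewrite !gt_eqF//; lra.
- by rewrite rE xE bE; field; rewrite !gt_eqF//; lra.
- rewrite divr_ge0 ?subr_ge0//=; last by rewrite mulr_ge0 ?(ltW e0)//; lra.
  rewrite -lE ler_pdivrMr; last by rewrite addr_gt0// ?exprn_gt0//; lra.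
  rewrite ler_pdivrMr//.
  have q21 : 1 <= q ^+ 2 by rewrite exprn_ege1.
  have : 2 <= (q ^+ 2 + q) * b by rewrite -[2]mulr1; apply: ler_pM => //; lra.
  by move=> /(ler_wpM2l x0); lra.
Qed.

Lemma lambda_lt eps delta x : 0 < eps -> 0 <= x -> 0 <= lambda eps delta x < eps^-1.
Proof.
move=> e0 x0; have [q [q1 lq _ _ /andP[-> _]]] := saddle_point delta e0 x0.
rewrite /= -[ltRHS]div1r ltr_pdivlMr//.
have q0 : 0 < q by lra.
by rewrite -(ltr_pM2r q0) lq; lra.
Qed.

(** With [b = 1 + delta^2] the left-hand side is [- b l^2 q (q + 1) / 2 + b l^2 q / 2 = - b l^2 q^2
    / 2]. *)
Lemma saddle_exponent eps delta x (l := lambda eps delta x) : 0 < eps -> 0 <= x ->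
  - (l * x) + l ^+ 2 / (2 * (1 - l * eps)) * (1 + delta ^+ 2)
    = - (xhat eps delta x ^+ 2 / 2).
Proof.
move=> e0 x0; have [q [q1 lq xE hE _]] := saddle_point delta e0 x0.
rewrite hE; rewrite -/l in lq xE hE *; clearbody l.
have q0 : 0 < q by lra.
have -> : 1 - l * eps = q^-1.
  by apply: (mulIf (lt0r_neq0 q0)); rewrite mulVf ?gt_eqF// mulrBl mul1r lq; ring.
rewrite !exprMn sqr_sqrtr; last by rewrite addr_ge0// sqr_ge0.
by rewrite xE; field; rewrite gt_eqF.
Qed.

(** [l eps <= 1 / 8] gives [q <= 8 / 7] and [q - 1 <= (8 / 7) l eps], so [x] and [xhat] are both [l]
    times [1 + O(l eps + delta^2)]. *)
Lemma saddle_close eps delta x (l := lambda eps delta x) : 0 < eps -> 0 <= delta <= 1 -> 0 <= x ->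
  l * eps <= 1 / 8 ->
  [/\ l <= xhat eps delta x, xhat eps delta x - l <= 2 * (l ^+ 2 * eps + l * delta ^+ 2) &
      `|x - l| <= 2 * (l ^+ 2 * eps + l * delta ^+ 2)].
Proof.
move=> e0 /andP[d0 d1] x0 le8.
have [q [q1 lq xE hE /andP[l0 _]]] := saddle_point delta e0 x0.
rewrite hE; rewrite -/l in lq xE hE l0 *; clearbody l.
have d2 : 0 <= delta ^+ 2 <= 1 by rewrite sqr_ge0 expr_le1.
set y := delta ^+ 2 in xE hE d2 *; case/andP: d2 => y0 y1.
have q87 : q <= 8 / 7.
  have : l * eps * q <= 1 / 8 * q by rewrite ler_wpM2r//; lra.
  lra.
have rb1 : 1 <= Num.sqrt (1 + y) by rewrite -[X in X <= _]sqrtr1 ler_wsqrtr//; lra.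
have rbb : Num.sqrt (1 + y) <= 1 + y / 2.
  rewrite -[leRHS]ger0_norm; last by lra.
  rewrite -sqrtr_sqr ler_wsqrtr//; have : 0 <= y ^+ 2 by exact: sqr_ge0.
  lra.
have le0 : 0 <= l * eps by rewrite mulr_ge0// ltW.
have qe : q - 1 <= 8 / 7 * (l * eps) by rewrite -lq; have := ler_wpM2l le0 q87; lra.
have yq : y * q <= y * (8 / 7) by rewrite ler_wpM2l.
have rq1 : 1 <= Num.sqrt (1 + y) * q by rewrite -[leLHS]mulr1; apply: ler_pM; lra.
have rq2 : Num.sqrt (1 + y) * q <= 1 + 8 / 7 * (l * eps) + y * (4 / 7).
  by apply: le_trans (ler_wpM2r _ rbb) _; lra.
have qq1 : 1 <= q * (q + 1) / 2 by have : 0 <= (q - 1) ^+ 2 := sqr_ge0 _; lra.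
have qq2 : q * (q + 1) / 2 <= 1 + 2 * (l * eps).
  have : (q - 1) * (q + 2) <= 8 / 7 * (l * eps) * (22 / 7) by apply: ler_pM; lra.
  lra.
have qqy : y * (q * (q + 1) / 2) <= y * 2 by rewrite ler_wpM2l//; lra.
have F z : z <= 2 * (l * eps + y) -> l * z <= 2 * (l ^+ 2 * eps + l * y).
  by move=> /(ler_wpM2l l0); lra.
have xlE : x - l = l * ((1 + y) * (q * (q + 1) / 2) - 1) by rewrite {1}xE; ring.
have hlE : Num.sqrt (1 + y) * l * q - l = l * (Num.sqrt (1 + y) * q - 1) by ring.
have yqq : 0 <= y * (q * (q + 1) / 2) by rewrite mulr_ge0//; lra.
split.
- by rewrite -subr_ge0 hlE mulr_ge0// subr_ge0.
- by rewrite hlE; apply: F; lra.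
- rewrite xlE ger0_norm; first by apply: F; lra.
  by rewrite mulr_ge0//; lra.
Qed.

End saddle_point.

Section tilted_tail.
Context d (T : measurableType d) (R : realType) (P : probability T R).
Variables (n : nat) (x s m : nat -> T -> R) (l c b : R).
Hypothesis c0 : 0 <= c.
Hypothesis m1 : forall k w, (k < n)%N -> 1 <= m k w <= 1 + c * s k w.
Hypothesis sb : forall w, psum s n w <= b.

(** Factor by factor, from [m <= 1 + c s <= expR (c s)]. *)
Lemma tilt_ge k w : (k <= n)%N ->
  expR (l * psum x k w - c * psum s k w) <= tilt x m l k w.
Proof.
elim: k => [|k IH] kn; first by rewrite !psum0 !mulr0 subrr expR0 /tilt big_ord0.
have /andP[h1 h2] := m1 w kn.
have m0 : 0 < m k w by lra.
rewrite tiltS !psumS.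
have -> : l * (psum x k w + x k w) - c * (psum s k w + s k w)
  = (l * psum x k w - c * psum s k w) + (l * x k w - c * s k w) by ring.
rewrite expRD; apply: ler_pM; [exact: expR_ge0|exact: expR_ge0|exact: IH (ltnW kn)|].
rewrite expRD; apply: ler_wpM2l; first exact: expR_ge0.
rewrite expRN lef_pV2 ?posrE ?expR_gt0//.
exact: le_trans h2 (expR_ge1Dx _).
Qed.

(** The change of measure in pointwise form; its integral over [P] is the tail bound under the
    tilt. *)
Lemma tilted_tail_pathwise t w : (t < psum x n w)%R%:R <=
  expR (- (l * t) + c * b) * (expR (- (l * (psum x n w - t))) * (1 - ind_le (fun w => psum x n w - t) 0 w))
    * tilt x m l n w.
Proof.
have T0 : 0 <= tilt x m l n w by apply: le_trans (tilt_ge w (leqnn n)); exact: expR_ge0.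
rewrite /ind_le; have [h|h] := ltP t (psum x n w); last first.
  by rewrite subr_le0 h subrr !mulr0 mul0r.
have h' : (psum x n w <= t) = false by rewrite leNgt h.
rewrite subr_le0 h' -[true%:R]/(1 : R) subr0 mulr1 -expRD.
apply: le_trans (_ : expR (- (l * t) + c * b - l * (psum x n w - t))
   * expR (l * psum x n w - c * psum s n w) <= _).
  rewrite -expRD -[leLHS]expR0 ler_expR.
  by have := ler_wpM2l c0 (sb w); lra.
by rewrite ler_wpM2l ?expR_ge0// tilt_ge.
Qed.

End tilted_tail.

Lemma mart_tail_le_Ex d (T : measurableType d) (R : realType) (P : probability T R)
    (n : nat) (xi : nat -> T -> R) (Z g : T -> R) (t K : R) :
  measurable_fun setT (mart_sum n xi) -> Int P Z g ->
  (forall w, (t < mart_sum n xi w)%R%:R <= K * g w * Z w) ->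
  mart_tail P n xi t <= K * Ex P Z g.
Proof.
move=> mS Ig h; rewrite /mart_tail.
pose A := [set w | t < mart_sum n xi w].
have mA : measurable A.
  have -> : A = mart_sum n xi @^-1` `]t, +oo[.
    by apply/seteqP; split => w /=; rewrite in_itv/= andbT.
  by rewrite -[X in measurable X]setTI; exact: mS.
have AE w : (w \in A) = (t < mart_sum n xi w) :> bool.
  by apply/idP/idP; rewrite inE.
have PA : P A = (\int[P]_w ((t < mart_sum n xi w)%R%:R : R)%:E)%E.
  transitivity (\int[P]_w (\1_A w)%:E)%E; first by rewrite integral_indic// setIT.
  by apply: eq_integral => w _; rewrite indicE AE.
have Kg : Int P Z (fun w => K * g w) by exact: IntZ.
rewrite -ExZ// -lee_fin fineK ?fin_num_measure//.
have -> : (Ex P Z (fun w => K * g w))%:E = (\int[P]_w (K * g w * Z w)%:E)%E.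
  by rewrite /Ex /Rintegral fineK// integrable_fin_num//; exact: Kg.
rewrite -/A PA; apply: ge0_le_integral => //.
- have -> : (fun w => ((t < mart_sum n xi w)%R%:R : R)%:E) = EFin \o \1_A.
    by apply/funext => w; rewrite /= indicE AE.
  by apply/measurable_EFinP; exact: measurable_indic.
- exact: measurable_int Kg.
- by move=> w _; rewrite lee_fin.
Qed.

(** * The tail bound *)

(** The tilt leads to [expR (- xhat^2 / 2)] times [mills xhat + O(h)], an additive error;
    [Phi_tail_ge] makes it relative at the price of the factor [1 + xhat]. *)
Theorem tail_bound (R : realType) : exists2 C : R, 0 < C &
  forall (d : measure_display) (T : measurableType d) (P : probability T R)
    (n : nat) (xi : nat -> T -> R) (F : nat -> set (set T)) (eps delta : R),
    (1 <= n)%N ->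
    martingale_differences P n xi F ->
    bernstein_condition P n xi F eps ->
    quad_char_condition P n xi F delta ->
    forall t : R, 0 <= t ->
      mart_tail P n xi t <=
        (1 - Phi (xhat eps delta t)) *
        (1 + C * (1 + xhat eps delta t) *
           (lambda eps delta t ^+ 2 * eps + lambda eps delta t * delta ^+ 2
              + eps * `|ln eps| + delta)).
Proof.
have [M M0 MP] := @tilt_pathwise R.
have M70 : 0 <= 7 * M by rewrite mulr_ge0// ltW.
have [Cb Cb0 BE] := berry_esseen M70.
have [c c0 Ct] := @Phi_tail_ge R.
pose L1 := 49 * M ^+ 2 + 7 * M.
have L10 : 0 <= L1 by rewrite addr_ge0// mulr_ge0// sqr_ge0.
(* The 8 is 2 for [xhat - lambda] plus 6 for [2 rho]; the remainder is twice the Berry-Esseen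
   bound. *)
pose B := 8 + 2 * (Cb * (L1 + 1)).
have B0 : 0 <= B by rewrite addr_ge0// mulr_ge0// mulr_ge0 ?(ltW Cb0)//; lra.
pose C := (B + (32 + L1)) / c.
exists C; first by rewrite divr_gt0//; lra.
move=> d T P n xi F eps delta n1 md bc qc t t0.
have /andP[e0 e2] := bc.1; have hdel := qc.1; have /andP[d0 d1] := hdel.
pose l := lambda eps delta t; pose xh := xhat eps delta t; rewrite -/l -/xh.
have /andP[l0 lle] : 0 <= l < eps^-1 := lambda_lt delta e0 t0.
have le1 : l * eps < 1 by rewrite -ltr_pdivlMr// div1r.
have [q [q1 _ _ xhE _]] := saddle_point delta e0 t0.
have xh0 : 0 <= xh.
  by rewrite /xh xhE; apply: mulr_ge0; [apply: mulr_ge0 => //; exact: sqrtr_ge0|lra].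
pose h := l ^+ 2 * eps + l * delta ^+ 2 + eps * `|ln eps| + delta; rewrite -/h.
have a1 : 0 <= l ^+ 2 * eps by rewrite mulr_ge0 ?sqr_ge0// ltW.
have a2 : 0 <= l * delta ^+ 2 by rewrite mulr_ge0 ?sqr_ge0.
have a3 : 0 <= eps * `|ln eps| by rewrite mulr_ge0 ?normr_ge0// ltW.
have h0 : 0 <= h by rewrite /h; clear -a1 a2 a3 d0; lra.
pose s := clipped_var P xi F eps delta.
pose X k := xi k.+1.
have cb k : (k < n)%N -> cond_bernstein P (F k) eps (X k) (s k).
  exact: cb_martingale md bc qc k.
have FT k : (k <= n)%N -> F k `<=` measurable by exact: (md_sub md).
have Fincr k : (k < n)%N -> F k `<=` F k.+1 by exact: (md_filtration md).
have mX k : (k < n)%N -> measurable_wrt (F k.+1) (X k).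
  by move=> kn; exact: (md_adapted md).
pose cc := l ^+ 2 / (2 * (1 - l * eps)).
have cc0 : 0 <= cc by rewrite divr_ge0 ?sqr_ge0// mulr_ge0// subr_ge0 ltW.
have [m hm] : exists m : nat -> T -> R, forall k, (k < n)%N ->
    [/\ measurable_wrt (F k) (m k), forall w, 1 <= m k w <= 1 + cc * s k w,
      cond_le P (F k) (fun w => expR (l * X k w)) (m k) &
      cond_le P (F k) (m k) (fun w => expR (l * X k w))].
  suff /boolp.choice[m hm] : forall k, exists m, (k < n)%N ->
    [/\ measurable_wrt (F k) m, forall w, 1 <= m w <= 1 + cc * s k w,
      cond_le P (F k) (fun w => expR (l * X k w)) m &
      cond_le P (F k) m (fun w => expR (l * X k w))] by exists m.
  move=> k; have [kn|kn] := boolP (k < n)%N; last by exists (cst 0).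
  by have [m hm] := exists_cond_mgf (cb k kn) l0 le1; exists m.
have mm k : (k < n)%N -> measurable_wrt (F k) (m k) by move=> /hm[].
have mb k w : (k < n)%N -> 1 <= m k w <= 1 + cc * s k w by move=> /hm[].
have m1 k w : (k < n)%N -> 1 <= m k w by move=> kn; have /andP[] := mb k w kn.
have mle k : (k < n)%N -> cond_le P (F k) (fun w => expR (l * X k w)) (m k) by move=> /hm[].
have mge k : (k < n)%N -> cond_le P (F k) (m k) (fun w => expR (l * X k w)) by move=> /hm[].
pose Z := tilt X m l n.
have hZ : density P Z by exact: density_tilt cb FT Fincr mX mm m1 mle mge.
have vle w : psum s n w <= 1 + delta ^+ 2 by exact: psum_clipped_var_le.
have vge : {ae P, forall w, 1 - delta ^+ 2 <= psum s n w} by exact: psum_clipped_var_ge md bc qc.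
have s0 k w : (k < n)%N -> 0 <= s k w by move=> kn; case/andP: (cb_s (cb k kn) w).
have SE : mart_sum n xi = psum X n.
  by apply/funext => w; rewrite /mart_sum big_add1 big_mkord.
have mS : measurable_fun setT (psum X n).
  apply: (measurable_wrt_fun (FT n (leqnn n))); exact: measurable_wrt_psum Fincr mX n (leqnn n).
pose Y w := psum X n w - t.
have mY : measurable_fun setT Y by rewrite /Y; msolve.
pose g w := expR (- (l * Y w)) * (1 - ind_le Y 0 w).
have g01 w : 0 <= g w <= 1.
  rewrite /g /ind_le; have [b|b] := leP (Y w) 0; first by rewrite subrr mulr0 lexx ler01.
  rewrite subr0 mulr1 expR_ge0 -[leRHS]expR0 ler_expR oppr_le0 mulr_ge0//.
  exact: ltW.
have Ig : Int P Z g.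
  apply: (Int_bounded hZ (M := 1)).
    by apply: measurable_funM; [msolve|apply: measurable_funB; [exact: measurable_cst|exact: measurable_ind_le]].
  by move=> w; have /andP[h1 h2] := g01 w; rewrite ger0_norm.
have tail : mart_tail P n xi t <= expR (- (xh ^+ 2 / 2)) * Ex P Z g.
  rewrite /xh -saddle_exponent//; apply: mart_tail_le_Ex => //; first by rewrite SE.
  by move=> w; rewrite SE; exact: (tilted_tail_pathwise X l cc0 mb vle t w).
have G0 : 0 <= 1 - Phi xh by rewrite subr_ge0 Phi_le1.
have Cxh := Ct xh xh0.
have G1 : 0 <= (1 - Phi xh) * (1 + xh) by rewrite mulr_ge0//; clear -xh0; lra.
have fin K : 0 <= K -> mart_tail P n xi t <= (1 - Phi xh) + expR (- (xh ^+ 2 / 2)) * K * h ->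
    K <= B + (32 + L1) ->
    mart_tail P n xi t <= (1 - Phi xh) * (1 + C * (1 + xh) * h).
  move=> K0 /le_trans + KB; apply.
  have -> : (1 - Phi xh) * (1 + C * (1 + xh) * h)
    = (1 - Phi xh) + (c^-1 * ((1 - Phi xh) * (1 + xh))) * (B + (32 + L1)) * h by rewrite /C; ring.
  rewrite lerD2l ler_wpM2r//; apply: ler_pM => //.
  by rewrite ler_pdivlMl.
(* Above the threshold the trivial bound [Ex P Z g <= 1 <= (32 + L1) h] is enough. Below it,
   [L1 h <= 1] controls [kap] and [mu], and [l^2 eps <= 1 / 32] with [eps <= 1 / 2] gives
   [l eps <= 1 / 8]. *)
have [hs|hl] := leP h (32 + L1)^-1; last first.
  apply: (fin (32 + L1)); [by clear -L10; lra| |by clear -B0; lra].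
  apply: (le_trans tail); apply: ler_wpDl => //.
  rewrite -mulrA; apply: ler_wpM2l; first exact: expR_ge0.
  have : Ex P Z g <= 1.
    rewrite -[leRHS](Ex_cst hZ); apply: (Ex_le hZ) => //; first exact: Int_cst.
    by move=> w; case/andP: (g01 w).
  move/le_trans; apply; rewrite mulrC -ler_pdivrMr; last by clear -L10; lra.
  by rewrite div1r ltW.
have L32 : 0 < 32 + L1 by clear -L10; lra.
have hs' : (32 + L1) * h <= 1 by rewrite -ler_pdivlMl// mulr1.
have lh : l ^+ 2 * eps <= h by rewrite /h; clear -a1 a2 a3 d0; lra.
have L1h : L1 * (l ^+ 2 * eps) <= L1 * h by rewrite ler_wpM2l.
have L1h0 : 0 <= L1 * h by rewrite mulr_ge0.
have kap1 : L1 * (l ^+ 2 * eps) <= 1 by clear -L1h h0 hs'; lra.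
have le0 : 0 <= l * eps by rewrite mulr_ge0// ltW.
have le8 : l * eps <= 1 / 8.
  rewrite -(@ler_pXn2r _ 2) ?nnegrE//.
  have -> : (l * eps) ^+ 2 = l ^+ 2 * eps * eps by ring.
  have : l ^+ 2 * eps * eps <= 1 / 32 * (1 / 2) by apply: ler_pM => //; [exact: ltW|clear -lh h0 hs' L1h0; lra].
  have -> : (1 / 8) ^+ 2 = 1 / 32 * (1 / 2) :> R by field.
  by [].
have mu1 : 7 * M * (l * eps) <= 1.
  rewrite -(@ler_pXn2r _ 2) ?nnegrE//; last exact: mulr_ge0.
  rewrite expr1n.
  have -> : (7 * M * (l * eps)) ^+ 2 = 49 * M ^+ 2 * (l ^+ 2 * eps) * eps by ring.
  apply: le_trans (_ : L1 * (l ^+ 2 * eps) * 1 <= _); last by rewrite mulr1.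
  apply: ler_pM; [by rewrite mulr_ge0// mulr_ge0 ?sqr_ge0|exact: ltW| |by clear -e2; lra].
  by rewrite ler_wpM2r// /L1 lerDl.
have NM := @near_martingale_tilt _ T R P n F X s m eps l delta M e2 hdel l0 n1 cb FT Fincr mX mm
  m1 mle mge vle vge M0 (fun x s hs => MP eps l s x e0 l0 le8 hs) kap1 mu1.
have KD := BE _ _ _ _ _ _ _ _ _ _ _ _ NM.
set U := psum _ n in KD; set D := Cb * _ in KD.
have [xl1 xl2 xl3] := saddle_close e0 hdel t0 le8.
pose rho := 3 * (l ^+ 2 * eps + l * delta ^+ 2).
have rho0 : 0 <= rho by rewrite /rho; clear -a1 a2; lra.
have UE w : U w = psum X n w - l * psum s n w.
  by rewrite /U /psum mulr_sumr -sumrB.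
(* [U] is centred by [l] times the accumulated variance, which is [l] up to [l delta^2], and [Y] by
   [t]; [saddle_close] bounds [t - l]. *)
have YU : {ae P, forall w, `|Y w - U w| <= rho}.
  apply: filterS vge => w vw; rewrite UE /Y.
  have -> : psum X n w - t - (psum X n w - l * psum s n w) = l * (psum s n w - 1) - (t - l) by ring.
  apply: le_trans (ler_normB _ _) _; rewrite normrM (ger0_norm l0).
  have : `|psum s n w - 1| <= delta ^+ 2 
    by rewrite ler_norml; have vw' := vle w; clear -vw vw'; apply/andP; split; lra.
  by move=> /(ler_wpM2l l0); move: xl3; rewrite -/l /rho; clear -a1 a2; lra.
have mUU : measurable_fun setT U.
  have msk k : (k < n)%N -> measurable_wrt (F k) (s k) by move=> kn; exact: cb_ms (cb k kn).
  apply: (measurable_wrt_fun (FT n (leqnn n))); apply: (measurable_wrt_psum Fincr) => //.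
  move=> k kn; have h1 := mX k kn; have h2 := measurable_wrt_sub (Fincr k kn) (msk k kn).
  by rewrite /measurable_wrt in h1 h2 *; msolve.
have Eg := exponential_tail_le hZ mUU mY l0 rho0 YU KD.
have Dh : D <= Cb * (L1 + 1) * h.
  rewrite /D -mulrA ler_wpM2l ?(ltW Cb0)//.
  by move: L1h; rewrite /h /L1; clear -a1 a2 a3 d0 L10; lra.
have ml : mills l - mills xh <= xh - l by apply: millsB_le.
apply: (fin B) => //; last by clear -L10; lra.
apply: (le_trans tail).
have -> : 1 - Phi xh + expR (- (xh ^+ 2 / 2)) * B * h = expR (- (xh ^+ 2 / 2)) * (mills xh + B * h).
  by rewrite [in RHS]mulrDr millsK mulrA.
apply: ler_wpM2l; first exact: expR_ge0.
apply: (le_trans Eg).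
by move: xl2 Dh ml; rewrite -/l -/xh /rho /B; rewrite /h; clear -a1 a2 a3 d0; lra.
Qed.

(** * The asymptotic form *)

Section remainder.
Context {R : realType}.
Implicit Types e x d k : R.

(** [ln y <= y] at [y = 1 / k]. It yields [eps |ln eps| <= 3 eps^(2/3)], which stays small after
    multiplication by [x]. *)
Lemma ln_cube_le k : 0 < k <= 1 -> `|ln (k ^+ 3)| <= 3 * k^-1.
Proof.
move=> /andP[k0 k1].
have l0 : ln k <= 0 by rewrite ln_le0.
rewrite lnXn// ler0_norm; last by rewrite mulrn_wle0.
have -> : - (ln k *+ 3) = 3 * - ln k by ring.
rewrite ler_wpM2l// -lnV ?posrE//.
have := @ln_sublinear R (k^-1); rewrite invr_gt0 => /(_ k0); exact: ltW.
Qed.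

(* With [k = eps^(1/3)] and [u = x (k + delta)]. *)
Lemma remainder_le k d x e C : 0 < k -> k <= 1 -> 0 <= d <= 1 -> 0 <= x -> d <= e -> k ^+ 3 <= e ->
  let u := x * (k + d) in
  forall h l, 0 <= h <= x -> 0 <= l <= x -> 0 <= C ->
  0 <= C * (1 + h) * (l ^+ 2 * k ^+ 3 + l * d ^+ 2 + k ^+ 3 * `|ln (k ^+ 3)| + d)
    <= C * (u * (u * u) + 2 * (u * u) + 5 * u + 6 * Num.sqrt e + e).
Proof.
move=> k0 k1 /andP[d0 d1] x0 de ke u h l /andP[h0 hx] /andP[l0 lx] C0.
have ki : k ^+ 3 * `|ln (k ^+ 3)| <= 3 * k ^+ 2.
  apply: le_trans (ler_wpM2l (exprn_ge0 3 (ltW k0)) (ln_cube_le _)) _; first by rewrite k0.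
  by apply: eq_le_of; field; rewrite gt_eqF.
have ks : k ^+ 2 <= Num.sqrt e.
  rewrite -[leLHS]ger0_norm ?sqr_ge0// -sqrtr_sqr ler_wsqrtr//.
  by apply: le_trans ke; rewrite -exprM (exprSr k 3) ler_piMr// exprn_ge0// ltW.
have k3 : 0 <= k ^+ 3 by rewrite exprn_ge0// ltW.
have d2 : 0 <= d ^+ 2 by exact: sqr_ge0.
have kl0 : 0 <= k ^+ 3 * `|ln (k ^+ 3)| by rewrite mulr_ge0.
have t1 : 0 <= l ^+ 2 * k ^+ 3 <= x ^+ 2 * k ^+ 3.
  by rewrite mulr_ge0 ?sqr_ge0//= ler_wpM2r// ler_sqr_of.
have t2 : 0 <= l * d ^+ 2 <= x * d ^+ 2 by rewrite mulr_ge0//= ler_wpM2r.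
case/andP: t1 => t10 t11; case/andP: t2 => t20 t21.
rewrite -mulrA mulr_ge0//=; last by rewrite mulr_ge0//; lra.
rewrite ler_wpM2l//.
apply: (@le_trans _ _ ((1 + x) * (x ^+ 2 * k ^+ 3 + x * d ^+ 2 + 3 * k ^+ 2 + d))).
  by apply: ler_pM; lra.
(* As [p + v = u], every term containing [x] is controlled by powers of [u]; the two terms without
   [x], [3 k^2] and [d], are bounded through [k^2 <= sqrt e] and [d <= e]. *)
pose p := x * k; pose v := x * d.
have p0 : 0 <= p by rewrite mulr_ge0// ltW.
have v0 : 0 <= v by rewrite mulr_ge0.
have b1 : p ^+ 2 * k <= p ^+ 2 by rewrite ler_piMr// sqr_ge0.
have b2 : v * d <= v by rewrite ler_piMr.
have b3 : p * k <= p by rewrite ler_piMr.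
have -> : (1 + x) * (x ^+ 2 * k ^+ 3 + x * d ^+ 2 + 3 * k ^+ 2 + d)
  = p ^+ 2 * k + v * d + 3 * k ^+ 2 + d + p ^+ 3 + v ^+ 2 + 3 * (p * k) + v.
  by rewrite /p /v; ring.
have -> : u = p + v by rewrite /u mulrDr.
have c1 : 0 <= p * v by rewrite mulr_ge0.
have c2 : 0 <= p * (p * v) by rewrite mulr_ge0.
have c3 : 0 <= v * (p * v) by rewrite mulr_ge0.
have c4 : 0 <= v ^+ 3 by rewrite exprn_ge0.
have c5 : 0 <= p ^+ 2 by exact: sqr_ge0.
have c6 : 0 <= v ^+ 2 by exact: sqr_ge0.
have c7 : 0 <= Num.sqrt e by exact: sqrtr_ge0.
have -> : (p + v) * ((p + v) * (p + v)) = p ^+ 3 + 3 * (p * (p * v)) + 3 * (v * (p * v)) + v ^+ 3.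
  by ring.
have -> : (p + v) * (p + v) = p ^+ 2 + 2 * (p * v) + v ^+ 2 by ring.
by lra.
Qed.

End remainder.

Theorem theorem2p3 (R : realType) :
  (exists C : R, 0 < C /\
    forall (d : measure_display) (T : measurableType d) (P : probability T R)
      (n : nat) (xi : nat -> T -> R) (F : nat -> set (set T)) (eps delta : R),
      (1 <= n)%N ->
      martingale_differences P n xi F ->
      bernstein_condition P n xi F eps ->
      quad_char_condition P n xi F delta ->
      forall x : R, 0 <= x ->
        0 <= lambda eps delta x < eps^-1 /\
        mart_tail P n xi x <=
          (1 - Phi (xhat eps delta x)) *
          (1 + C * (1 + xhat eps delta x) *
             (lambda eps delta x ^+ 2 * eps + lambda eps delta x * delta ^+ 2
                + eps * `|ln eps| + delta)))
  /\
  (forall (d : nat -> measure_display) (T : forall m, measurableType (d m))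
      (P : forall m, probability (T m) R) (n : nat -> nat)
      (xi : forall m, nat -> T m -> R) (F : forall m, nat -> set (set (T m)))
      (eps delta x : nat -> R),
      (forall m, (1 <= n m)%N) ->
      (forall m, martingale_differences (P m) (n m) (xi m) (F m)) ->
      (forall m, bernstein_condition (P m) (n m) (xi m) (F m) (eps m)) ->
      (forall m, quad_char_condition (P m) (n m) (xi m) (F m) (delta m)) ->
      (forall m, 0 <= x m) ->
      Num.max (eps m) (delta m) @[m --> \oo] --> (0 : R) ->
      x m * (eps m `^ 3^-1 + delta m) @[m --> \oo] --> (0 : R) ->
      exists r : nat -> R, r m @[m --> \oo] --> (0 : R) /\
        forall m, mart_tail (P m) (n m) (xi m) (x m) <=
          (1 - Phi (xhat (eps m) (delta m) (x m))) * (1 + r m)).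
Proof.
have [C C0 tail] := tail_bound R.
split.
  exists C; split => // d T P n xi F eps delta n1 md bc qc x x0.
  split; last exact: tail n1 md bc qc x x0.
  by apply: lambda_lt => //; have /andP[] := bc.1.
move=> d T P n xi F eps delta x n1 md bc qc x0 cvg_max cvg_u.
(* The error of the nonasymptotic bound itself serves as [r]; it remains to squeeze it between 0 and
   a sequence tending to 0. *)
pose r m := C * (1 + xhat (eps m) (delta m) (x m)) *
  (lambda (eps m) (delta m) (x m) ^+ 2 * eps m + lambda (eps m) (delta m) (x m) * delta m ^+ 2
    + eps m * `|ln (eps m)| + delta m).
exists r; split; last by move=> m; exact: tail (n1 m) (md m) (bc m) (qc m) _ (x0 m).
pose e m := Num.max (eps m) (delta m).
pose u m := x m * (eps m `^ 3^-1 + delta m).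
pose b m := C * (u m * (u m * u m) + 2 * (u m * u m) + 5 * u m + 6 * Num.sqrt (e m) + e m).
have cvg_b : b m @[m --> \oo] --> (0 : R).
  have cvg_s : Num.sqrt (e m) @[m --> \oo] --> (0 : R).
    by rewrite -sqrtr0; apply: continuous_cvg => //; exact: sqrt_continuous.
  have -> : (0 : R) = C * (0 * (0 * 0) + 2 * (0 * 0) + 5 * 0 + 6 * 0 + 0) by ring.
  apply: cvgM; first exact: cvg_cst.
  apply: cvgD => //; apply: cvgD; last by apply: cvgM => //; exact: cvg_cst.
  apply: cvgD; last by apply: cvgM => //; exact: cvg_cst.
  have cvg_uu : u m * u m @[m --> \oo] --> (0 * 0 : R) by exact: cvgM.
  apply: cvgD; last by apply: cvgM => //; exact: cvg_cst.
  exact: cvgM.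
suff rb m : 0 <= r m <= b m.
  apply: (squeeze_cvgr _ (cvg_cst (0 : R)) cvg_b); exact: nearW.
have /andP[e0 e2] := (bc m).1; have hd := (qc m).1; have /andP[d0 d1] := hd.
pose k := eps m `^ 3^-1.
have k0 : 0 < k by rewrite powR_gt0.
have kE : k ^+ 3 = eps m.
  by rewrite -powR_mulrn ?powR_ge0// -powRrM mulVf// powRr1// ltW.
have k1 : k <= 1 by rewrite -(@ler_pXn2r _ 3) ?nnegrE ?(ltW k0)// expr1n kE; lra.
have [q [q1 _ _ xhE lx]] := saddle_point (delta m) e0 (x0 m).
have /andP[l0 _] := lx.
(* Both square roots are at least 1, so the denominators multiply to at least 2. *)
have hx : 0 <= xhat (eps m) (delta m) (x m) <= x m.
  have a0 : 0 <= 2 * x m * eps m / (1 + delta m ^+ 2).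
    by rewrite divr_ge0 ?addr_ge0 ?sqr_ge0// !mulr_ge0// ltW.
  have r1 : 1 <= Num.sqrt (1 + delta m ^+ 2).
    by rewrite -[leLHS]sqrtr1 ler_wsqrtr// lerDl sqr_ge0.
  have r2 : 1 <= Num.sqrt (1 + 2 * x m * eps m / (1 + delta m ^+ 2)).
    by rewrite -[leLHS]sqrtr1 ler_wsqrtr// lerDl.
  have xm := x0 m; rewrite /xhat; apply/andP; split.
    by apply: divr_ge0; [apply: divr_ge0; [exact: mulr_ge0|lra]|lra].
  rewrite ler_pdivrMr; last by lra.
  rewrite ler_pdivrMr; last by lra.
  have h2 : 2 * 1 <= (1 + Num.sqrt (1 + 2 * x m * eps m / (1 + delta m ^+ 2)))
      * Num.sqrt (1 + delta m ^+ 2) by apply: ler_pM => //; lra.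
  by have := ler_wpM2l xm h2; rewrite mulr1 (mulrC (x m) 2) mulrA.
have := remainder_le k0 k1 hd (x0 m) (_ : delta m <= e m) (_ : k ^+ 3 <= e m) hx lx (ltW C0).
by rewrite kE; apply; rewrite le_max lexx ?orbT.
Qed.
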